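(* Let $n\ge 3$ and assume that $\alpha\in L^\infty(\partial\Omega;\mathbb{C})$ is such that $\operatorname{Re}\alpha\ge|\operatorname{Im}\alpha|$ (almost everywhere on $\partial\Omega$). If there exist non-negative numbers $b_1,b_2$ satisfying $$2C^*\,[\,b_1+S^*b_2\,]<1$$ such that $$\|x\,\alpha\|_{L^\infty(\partial\Omega)}\le b_1\qquad\text{and}\qquad \|(-\Delta)^{1/4}(x\,\alpha)\|_{L^{2(n-1)}(\partial\Omega)}\le b_2 ,$$ then the Robin Laplacian has no eigenvalues: $\sigma_{\mathrm p}(-\Delta_\alpha^\Omega)=\varnothing$.
   Context: $\Omega:=\mathbb{R}^{n-1}\times(0,\infty)$ is the upper half-space, with $\partial\Omega$ identified with $\mathbb{R}^{n-1}$; points are $x=(x',x_n)$ with $x'=(x_1,\dots,x_{n-1})$, and on $\partial\Omega$ one has $x=(x',0)$. For $\alpha\in L^\infty(\partial\Omega;\mathbb{C})$, the Robin Laplacian $-\Delta_\alpha^\Omega$ is the m-sectorial operator in $L^2(\Omega)$ associated, via the first representation theorem, with the closed form $h_\alpha[u]:=\int_\Omega|\nabla u|^2\,dx+\int_{\partial\Omega}\alpha|u|^2\,d\sigma$, $\mathcal{D}(h_\alpha):=H^1(\Omega)$ (boundary values in the sense of traces). That is, $u\in\mathcal{D}(-\Delta_\alpha^\Omega)$ iff $u\in H^1(\Omega)$ and there is $w_u\in L^2(\Omega)$ such that $\int_\Omega\nabla u\cdot\overline{\nabla v}\,dx+\int_{\partial\Omega}\alpha u\bar v\,d\sigma=\int_\Omega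 w_u\bar v\,dx$ for all $v\in H^1(\Omega)$, and then $-\Delta_\alpha^\Omega u:=w_u$. $\sigma_{\mathrm p}(H)$ is the set of eigenvalues of a closed operator $H$. $(-\Delta)^{1/4}$ is the fractional Laplacian on $\mathbb{R}^{n-1}$, defined in the standard way via the Fourier transform as the multiplier $|\xi|^{1/2}$. Set $2^*:=2(n-1)/(n-2)$. $C^*$ is the smallest constant $C$ (depending on $n$) such that the fractional Leibniz rule $$\|(-\Delta)^{1/4}(fg)\|_{L^2(\mathbb{R}^{n-1})}\le C\big[\|f\|_{L^\infty(\mathbb{R}^{n-1})}\|(-\Delta)^{1/4}g\|_{L^2(\mathbb{R}^{n-1})}+\|(-\Delta)^{1/4}f\|_{L^{2(n-1)}(\mathbb{R}^{n-1})}\|g\|_{L^{2^*}(\mathbb{R}^{n-1})}\big]$$ holds for complex-valued functions $f,g$ on $\mathbb{R}^{n-1}$ (a particular case of the homogeneous Kato–Ponce inequality, so such a finite constant exists). $S^*$ is the smallest constant $S$ such that the fractional Sobolev inequality $\|f\|_{L^{2^*}(\mathbb{R}^{n-1})}\le S\,\|(-\Delta)^{1/4}f\|_{L^2(\mathbb{R}^{n-1})}$ holds, quantifying the embedding $\dot H^{1/2}(\mathbb{R}^{n-1})\hookrightarrow L^{2^*}(\mathbb{R}^{n-1})$. The product $x\,\alpha$ is the vector-valued function $x\mapsto x\,\alpha(x)$ on $\partial\Omega$, and $(-\Delta)^{1/4}$ acts on it componentwise. The $L^p$ norm of a vector-valued function is the $L^p$ norm of its pointwise Euclidean length; in particular $\|x\,\alpha\|_{L^\infty(\partial\Omega)}=\operatorname{ess\,sup}_{x\in\partial\Omega}|x|\,|\alpha(x)|$.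 *)

(* Defs.v *)
From HB Require Import structures.
From mathcomp Require Import all_boot all_order all_algebra.
From mathcomp Require Import complex.
From mathcomp Require Import all_classical all_reals all_analysis.

Set Implicit Arguments.
Unset Strict Implicit.
Unset Printing Implicit Defensive.
Import Order.TTheory GRing.Theory Num.Theory.
Import numFieldNormedType.Exports.

Local Open Scope classical_set_scope.
Local Open Scope ring_scope.
Local Open Scope complex_scope.

Definition measure_rV_display : measure_display. Proof. exact: default_measure_display. Qed.

Section measurable_rV.
Context (R : realType) (d : nat).

Definition coord_rV (i : 'I_d) (x : 'rV[R]_d) : R := x ord0 i.

Let rV_set0 : g_sigma_preimage coord_rV set0.
Proof. exact: sigma_algebra0. Qed.

Let rV_setC A : g_sigma_preimage coord_rV A -> g_sigma_preimage coord_rV (~` A).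
Proof. exact: sigma_algebraC. Qed.

Let rV_bigcup (F : (set 'rV[R]_d)^nat) :
  (forall i, g_sigma_preimage coord_rV (F i)) ->
  g_sigma_preimage coord_rV (\bigcup_i F i).
Proof. exact: sigma_algebra_bigcup. Qed.

HB.instance Definition _ := @isMeasurable.Build measure_rV_display
  'rV[R]_d (g_sigma_preimage coord_rV) rV_set0 rV_setC rV_bigcup.

Lemma measurable_coord_rV (i : 'I_d) : measurable_fun [set: 'rV[R]_d] (coord_rV i).
Proof.
move=> _ Y mY; rewrite setTI; apply: sub_sigma_algebra => /=.
rewrite -bigcup_seq/=; exists i => /=; first by rewrite mem_index_enum.
by exists Y => //; rewrite setTI.
Qed.

Lemma measurable_fun_rVP d1 (T1 : measurableType d1) (f : T1 -> 'rV[R]_d) :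
  (forall i, measurable_fun [set: T1] (coord_rV i \o f)) ->
  measurable_fun [set: T1] f.
Proof.
move=> mf _ A mA; rewrite setTI.
suff : g_sigma_preimage (fun i => coord_rV i \o f) `<=` measurable.
  by apply; rewrite g_sigma_preimage_comp; exists A => //; rewrite setTI.
apply: smallest_sub; first exact: sigma_algebra_measurable.
move=> B; rewrite -bigcup_seq/= => -[i _ [C mC <-]].
exact: mf.
Qed.

End measurable_rV.

Section lebesgue_rV.
Context (R : realType).

Definition rV_cons (d : nat) (p : R * 'rV[R]_d) : 'rV[R]_d.+1 :=
  \row_i oapp (fun j => p.2 ord0 j) p.1 (unlift ord0 i).

Definition rV_uncons (d : nat) (x : 'rV[R]_d.+1) : R * 'rV[R]_d :=
  (x ord0 ord0, \row_j x ord0 (lift ord0 j)).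

Lemma rV_consK d : cancel (@rV_cons d) (@rV_uncons d).
Proof.
move=> [t x]; congr pair; first by rewrite mxE unlift_none.
by apply/rowP => j; rewrite !mxE liftK.
Qed.

Lemma measurable_rV_cons d : measurable_fun setT (@rV_cons d).
Proof.
apply: measurable_fun_rVP => i.
case: (unliftP ord0 i) => [j|] ->.
  rewrite (_ : _ \o _ = coord_rV j \o snd); last first.
    by apply/funext => p; rewrite /= /coord_rV mxE liftK.
  exact: measurableT_comp (measurable_coord_rV j) _.
rewrite (_ : _ \o _ = fst) //.
by apply/funext => p; rewrite /= /coord_rV mxE unlift_none.
Qed.

Lemma measurable_rV_uncons d : measurable_fun setT (@rV_uncons d).
Proof.
apply: measurable_fun_pair; first exact: (@measurable_coord_rV R d.+1 ord0).
apply: measurable_fun_rVP => i.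
rewrite (_ : _ \o _ = coord_rV (lift ord0 i)); first exact: measurable_coord_rV.
by apply/funext => p; rewrite /= /coord_rV mxE.
Qed.

Definition lebesgue_cons d (m : {sigma_finite_measure set 'rV[R]_d -> \bar R}) :=
  pushforward (lebesgue_measure \x m)%E (@rV_cons d).

Section lebesgue_cons.
Context d (m : {sigma_finite_measure set 'rV[R]_d -> \bar R}).

Let lebesgue_cons0 : lebesgue_cons m set0 = 0%E.
Proof. by rewrite /lebesgue_cons /pushforward preimage_set0 measure0. Qed.

Let lebesgue_cons_ge0 A : (0 <= lebesgue_cons m A)%E.
Proof. by rewrite /lebesgue_cons /pushforward; exact: measure_ge0. Qed.

Let lebesgue_cons_sigma_additive : semi_sigma_additive (lebesgue_cons m).
Proof.
move=> F mF tF mUF; rewrite /lebesgue_cons /pushforward preimage_bigcup.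
have mc := @measurable_rV_cons d.
apply: measure_semi_sigma_additive.
- by move=> n; rewrite -[X in measurable X]setTI; exact: mc.
- apply/trivIsetP => /= i j _ _ ij; rewrite -preimage_setI.
  by move/trivIsetP : tF => /(_ _ _ _ _ ij) ->//; rewrite preimage_set0.
- by rewrite -preimage_bigcup -[X in measurable X]setTI; exact: mc.
Qed.

HB.instance Definition _ := isMeasure.Build _ _ _ (lebesgue_cons m)
  lebesgue_cons0 lebesgue_cons_ge0 lebesgue_cons_sigma_additive.

Let lebesgue_cons_sigma_finite : sigma_finite setT (lebesgue_cons m).
Proof.
have /sigma_finiteP[F [TF ndF Foo]] := sigma_finiteT (@lebesgue_measure R).
have /sigma_finiteP[G [TG ndG Goo]] := sigma_finiteT m.
exists (fun k => @rV_uncons d @^-1` (F k `*` G k)).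
  apply/esym/seteqP; split => // x _.
  have [k1 _ Fk1] : (\bigcup_k F k) (rV_uncons x).1 by rewrite -TF.
  have [k2 _ Gk2] : (\bigcup_k G k) (rV_uncons x).2 by rewrite -TG.
  exists (maxn k1 k2) => //; split.
  - by move: Fk1; exact/subsetPset/ndF/leq_maxl.
  - by move: Gk2; exact/subsetPset/ndG/leq_maxr.
move=> k; have [mF Fk] := Foo k; have [mG Gk] := Goo k; split.
  rewrite -[X in measurable X]setTI; apply: measurable_rV_uncons => //.
  exact: measurableX.
rewrite /lebesgue_cons /pushforward -comp_preimage.
rewrite (_ : @rV_uncons d \o @rV_cons d = id); last exact/funext/rV_consK.
by rewrite product_measure1E// lte_mul_pinfty// ge0_fin_numE.
Qed.

HB.instance Definition _ := Measure_isSigmaFinite.Build _ _ _ (lebesgue_cons m)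
  lebesgue_cons_sigma_finite.

End lebesgue_cons.

Fixpoint lebesgue_rV (d : nat) : {sigma_finite_measure set 'rV[R]_d -> \bar R} :=
  match d with
  | 0%N => dirac (0 : 'rV[R]_0)
  | d'.+1 => lebesgue_cons (lebesgue_rV d')
  end.

End lebesgue_rV.
Arguments lebesgue_rV {R} d.

Local Notation Re := complex.Re.
Local Notation Im := complex.Im.
Local Notation normc := ComplexField.Normc.normc.

Section complex_lebesgue.
Context dp (T : measurableType dp) (R : realType).
Implicit Types (mu : {measure set T -> \bar R}) (D : set T) (p : \bar R).
Implicit Type f : T -> R[i].

Definition cmeasurable D f :=
  measurable_fun D (fun x => Re (f x)) /\ measurable_fun D (fun x => Im (f x)).

Definition cintegral mu D f : R[i] :=
  (\int[mu]_(x in D) Re (f x)) +i* (\int[mu]_(x in D) Im (f x)).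

Definition cLnorm mu D p f : \bar R :=
  Lnorm mu p (fun x => (\1_D x * normc (f x))%:E).

Definition in_Lp mu D p f := cmeasurable D f /\ (cLnorm mu D p f < +oo)%E.

End complex_lebesgue.

Section test_functions.
Context (R : realType) (V : normedModType R).
Implicit Types (f : V -> R[i]) (U : set V).

Definition cderive (v : V) f : V -> R[i] := fun x =>
  'D_v (fun y => Re (f y)) x +i* 'D_v (fun y => Im (f y)) x.

Definition cdifferentiable f (x : V) :=
  differentiable (fun y => Re (f y)) x /\ differentiable (fun y => Im (f y)) x.

Definition cderives (vs : seq V) f := foldr cderive f vs.

Definition csmooth f := forall vs x, cdifferentiable (cderives vs f) x.

Definition test_function U f :=
  csmooth f /\
  exists K : set V, [/\ compact K, K `<=` U & forall x, ~ K x -> f x = 0].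

Definition schwartz f :=
  csmooth f /\
  forall (N : nat) vs, exists M : R,
    forall x, `|x| ^+ N * normc (cderives vs f x) <= M.

End test_functions.

Section fractional_laplacian.
Context (R : realType) (d : nat).
Local Notation Rd := 'rV[R]_d.
Local Notation mu := (lebesgue_rV d).
Implicit Types (f g : Rd -> R[i]).

Definition dotr (x y : Rd) : R := \sum_(i < d) x ord0 i * y ord0 i.

(* the norm `|x| of 'rV[R]_d is the max-norm *)
Definition clength k (z : 'rV[R[i]]_k) : R :=
  Num.sqrt (\sum_(i < k) normc (z ord0 i) ^+ 2).

Definition rlength (x : Rd) : R := Num.sqrt (dotr x x).

Definition cis (t : R) : R[i] := cos t +i* sin t.

Definition fourier f (xi : Rd) : R[i] :=
  cintegral mu setT (fun x => cis (- dotr x xi) * f x).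

Definition inv_fourier f (x : Rd) : R[i] :=
  (((2 * pi) ^+ d)^-1)%:C *
  cintegral mu setT (fun xi => cis (dotr x xi) * f xi).

Definition quarter_laplacian_schwartz f : Rd -> R[i] :=
  inv_fourier (fun xi => (rlength xi `^ 2^-1)%:C * fourier f xi).

(* (-Delta)^(1/4) f = g in the sense of distributions. The multiplier
   |xi|^(1/2) is even, so (-Delta)^(1/4) is symmetric for the bilinear pairing.
   For phi Schwartz, (-Delta)^(1/4) phi is bounded and O(|x|^(-d-1/2)), hence
   integrable against every f in L^p, 1 <= p <= oo; but it is not Schwartz,
   which is why f is not an arbitrary tempered distribution. *)
Definition is_quarter_laplacian f g :=
  forall phi, schwartz phi ->
    cintegral mu setT (fun x => f x * quarter_laplacian_schwartz phi x) =
    cintegral mu setT (fun x => g x * phi x).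

(* With d = n - 1, this is 2^* = 2 (n - 1) / (n - 2). *)
Definition sobolev_exponent : R := (2 * d)%:R / d.-1%:R.

Local Notation p_crit := (sobolev_exponent%:E).
Local Notation p_leib := ((2 * d)%:R%:E : \bar R).
Local Notation "'L_' p f" := (cLnorm mu setT p f)
  (at level 10, p at level 2, f at level 9).

(* g = (-Delta)^(1/4) f with f in the homogeneous space \dot H^(1/2)(R^d),
   realized as a space of functions in L^(2^* ); asking for f in L^(2^* )
   excludes constants, which (-Delta)^(1/4) annihilates. *)
Definition in_homogeneous_H12 f g :=
  [/\ in_Lp mu setT p_crit f, in_Lp mu setT 2%:E g & is_quarter_laplacian f g].

Definition fractional_leibniz (C : R) :=
  forall f f' g g',
    in_Lp mu setT +oo%E f -> in_Lp mu setT p_leib f' ->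
    is_quarter_laplacian f f' ->
    in_homogeneous_H12 g g' ->
    exists h, [/\ in_Lp mu setT 2%:E h,
      is_quarter_laplacian (fun x => f x * g x) h &
      (L_ (2%:E) h <= C%:E * (L_ (+oo) f * L_ (2%:E) g' +
                              L_ p_leib f' * L_ p_crit g))%E].

Definition fractional_sobolev (S : R) :=
  forall f f', in_homogeneous_H12 f f' ->
    (L_ p_crit f <= S%:E * L_ (2%:E) f')%E.

(* The infima are attained when the sets are nonempty, so these are the smallest
   admissible constants; they are +oo if no constant is admissible. *)
Definition leibniz_constant : \bar R :=
  ereal_inf [set C%:E | C in [set C : R | 0 <= C /\ fractional_leibniz C]].

Definition sobolev_constant : \bar R :=
  ereal_inf [set S%:E | S in [set S : R | 0 <= S /\ fractional_sobolev S]].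

Definition xmul (alpha : Rd -> R[i]) (x : Rd) : 'rV[R[i]]_d :=
  \row_i ((x ord0 i)%:C * alpha x).

Definition vLnorm (p : \bar R) (F : Rd -> 'rV[R[i]]_d) : \bar R :=
  Lnorm mu p (fun x => (clength (F x))%:E).

Definition is_vquarter_laplacian (F G : Rd -> 'rV[R[i]]_d) :=
  forall i : 'I_d, cmeasurable setT (fun x => G x ord0 i) /\
    is_quarter_laplacian (fun x => F x ord0 i) (fun x => G x ord0 i).

End fractional_laplacian.

Section robin_laplacian.
Context (R : realType) (d : nat).
Local Notation pt := ('rV[R]_d * R)%type.
Local Notation mu := (lebesgue_rV d \x lebesgue_measure)%E.
Local Notation sigma := (lebesgue_rV d).
Implicit Types (u v w : pt -> R[i]) (Du Dv : 'I_d.+1 -> pt -> R[i]).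
Implicit Types (tu tv : 'rV[R]_d -> R[i]) (alpha : 'rV[R]_d -> R[i]).

Definition half_space : set pt := [set x | 0 < x.2].
Local Notation Omega := half_space.

Definition L2 u := in_Lp mu Omega 2%:E u.

(* the canonical basis of R^(d+1); the last vector is normal to the boundary *)
Definition basis_vector (i : 'I_d.+1) : pt :=
  if unlift ord_max i is Some j then (delta_mx ord0 j, 0) else (0, 1).

Definition weak_derivative (i : 'I_d.+1) u v :=
  forall phi, test_function Omega phi ->
    cintegral mu Omega (fun x => u x * cderive (basis_vector i) phi x) =
    - cintegral mu Omega (fun x => v x * phi x).

Definition in_H1 u Du :=
  L2 u /\ forall i, L2 (Du i) /\ weak_derivative i u (Du i).

(* tu is the trace of u: the restriction of C_c^oo functions to the boundary,
   extended by density to H^1(Omega) *)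
Definition is_trace u Du tu :=
  in_Lp sigma setT 2%:E tu /\
  exists phi : nat -> pt -> R[i],
    [/\ forall k, test_function setT (phi k),
      cLnorm mu Omega 2%:E (fun x => phi k x - u x) @[k --> \oo] --> (0 : \bar R),
      forall i, cLnorm mu Omega 2%:E
        (fun x => cderive (basis_vector i) (phi k) x - Du i x)
          @[k --> \oo] --> (0 : \bar R) &
      cLnorm sigma setT 2%:E (fun x => phi k (x, 0) - tu x)
        @[k --> \oo] --> (0 : \bar R)].

Definition robin_form alpha Du tu Dv tv : R[i] :=
  \sum_(i < d.+1) cintegral mu Omega (fun x => Du i x * (Dv i x)^*) +
  cintegral sigma setT (fun x => alpha x * tu x * (tv x)^*).

(* the graph of the operator: u is in its domain and is mapped to w *)
Definition robin_laplacian alpha u w :=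
  L2 w /\
  exists Du tu, [/\ in_H1 u Du, is_trace u Du tu &
    forall v Dv tv, in_H1 v Dv -> is_trace v Dv tv ->
      robin_form alpha Du tu Dv tv =
      cintegral mu Omega (fun x => w x * (v x)^*)].

Definition point_spectrum (H : (pt -> R[i]) -> (pt -> R[i]) -> Prop) : set R[i] :=
  [set lambda | exists u, H u (fun x => lambda * u x) /\
     ~ {ae mu, forall x, Omega x -> u x = 0}].

End robin_laplacian.

(* Main.v *)
Require Import Defs.
From HB Require Import structures.
From mathcomp Require Import all_boot all_order all_algebra.
From mathcomp Require Import complex ring lra.
From mathcomp Require Import all_classical all_reals all_analysis.
From mathcomp Require Import measurable_realfun ess_sup_inf.
Import Order.TTheory GRing.Theory Num.Theory.
Import numFieldNormedType.Exports.
Local Open Scope classical_set_scope.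
Local Open Scope ring_scope.
Local Open Scope complex_scope.

(** Formally, the boundary values [g] of an eigenfunction satisfy [(kappa + alpha) g = 0]
    with [kappa = sqrt (- Delta' - lambda)], [Delta'] the Laplacian of the boundary and
    [Re kappa >= 0]; taking real parts of [<(kappa + alpha) g, g>] gives [g = 0]. This is
    made rigorous on test functions [phi] close to the eigenfunction [u], which satisfy
    the weak equation up to a small error.

    If [lambda] is real, testing with the dilations [phi (y, c t)] and [phi (y, t / c)]
    and eliminating the tangential terms gives [(c^2 - 1) Re <d_t phi, d_t phi (y, c t)> <= o(1)],
    because the boundary term has a nonnegative real part. Hence [d_t u = 0], and [u = 0]
    since [u] is square-integrable.

    If [lambda] is not real, test with [psi = e^{- kappa^* t} phi (., 0)], where [kappa] is
    computed in the finite-dimensional span of finitely many slices of [phi] in [t]: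
    diagonalizing the tangential Dirichlet form there makes [psi] an explicit sum of
    exponentials. The real part of the form at [(phi, psi)] is then, up to small errors,
    [B = <Re kappa phi (., 0), phi (., 0)>], and the energy of [psi] is [O(B)] because
    [|kappa|^2 + D = 2 (Re kappa)^2 + Re lambda] for [kappa^2 = D - lambda]. So
    [B <= o(1) sqrt B]; as [Re kappa] is bounded below, the trace of [u] vanishes, and the
    imaginary part of the energy identity gives [u = 0]. *)

Set Implicit Arguments.
Unset Strict Implicit.
Unset Printing Implicit Defensive.
Local Notation Re := complex.Re.
Local Notation Im := complex.Im.
Local Notation normc := ComplexField.Normc.normc.

(** * Complex-valued square-integrable functions *)

Section complex_algebra.
Variable R : realType.
Implicit Types x y z : R[i].

(** The case split is forced by [kappa]. For non-real [lambda], [Re kappa] is bounded below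
    uniformly in the tangential energy; for positive [lambda], [kappa] is imaginary at low
    tangential frequencies and no decaying exponential is available there. The dilations are a
    finite form of the virial argument with multiplier [t d_t u], which need not lie in H^1.

    The eigenfunction is known only as a limit of test functions, so each step is a quantitative
    estimate on a single [phi]. In the non-real case the grid, the finite-dimensional span and the
    cutoff all depend on [phi]; the argument closes because the constant bounding the energy of
    [psi] by [B] does not. Interpolation in [t] makes the span finite-dimensional and writes [phi]
    as a finite sum of products. Since the exponentials satisfy the one-dimensional equation exactly
    against each piecewise linear profile, discretization costs only the interpolation error of
    [phi] and of its first derivatives. *)

Definition cj z : R[i] := Re z -i* Im z.

Definition nsq z : R := Re z ^+ 2 + Im z ^+ 2.

Lemma nsq_ge0 z : 0 <= nsq z.
Proof. by rewrite addr_ge0 ?sqr_ge0. Qed.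

Lemma normc_sqr z : normc z ^+ 2 = nsq z.
Proof. by case: z => a b; rewrite /nsq /= sqr_sqrtr// addr_ge0 ?sqr_ge0. Qed.

Lemma nsqM x y : nsq (x * y) = nsq x * nsq y.
Proof. by case: x => a b; case: y => c d; rewrite /nsq /=; ring. Qed.

Lemma nsqN x : nsq (- x) = nsq x.
Proof. by case: x => a b; rewrite /nsq /=; ring. Qed.

Lemma nsqJ x : nsq (cj x) = nsq x.
Proof. by case: x => a b; rewrite /nsq /=; ring. Qed.

Lemma nsq_real (a : R) : nsq a%:C = a ^+ 2.
Proof. by rewrite /nsq /=; ring. Qed.

Lemma nsq0 : nsq 0 = 0.
Proof. by rewrite /nsq /=; ring. Qed.

Lemma nsq_eq0 z : (nsq z == 0) = (z == 0).
Proof.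
by case: z => a b; rewrite eq_complex /nsq /= paddr_eq0 ?sqr_ge0// !sqrf_eq0.
Qed.

Lemma nsqD_le x y : nsq (x + y) <= 2 * nsq x + 2 * nsq y.
Proof.
case: x => a b; case: y => c d; rewrite /nsq /=.
rewrite -subr_ge0 [leRHS](_ : _ = (a - c) ^+ 2 + (b - d) ^+ 2); last by ring.
by rewrite addr_ge0 ?sqr_ge0.
Qed.

Lemma mulcJ_nsq z : z * (cj z) = (nsq z)%:C.
Proof. by case: z => a b; rewrite /cj /nsq /=; congr (_ +i* _) => /=; ring. Qed.

Lemma normr_Re_le z : `|Re z| <= normc z.
Proof.
case: z => a b /=; rewrite -sqrtr_sqr ler_wsqrtr// lerDl sqr_ge0 //.
Qed.

Lemma normr_Im_le z : `|Im z| <= normc z.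
Proof.
by case: z => a b /=; rewrite -sqrtr_sqr ler_wsqrtr// lerDr sqr_ge0.
Qed.

Lemma ReM x y : Re (x * y) = Re x * Re y - Im x * Im y.
Proof. by case: x; case: y. Qed.

Lemma ImM x y : Im (x * y) = Re x * Im y + Im x * Re y.
Proof. by case: x; case: y. Qed.

Lemma ReD x y : Re (x + y) = Re x + Re y.
Proof. by case: x; case: y. Qed.

Lemma ImD x y : Im (x + y) = Im x + Im y.
Proof. by case: x; case: y. Qed.

Lemma ReN x : Re (- x) = - Re x. Proof. by case: x. Qed.
Lemma ImN x : Im (- x) = - Im x. Proof. by case: x. Qed.
Lemma ReJ x : Re (cj x) = Re x. Proof. by case: x. Qed.
Lemma ImJ x : Im (cj x) = - Im x. Proof. by case: x. Qed.

Lemma eqc x y : Re x = Re y -> Im x = Im y -> x = y.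
Proof. by case: x => a b; case: y => c d /= -> ->. Qed.

Lemma conjD x y : cj (x + y) = cj x + cj y.
Proof. by apply: eqc; rewrite ?(ReJ, ImJ, ReD, ImD)//; ring. Qed.

Lemma conjM x y : cj (x * y) = cj x * cj y.
Proof. by apply: eqc; rewrite ?(ReJ, ImJ, ReM, ImM); ring. Qed.

Lemma conjN x : cj (- x) = - cj x.
Proof. by apply: eqc; rewrite ?(ReJ, ImJ, ReN, ImN). Qed.

Lemma conjK : involutive cj.
Proof. by move=> x; apply: eqc; rewrite ?(ReJ, ImJ) ?opprK. Qed.

Lemma cj_real (a : R) : cj a%:C = a%:C.
Proof. by apply: eqc; rewrite ?(ReJ, ImJ) /= ?oppr0. Qed.

Lemma conj_sum I (r : seq I) (F : I -> R[i]) :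
  cj (\sum_(i <- r) F i) = \sum_(i <- r) cj (F i).
Proof. exact: (big_morph _ conjD (cj_real 0)). Qed.

Lemma Re_sum I (r : seq I) (F : I -> R[i]) :
  Re (\sum_(i <- r) F i) = \sum_(i <- r) Re (F i).
Proof. exact: (big_morph _ (@ReD) erefl). Qed.

Lemma Im_sum I (r : seq I) (F : I -> R[i]) :
  Im (\sum_(i <- r) F i) = \sum_(i <- r) Im (F i).
Proof. exact: (big_morph _ (@ImD) erefl). Qed.

Lemma normc_nsq z : normc z = Num.sqrt (nsq z).
Proof. by case: z. Qed.

Lemma normc_ge0 z : 0 <= normc z.
Proof. by rewrite normc_nsq sqrtr_ge0. Qed.

End complex_algebra.

Section L2.
Context dp (T : measurableType dp) (R : realType).
Variables (mu : {measure set T -> \bar R}) (D : set T).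
Hypothesis mD : measurable D.
Implicit Types f g h : T -> R[i].

Definition cintegrable f :=
  mu.-integrable D (fun x => (Re (f x))%:E) /\
  mu.-integrable D (fun x => (Im (f x))%:E).

Definition sqint f :=
  cmeasurable D f /\ mu.-integrable D (fun x => (nsq (f x))%:E).

Definition n2 f : R := \int[mu]_(x in D) nsq (f x).

Definition ip f g : R[i] := cintegral mu D (fun x => f x * (cj (g x))).

Lemma eq_cintegral f g :
  (forall x, D x -> f x = g x) -> cintegral mu D f = cintegral mu D g.
Proof.
by move=> fg; congr (_ +i* _); apply: eq_Rintegral => x; rewrite inE => /fg ->.
Qed.

Lemma cintegralD f g : cintegrable f -> cintegrable g ->
  cintegral mu D (fun x => f x + g x) = cintegral mu D f + cintegral mu D g.
Proof.
move=> [rf imf] [rg ig]; apply: eqc; rewrite ?ReD ?ImD /=.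
  by rewrite -RintegralD//; apply: eq_Rintegral => x _; rewrite ReD.
by rewrite -RintegralD//; apply: eq_Rintegral => x _; rewrite ImD.
Qed.

Lemma cintegrableD f g : cintegrable f -> cintegrable g ->
  cintegrable (fun x => f x + g x).
Proof.
move=> [rf imf] [rg ig]; split.
  by under eq_fun do rewrite ReD EFinD; exact: integrableD.
by under eq_fun do rewrite ImD EFinD; exact: integrableD.
Qed.

Lemma cintegrableZ c f : cintegrable f -> cintegrable (fun x => c * f x).
Proof.
move=> [rf imf]; split.
  under eq_fun do rewrite ReM EFinB 2!EFinM.
  by apply: integrableB => //; exact: integrableZl.
under eq_fun do rewrite ImM EFinD 2!EFinM.
by apply: integrableD => //; exact: integrableZl.
Qed.

Lemma cintegralZ c f : cintegrable f ->
  cintegral mu D (fun x => c * f x) = c * cintegral mu D f.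
Proof.
move=> [rf imf].
have iZ (a : R) (u : T -> R) : mu.-integrable D (EFin \o u) ->
    mu.-integrable D (EFin \o (fun x => a * u x)).
  by move=> iu; rewrite /comp; under eq_fun do rewrite EFinM; exact: integrableZl.
apply: eqc; rewrite ?ReM ?ImM /=.
  transitivity (\int[mu]_(x in D) (Re c * Re (f x) - Im c * Im (f x))).
    by apply: eq_Rintegral => x _; rewrite ReM.
  by rewrite RintegralB ?RintegralZl//; exact: iZ.
transitivity (\int[mu]_(x in D) (Re c * Im (f x) + Im c * Re (f x))).
  by apply: eq_Rintegral => x _; rewrite ImM.
by rewrite RintegralD ?RintegralZl//; exact: iZ.
Qed.

Lemma cintegrable0 : cintegrable (fun=> 0 : R[i]).
Proof. by split; exact: integrable0. Qed.

Lemma cintegral0 : cintegral mu D (fun=> 0) = 0.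
Proof. by rewrite /cintegral /Rintegral /= integral0. Qed.

Lemma cintegrable_sum I (r : seq I) (F : I -> T -> R[i]) :
  (forall i, cintegrable (F i)) ->
  cintegrable (fun x => \sum_(i <- r) F i x).
Proof.
move=> iF; elim: r => [|i r ih].
  by under [X in cintegrable X]eq_fun do rewrite big_nil; exact: cintegrable0.
under [X in cintegrable X]eq_fun do rewrite big_cons.
exact: cintegrableD.
Qed.

Lemma cintegral_sum I (r : seq I) (F : I -> T -> R[i]) :
  (forall i, cintegrable (F i)) ->
  cintegral mu D (fun x => \sum_(i <- r) F i x) =
  \sum_(i <- r) cintegral mu D (F i).
Proof.
move=> iF; elim: r => [|i r ih].
  by rewrite big_nil; under eq_cintegral do rewrite big_nil; exact: cintegral0.
rewrite big_cons -ih -cintegralD//; last exact: cintegrable_sum.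
by apply: eq_cintegral => x _; rewrite big_cons.
Qed.

Lemma cintegral_conj f : cintegrable f ->
  cintegral mu D (fun x => (cj (f x))) = (cj (cintegral mu D f)).
Proof.
move=> [_ imf]; apply: eqc => /=.
  by [].
rewrite -mulN1r -RintegralZl//.
by apply: eq_Rintegral => x _; rewrite mulN1r.
Qed.

Lemma cmeasurable_nsq f : cmeasurable D f -> measurable_fun D (fun x => nsq (f x)).
Proof.
by move=> [mr mi]; apply: measurable_funD; exact: measurable_funX.
Qed.

Lemma cmeasurableM f g : cmeasurable D f -> cmeasurable D g ->
  cmeasurable D (fun x => f x * g x).
Proof.
move=> [fr fi] [gr gi]; split.
  by under eq_fun do rewrite ReM; apply: measurable_funB; exact: measurable_funM.
by under eq_fun do rewrite ImM; apply: measurable_funD; exact: measurable_funM.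
Qed.

Lemma cmeasurableD f g : cmeasurable D f -> cmeasurable D g ->
  cmeasurable D (fun x => f x + g x).
Proof.
move=> [fr fi] [gr gi]; split.
  by under eq_fun do rewrite ReD; exact: measurable_funD.
by under eq_fun do rewrite ImD; exact: measurable_funD.
Qed.

Lemma cmeasurable_cst (c : R[i]) : cmeasurable D (fun=> c).
Proof. by split; exact: measurable_cst. Qed.

Lemma cmeasurableJ f : cmeasurable D f -> cmeasurable D (fun x => (cj (f x))).
Proof.
move=> [fr fi]; split; first exact: fr.
exact: (measurable_funN fi).
Qed.

Lemma le_integrable_nsq f (h : T -> R) : cmeasurable D f ->
  mu.-integrable D (EFin \o h) ->
  (forall x, D x -> nsq (f x) <= h x) -> sqint f.
Proof.
move=> mf ih fh; split=> //.
apply: (le_integrable mD _ _ ih).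
  by apply/measurable_EFinP; exact: cmeasurable_nsq.
move=> x Dx /=; rewrite lee_fin ger0_norm ?nsq_ge0//.
by rewrite (le_trans (fh _ Dx))// ler_norm.
Qed.

Lemma sqintD f g : sqint f -> sqint g -> sqint (fun x => f x + g x).
Proof.
move=> [mf If] [mg Ig].
apply: (@le_integrable_nsq _ (fun x => 2 * nsq (f x) + 2 * nsq (g x))).
- exact: cmeasurableD.
- rewrite /comp; under eq_fun do rewrite EFinD !EFinM.
  by apply: integrableD => //; exact: integrableZl.
- by move=> x _; exact: nsqD_le.
Qed.

Lemma sqintZ c f : sqint f -> sqint (fun x => c * f x).
Proof.
move=> [mf If].
apply: (@le_integrable_nsq _ (fun x => nsq c * nsq (f x))).
- by apply: cmeasurableM => //; exact: cmeasurable_cst.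
- by rewrite /comp; under eq_fun do rewrite EFinM; exact: integrableZl.
- by move=> x _; rewrite nsqM.
Qed.

Lemma sqintN f : sqint f -> sqint (fun x => - f x).
Proof. by move=> sf; under [X in sqint X]eq_fun do rewrite -mulN1r; exact: sqintZ. Qed.

Lemma sqintB f g : sqint f -> sqint g -> sqint (fun x => f x - g x).
Proof. by move=> sf sg; apply: sqintD => //; exact: sqintN. Qed.

Lemma sqint0 : sqint (fun=> 0 : R[i]).
Proof.
split; first exact: cmeasurable_cst.
by under eq_fun do rewrite nsq0; exact: integrable0.
Qed.

Lemma sqint_sum I (r : seq I) (F : I -> T -> R[i]) :
  (forall i, sqint (F i)) -> sqint (fun x => \sum_(i <- r) F i x).
Proof.
move=> iF; elim: r => [|i r ih].
  by under [X in sqint X]eq_fun do rewrite big_nil; exact: sqint0.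
by under [X in sqint X]eq_fun do rewrite big_cons; exact: sqintD.
Qed.

Lemma sqint_ip f g : sqint f -> sqint g -> cintegrable (fun x => f x * (cj (g x))).
Proof.
move=> [mf If] [mg Ig].
have mfg := cmeasurableM mf (cmeasurableJ mg).
have bd x : normc (f x * (cj (g x))) <= nsq (f x) + nsq (g x).
  rewrite normc_nsq nsqM nsqJ.
  rewrite -(ger0_norm (addr_ge0 (nsq_ge0 (f x)) (nsq_ge0 (g x)))) -sqrtr_sqr.
  rewrite ler_wsqrtr// sqrrD.
  have := mulr_ge0 (nsq_ge0 (f x)) (nsq_ge0 (g x)).
  have := sqr_ge0 (nsq (f x)); have := sqr_ge0 (nsq (g x)).
  by set a := nsq _; set b := nsq _; lra.
split.
- apply: (@le_integrable _ _ _ _ _ _ _ (fun x => ((nsq (f x))%:E + (nsq (g x))%:E)%E)) => //.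
  + by apply/measurable_EFinP; exact: mfg.1.
  + move=> x _; rewrite /= lee_fin (le_trans (normr_Re_le _))//.
    by rewrite (le_trans (bd x))// ler_norm.
  + exact: integrableD.
- apply: (@le_integrable _ _ _ _ _ _ _ (fun x => ((nsq (f x))%:E + (nsq (g x))%:E)%E)) => //.
  + by apply/measurable_EFinP; exact: mfg.2.
  + move=> x _; rewrite /= lee_fin (le_trans (normr_Im_le _))//.
    by rewrite (le_trans (bd x))// ler_norm.
  + exact: integrableD.
Qed.

Lemma ipDl f g h : sqint f -> sqint g -> sqint h ->
  ip (fun x => f x + g x) h = ip f h + ip g h.
Proof.
move=> sf sg sh; rewrite /ip -cintegralD; [|exact: sqint_ip..].
by apply: eq_cintegral => x _; rewrite mulrDl.
Qed.

Lemma ipZl c f g : sqint f -> sqint g -> ip (fun x => c * f x) g = c * ip f g.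
Proof.
move=> sf sg; rewrite /ip -cintegralZ; last exact: sqint_ip.
by apply: eq_cintegral => x _; rewrite mulrA.
Qed.

Lemma ipC f g : sqint f -> sqint g -> ip g f = (cj (ip f g)).
Proof.
move=> sf sg; rewrite /ip -cintegral_conj; last exact: sqint_ip.
apply: eq_cintegral => x _; by rewrite conjM conjK mulrC.
Qed.

Lemma ipDr f g h : sqint f -> sqint g -> sqint h ->
  ip h (fun x => f x + g x) = ip h f + ip h g.
Proof.
move=> sf sg sh; have sfg := sqintD sf sg.
by rewrite ipC// ipDl// conjD -!ipC.
Qed.

Lemma ipZr c f g : sqint f -> sqint g -> ip g (fun x => c * f x) = (cj c) * ip g f.
Proof.
move=> sf sg; have sfg := sqintZ c sf.
by rewrite ipC// ipZl// conjM -ipC.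
Qed.

Lemma eq_ip f f' g g' : (forall x, D x -> f x = f' x) ->
  (forall x, D x -> g x = g' x) -> ip f g = ip f' g'.
Proof. by move=> ff gg; apply: eq_cintegral => x Dx; rewrite ff// gg. Qed.

Lemma ipNl f g : sqint f -> sqint g -> ip (fun x => - f x) g = - ip f g.
Proof.
move=> sf sg; rewrite -mulN1r -ipZl//.
by apply: eq_ip => // x _; rewrite mulN1r.
Qed.

Lemma ipNr f g : sqint f -> sqint g -> ip g (fun x => - f x) = - ip g f.
Proof.
move=> sf sg; rewrite ipC; [|exact: sqintN|by []].
by rewrite ipNl// conjN -ipC.
Qed.

Lemma ipBl f g h : sqint f -> sqint g -> sqint h ->
  ip (fun x => f x - g x) h = ip f h - ip g h.
Proof. by move=> sf sg sh; rewrite ipDl ?ipNl//; exact: sqintN. Qed.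

Lemma ipBr f g h : sqint f -> sqint g -> sqint h ->
  ip h (fun x => f x - g x) = ip h f - ip h g.
Proof. by move=> sf sg sh; rewrite ipDr ?ipNr//; exact: sqintN. Qed.

Lemma ip_suml I (r : seq I) (F : I -> T -> R[i]) g :
  (forall i, sqint (F i)) -> sqint g ->
  ip (fun x => \sum_(i <- r) F i x) g = \sum_(i <- r) ip (F i) g.
Proof.
move=> sF sg; rewrite /ip -cintegral_sum; last by move=> i; exact: sqint_ip.
by apply: eq_cintegral => x _; rewrite mulr_suml.
Qed.

Lemma ip_sumr I (r : seq I) (F : I -> T -> R[i]) g :
  (forall i, sqint (F i)) -> sqint g ->
  ip g (fun x => \sum_(i <- r) F i x) = \sum_(i <- r) ip g (F i).
Proof.
move=> sF sg; rewrite ipC//; last exact: sqint_sum.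
rewrite ip_suml// conj_sum; apply: eq_bigr => i _.
by rewrite -ipC.
Qed.

Lemma ip_n2 f : ip f f = (n2 f)%:C.
Proof.
rewrite /ip /n2 /cintegral; apply: eqc => /=.
  by apply: eq_Rintegral => x _; rewrite mulcJ_nsq.
under eq_Rintegral do rewrite mulcJ_nsq /=.
by rewrite /Rintegral /= integral0.
Qed.

Lemma n2_ge0 f : 0 <= n2 f.
Proof. by apply: Rintegral_ge0 => x _; exact: nsq_ge0. Qed.

Lemma n2_le f g : sqint f -> sqint g ->
  (forall x, D x -> nsq (f x) <= nsq (g x)) -> n2 f <= n2 g.
Proof. by move=> sf sg fg; apply: le_Rintegral => //; [exact: sf.2|exact: sg.2]. Qed.

Lemma eq_n2 f g : (forall x, D x -> f x = g x) -> n2 f = n2 g.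
Proof. by move=> fg; apply: eq_Rintegral => x; rewrite inE => /fg ->. Qed.

Lemma n2Z c f : sqint f -> n2 (fun x => c * f x) = nsq c * n2 f.
Proof.
move=> sf; rewrite /n2 -RintegralZl//; last exact: sf.2.
by apply: eq_Rintegral => x _; rewrite nsqM.
Qed.

Lemma n2N f : n2 (fun x => - f x) = n2 f.
Proof. by apply: eq_Rintegral => x _; rewrite nsqN. Qed.

Lemma n2D_le f g : sqint f -> sqint g ->
  n2 (fun x => f x + g x) <= 2 * n2 f + 2 * n2 g.
Proof.
move=> [mf If] [mg Ig].
have iZ (u : T -> R) : mu.-integrable D (EFin \o u) ->
    mu.-integrable D (EFin \o (fun x => 2 * u x)).
  by move=> iu; rewrite /comp; under eq_fun do rewrite EFinM; exact: integrableZl.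
rewrite /n2 -!RintegralZl// -RintegralD//; [|exact: iZ..].
apply: le_Rintegral => //.
- by case: (@sqintD f g) => //; split.
- rewrite /comp; under eq_fun do rewrite EFinD.
  by apply: integrableD => //; exact: iZ.
- by move=> x _; exact: nsqD_le.
Qed.

Lemma n2B_le f g : sqint f -> sqint g ->
  n2 (fun x => f x - g x) <= 2 * n2 f + 2 * n2 g.
Proof.
move=> sf sg; rewrite -(n2N g); apply: n2D_le => //; exact: sqintN.
Qed.

Lemma CauchySchwarz f g : sqint f -> sqint g ->
  nsq (ip f g) <= n2 f * n2 g.
Proof.
move=> sf sg.
have pos c : 0 <= n2 f - 2 * Re ((cj c) * ip f g) + nsq c * n2 g.
  have -> : n2 f - 2 * Re ((cj c) * ip f g) + nsq c * n2 g =
            n2 (fun x => f x - c * g x); last exact: n2_ge0.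
  have sc := sqintZ c sg.
  have : ip (fun x => f x - c * g x) (fun x => f x - c * g x) =
      ip f f - (cj c) * ip f g - (c * (cj (ip f g)) - (c * (cj c)) * ip g g).
    rewrite ipBl//; last exact: sqintB.
    rewrite !ipBr// !ipZl// !ipZr//.
    by rewrite (ipC sf sg); ring.
  rewrite !ip_n2 mulcJ_nsq => /(congr1 (@complex.Re R)) /= ->.
  rewrite !(ReD, ReN, ReM, ImM, ImD, ImN, ReJ, ImJ) /=; ring.
(* Taking [c] to be a real multiple of [ip f g] removes the phase and leaves a real polynomial in
   [t]. *)
have post t : 0 <= n2 f - 2 * t * nsq (ip f g) + t ^+ 2 * nsq (ip f g) * n2 g.
  have := pos (t%:C * ip f g).
  rewrite nsqM nsq_real conjM cj_real -mulrA (mulrC (cj _)) mulcJ_nsq.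
  by rewrite ReM /= mul0r subr0 mulrA.
have P0 := nsq_ge0 (ip f g); have F0 := n2_ge0 f; have G0 := n2_ge0 g.
move: P0 F0 G0 post; move: (nsq _) (n2 f) (n2 g) => P F G P0 F0 G0 post.
have [g0|g0] := eqVneq G 0.
  rewrite g0 mulr0; have [->//|p0] := eqVneq P 0.
  (* With [G = 0] the polynomial is affine in [t]; at this [t] its value is -1, a contradiction. *)
  have := post ((F + 1) / (2 * P)); rewrite g0 mulr0 addr0.
  have -> : 2 * ((F + 1) / (2 * P)) * P = F + 1 by field.
  by move=> h; exfalso; lra.
have gt : 0 < G by rewrite lt_def g0.
have := post G^-1.
have -> : F - 2 * G^-1 * P + G^-1 ^+ 2 * P * G = F - P / G by field.
by rewrite subr_ge0 ler_pdivrMr.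
Qed.

End L2.

(** * Comparison with the L^2 and L^oo norms of the statement *)

Section Lp_bridge.
Context dp (T : measurableType dp) (R : realType).
Variables (mu : {measure set T -> \bar R}) (D : set T).
Hypothesis mD : measurable D.
Implicit Types f g h : T -> R[i].

Lemma integral_cLnorm2 f :
  (\int[mu]_x (`| (\1_D x * normc (f x))%:E | `^ 2) =
   \int[mu]_(x in D) (nsq (f x))%:E)%E.
Proof.
rewrite [RHS]integral_mkcond; apply: eq_integral => x _.
rewrite patchE /= powR_mulrn// ger0_norm; last first.
  by rewrite mulr_ge0// normc_ge0.
rewrite exprMn normc_sqr indicE; case: ifPn => xD; first by rewrite expr1n mul1r.
by rewrite expr0n /= mul0r.
Qed.

Lemma cLnorm2E f : cLnorm mu D 2%:E f = ((\int[mu]_(x in D) (nsq (f x))%:E) `^ 2^-1)%E.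
Proof. by rewrite /cLnorm unlock integral_cLnorm2. Qed.

Lemma in_Lp_sqint f : in_Lp mu D 2%:E f -> sqint mu D f.
Proof.
move=> [mf foo]; split=> //; apply/integrableP; split.
  by apply/measurable_EFinP; exact: cmeasurable_nsq.
under eq_integral do rewrite gee0_abs ?lee_fin ?nsq_ge0//.
move: foo; rewrite cLnorm2E; apply: lty_poweRy.
by rewrite invr_neq0.
Qed.

Lemma sqint_n2E f : sqint mu D f -> (\int[mu]_(x in D) (nsq (f x))%:E)%E = (n2 mu D f)%:E.
Proof. by move=> [_ If]; rewrite /n2 /Rintegral fineK//; exact: integrable_fin_num. Qed.

Lemma cLnorm2_n2 f : sqint mu D f -> cLnorm mu D 2%:E f = (Num.sqrt (n2 mu D f))%:E.
Proof.
by move=> sf; rewrite cLnorm2E sqint_n2E// poweR_EFin powR12_sqrt// n2_ge0.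
Qed.

Lemma sqint_in_Lp f : sqint mu D f -> in_Lp mu D 2%:E f.
Proof. by move=> sf; split; [exact: sf.1|rewrite cLnorm2_n2// ltry]. Qed.

Lemma cLnorm2_cvg0 (f : nat -> T -> R[i]) : (forall k, sqint mu D (f k)) ->
  cLnorm mu D 2%:E (f k) @[k --> \oo] --> (0 : \bar R) ->
  n2 mu D (f k) @[k --> \oo] --> (0 : R).
Proof.
move=> sf; under eq_fun do rewrite cLnorm2_n2//.
move=> /fine_cvgP[_ h].
have : (Num.sqrt (n2 mu D (f k))) * (Num.sqrt (n2 mu D (f k))) @[k --> \oo] --> (0 * 0 : R).
  exact: cvgM.
rewrite mulr0; apply: cvg_trans; apply: near_eq_cvg; apply: nearW => k.
by rewrite -expr2 sqr_sqrtr// n2_ge0.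
Qed.

Lemma n2_eq0 f : sqint mu D f -> n2 mu D f = 0 ->
  {ae mu, forall x, D x -> f x = 0}.
Proof.
move=> sf f0; have := sqint_n2E sf; rewrite f0 => h.
have /measurable_EFinP mf := cmeasurable_nsq sf.1.
have /(ae_eq_integral_abs mu mD mf)  : (\int[mu]_(x in D) `|(nsq (f x))%:E|)%E = 0.
  by rewrite -[RHS]h; apply: eq_integral => x _; rewrite gee0_abs// lee_fin nsq_ge0.
apply: filterS => x /= xD Dx; have /eqP := xD Dx.
by rewrite eqe nsq_eq0 => /eqP.
Qed.

Lemma sqint_ae_bound (a : T -> R[i]) (C : R) f : 0 <= C -> cmeasurable D a ->
  {ae mu, forall x, D x -> nsq (a x) <= C} -> sqint mu D f ->
  sqint mu D (fun x => a x * f x) /\ n2 mu D (fun x => a x * f x) <= C * n2 mu D f.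
Proof.
move=> C0 ma aC sf.
have mfa := cmeasurableM ma sf.1.
have le : (\int[mu]_(x in D) (nsq (a x * f x))%:E <= (C * n2 mu D f)%:E)%E.
  rewrite EFinM -(sqint_n2E sf) -integralZl//; last exact: sf.2.
  apply: ae_ge0_le_integral => //.
  - by move=> x _; rewrite lee_fin nsq_ge0.
  - by apply/measurable_EFinP; exact: cmeasurable_nsq.
  - by move=> x _; rewrite lee_fin mulr_ge0// nsq_ge0.
  - apply/measurable_EFinP; apply: measurable_funM => //.
    exact: cmeasurable_nsq sf.1.
  apply: filterS aC => x h Dx; rewrite -EFinM lee_fin nsqM ler_wpM2r ?nsq_ge0//.
  exact: h.
have sfa : sqint mu D (fun x => a x * f x).
  split=> //; apply/integrableP; split.
    by apply/measurable_EFinP; exact: cmeasurable_nsq.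
  under eq_integral do rewrite gee0_abs ?lee_fin ?nsq_ge0//.
  by rewrite (le_lt_trans le)// ltry.
by split=> //; move: le; rewrite sqint_n2E.
Qed.

Lemma in_Lpoo_bound (a : T -> R[i]) : in_Lp mu setT +oo%E a ->
  cmeasurable setT a /\
  exists C : R, 0 <= C /\ {ae mu, forall x, setT x -> nsq (a x) <= C}.
Proof.
(* For a null measure the L^oo norm is 0 by convention and carries no information on [a]; the bound
   then holds almost everywhere because the whole space is negligible. *)
move=> [ma]; rewrite /cLnorm unlock; case: ifPn => [_|mu0] foo; split=> //; last first.
  exists 0; split=> //; exists setT; split=> //.
  by move: mu0; rewrite -leNgt => h; apply/eqP; rewrite eq_le h measure_ge0.
have [M [M0 hM]] : exists M : R, 0 <= M /\
    (ess_sup mu (abse \o (fun x => (\1_setT x * normc (a x))%:E)) <= M%:E)%E.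
  move: foo; case: (ess_sup _ _) => [r _|//|_].
    by exists `|r|; rewrite normr_ge0 lee_fin ler_norm.
  by exists 0; split=> //; rewrite leNye.
exists (M ^+ 2); split; first exact: sqr_ge0.
move/ess_supP : hM; apply: filterS => x /=.
rewrite indicT mul1r lee_fin ger0_norm ?normc_ge0// => h _.
by rewrite -normc_sqr lerXn2r// ?nnegrE// normc_ge0.
Qed.

End Lp_bridge.

(** * Measurability and bounded sets in the half-space *)

Section borel_pt.
Variables (R : realType) (d : nat).
Local Notation Rd := 'rV[R]_d.
Local Notation pt := (Rd * R)%type.

Lemma measurable_half_space : measurable (@half_space R d).
Proof.
rewrite (_ : @half_space R d = setT `*` `]0, +oo[%classic).
  exact: measurableX.
by apply/seteqP; split => x /=; rewrite in_itv /= andbT // => -[].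
Qed.

Lemma ball_ptP (x y : pt) (e : R) :
  (forall i, `|x.1 ord0 i - y.1 ord0 i| < e) -> `|x.2 - y.2| < e -> ball x e y.
Proof.
move=> h1 h2; split=> //=; split; first exact: le_lt_trans h2.
by move=> i j; rewrite ord1; exact: h1.
Qed.

Let rbox (q : 'rV[rat]_d * rat * nat) : set pt :=
  [set x : pt | (forall i, `|x.1 ord0 i - ratr (q.1.1 ord0 i)| < q.2.+1%:R^-1) /\
           `|x.2 - ratr q.1.2| < q.2.+1%:R^-1].

Let rbox_measurable q : measurable (rbox q).
Proof.
have -> : rbox q = \bigcap_(i in [set: 'I_d])
    ((fun x : pt => x.1 ord0 i - ratr (q.1.1 ord0 i)) @^-1` `]- q.2.+1%:R^-1, q.2.+1%:R^-1[%classic)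
    `&` ((fun x : pt => x.2 - ratr q.1.2) @^-1` `]- q.2.+1%:R^-1, q.2.+1%:R^-1[%classic).
  apply/seteqP; split => x.
    move=> [h1 h2]; split; last by rewrite /= in_itv /= -ltr_norml.
    by move=> i _ /=; rewrite in_itv /= -ltr_norml.
  move=> [h1 h2]; split; last by move: h2; rewrite /= in_itv /= -ltr_norml.
  by move=> i; have := h1 i I; rewrite /= in_itv /= -ltr_norml.
apply: measurableI.
  apply: fin_bigcap_measurable; [exact: finite_finset|move=> i _]; rewrite -[X in measurable X]setTI.
  have m : measurable_fun setT (fun x : pt => x.1 ord0 i - ratr (q.1.1 ord0 i)).
    apply: measurable_funB => //.
    exact: (measurableT_comp (measurable_coord_rV i) measurable_fst).
  by apply: m => //; exact: measurable_itv.
rewrite -[X in measurable X]setTI.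
have m : measurable_fun setT (fun x : pt => x.2 - ratr q.1.2).
  by apply: measurable_funB => //; exact: measurable_snd.
by apply: m => //; exact: measurable_itv.
Qed.

(** Measurability is generated by coordinates, not by the topology, so the two have to be linked: an
    open set is the countable union of the boxes with rational centre and radius [1 / (k + 1)] that
    it contains. A radius below [e / 2] keeps the box around a nearby rational point inside the ball
    of radius [e]. *)
Lemma open_measurable_pt (U : set pt) : open U -> measurable U.
Proof.
move=> oU.
have -> : U = \bigcup_q (if `[< rbox q `<=` U >] then rbox q else set0).
  apply/seteqP; split => [x Ux|x [q _]]; last by case: asboolP => // h /h.
  have /nbhs_ballP[e /= e0 xU] : nbhs x U by move: oU; rewrite openE; exact.
  pose k := Num.truncn (2 / e).
  have ke : (k.+1%:R^-1 : R) < e / 2.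
    rewrite -[ltRHS]invrK ltf_pV2 ?posrE ?invr_gt0 ?divr_gt0// invf_div.
    exact: truncnS_gt.
  have k0 : 0 < (k.+1%:R^-1 : R) by rewrite invr_gt0.
  have ex (r : R) : exists q : rat, `|r - ratr q| < k.+1%:R^-1.
    have [|q] := @rat_in_itvoo R (r - k.+1%:R^-1) (r + k.+1%:R^-1).
      by rewrite ltrBlDr -addrA ltrDl addr_gt0.
    rewrite in_itv /= => /andP[h1 h2]; exists q.
    by rewrite distrC ltr_distl h1 h2.
  pose s := projT1 (cid (ex x.2)).
  pose v : 'rV[rat]_d := \row_i projT1 (cid (ex (x.1 ord0 i))).
  exists (v, s, k) => //; case: asboolP => [_|[]].
    split; last by rewrite /s; case: cid.
    by move=> i; rewrite /= mxE; case: cid.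
  move=> y [h1 h2]; apply: xU; apply: ball_ptP.
    move=> i; have hx : `|x.1 ord0 i - ratr (v ord0 i)| < k.+1%:R^-1.
      by rewrite mxE; case: cid.
    rewrite (le_lt_trans (ler_distD (ratr (v ord0 i)) _ _))//.
    rewrite [ltRHS]splitr ltrD//; first exact: lt_trans ke.
    by rewrite distrC; exact: lt_trans (h1 i) ke.
  have hx : `|x.2 - ratr s| < k.+1%:R^-1 by rewrite /s; case: cid.
  rewrite (le_lt_trans (ler_distD (ratr s) _ _))//.
  rewrite [ltRHS]splitr ltrD//; first exact: lt_trans ke.
  by rewrite distrC; exact: lt_trans h2 ke.
apply: countable_bigcupT_measurable; first exact: countableP.
by move=> q; case: ifP.
Qed.

Lemma continuous_measurable_pt (f : pt -> R) : continuous f -> measurable_fun setT f.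
Proof.
move=> cf; apply: (measurability _ (RGenOInfty.measurableE R)) => //.
move=> _ [_ [a ->] <-]; rewrite setTI; apply: open_measurable_pt.
by apply: open_comp => // x _; exact: cf.
Qed.

Lemma continuous_measurable_rV (f : Rd -> R) : continuous f -> measurable_fun setT f.
Proof.
move=> cf; have m : measurable_fun setT (f \o fst : pt -> R).
  by apply: continuous_measurable_pt => x; apply: continuous_comp; [exact: cvg_fst|exact: cf].
have -> : f = (f \o fst) \o (fun x : Rd => (x, 0 : R)) by [].
by apply: measurableT_comp => //; apply: measurable_fun_pair => //; exact: measurable_cst.
Qed.

Definition rVbox (M : R) : set Rd := [set x | forall i, `|x ord0 i| <= M].

Lemma measurable_rVbox M : measurable (rVbox M).
Proof.
have -> : rVbox M = \bigcap_(i in [set: 'I_d]) (coord_rV i @^-1` `[- M, M]%classic).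
  apply/seteqP; split => x h i.
    by move=> _; rewrite /= in_itv /= -ler_norml; exact: h.
  by have := h i I; rewrite /= in_itv /= -ler_norml.
apply: fin_bigcap_measurable; [exact: finite_finset|move=> i _]; rewrite -[X in measurable X]setTI.
by apply: measurable_coord_rV => //; exact: measurable_itv.
Qed.

End borel_pt.

Lemma rVbox_lty (R : realType) d (M : R) : (lebesgue_rV d (rVbox M) < +oo)%E.
Proof.
elim: d => [|d ih]; first by rewrite /= diracE; case: (_ \in _); rewrite ltry.
rewrite /= /lebesgue_cons /pushforward.
have -> : @rV_cons R d @^-1` rVbox M = `[- M, M]%classic `*` rVbox M.
  apply/seteqP; split => -[t x] /=.
    move=> h; split; rewrite /= ?in_itv /=.
      by rewrite -ler_norml; have := h ord0; rewrite mxE unlift_none.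
    by move=> i; have := h (lift ord0 i); rewrite mxE liftK.
  rewrite in_itv /= -ler_norml => -[h1 h2] i.
  by rewrite mxE; case: unliftP => [j _|_] //=.
rewrite product_measure1E//; last exact: measurable_rVbox.
apply: lte_mul_pinfty => //.
  rewrite [X in X \is a fin_num](lebesgue_measure_itv `[- M, M]%R) /=.
  by case: ifP.
Qed.

Section bounded_support.
Variables (R : realType) (d : nat).
Local Notation Rd := 'rV[R]_d.
Local Notation pt := (Rd * R)%type.
Local Notation mu := (lebesgue_rV d \x lebesgue_measure)%E.
Local Notation sigma := (lebesgue_rV d).
Local Notation Omega := (@half_space R d).

Definition ptbox (M : R) : set pt := rVbox M `*` `[- M, M]%classic.

Lemma measurable_ptbox M : measurable (ptbox M).
Proof. by apply: measurableX => //; exact: measurable_rVbox. Qed.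

Lemma ptbox_lty M : (mu (ptbox M) < +oo)%E.
Proof.
rewrite product_measure1E//; last exact: measurable_rVbox.
apply: lte_mul_pinfty => //.
  by rewrite ge0_fin_numE ?measure_ge0 //; exact: rVbox_lty.
rewrite [X in (X < _)%E](lebesgue_measure_itv `[- M, M]%R) /=.
by case: ifP => // _; rewrite -EFinD ltry.
Qed.

Definition bounded_box (f : pt -> R[i]) := cmeasurable setT f /\
  exists M B : R, forall x, nsq (f x) <= B /\ (~ ptbox M x -> f x = 0).

Lemma bounded_box_sqint D f : measurable D -> bounded_box f -> sqint mu D f.
Proof.
move=> mD [mf [M [B fB]]].
have mfD : cmeasurable D f.
  by split; apply: (measurable_funS measurableT) => //; [exact: mf.1|exact: mf.2].
apply: (@le_integrable_nsq _ _ _ _ _ mD _ (fun x => `|B| * \1_(ptbox M) x)) => //.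
  apply: (@integrableS _ _ _ _ setT) => //.
  rewrite /comp; under eq_fun do rewrite EFinM.
  apply: integrableZl => //.
  apply/integrableP; split.
    by apply/measurable_EFinP; apply: measurable_indic; exact: measurable_ptbox.
  under eq_integral do rewrite gee0_abs ?lee_fin//.
  rewrite integral_indic ?setIT//; first exact: ptbox_lty.
  exact: measurable_ptbox.
move=> x _; rewrite indicE; have [h1 h2] := fB x.
case: (boolP (x \in ptbox M)) => [_|]; first by rewrite mulr1 (le_trans h1)// ler_norm.
by rewrite notin_setE => /h2 ->; rewrite nsq0 mulr0.
Qed.

Definition bounded_box_rV (f : Rd -> R[i]) := cmeasurable setT f /\
  exists M B : R, forall x, nsq (f x) <= B /\ (~ rVbox M x -> f x = 0).

Lemma bounded_box_rV_sqint f : bounded_box_rV f -> sqint sigma setT f.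
Proof.
move=> [mf [M [B fB]]].
apply: (@le_integrable_nsq _ _ _ _ _ measurableT _ (fun x => `|B| * \1_(rVbox M) x)) => //.
  rewrite /comp; under eq_fun do rewrite EFinM.
  apply: integrableZl => //.
  apply/integrableP; split.
    by apply/measurable_EFinP; apply: measurable_indic; exact: measurable_rVbox.
  under eq_integral do rewrite gee0_abs ?lee_fin//.
  rewrite integral_indic ?setIT//; first exact: rVbox_lty.
  exact: measurable_rVbox.
move=> x _; rewrite indicE; have [h1 h2] := fB x.
case: (boolP (x \in rVbox M)) => [_|]; first by rewrite mulr1 (le_trans h1)// ler_norm.
by rewrite notin_setE => /h2 ->; rewrite nsq0 mulr0.
Qed.

Lemma ccontinuous_measurable_pt (f : pt -> R[i]) :
  continuous (fun x => Re (f x)) -> continuous (fun x => Im (f x)) ->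
  cmeasurable setT f.
Proof. by move=> c1 c2; split; exact: continuous_measurable_pt. Qed.

End bounded_support.

(** * Smooth complex-valued functions *)

Section csmooth_theory.
Variables (R : realType) (V : normedModType R).
Implicit Types (f g : V -> R[i]) (v x : V).

Lemma derivable_mulr (a b : V -> R) x v : derivable a x v -> derivable b x v ->
  derivable (fun y => a y * b y) x v.
Proof. by move=> ha hb; exact: (derivableM ha hb). Qed.

Lemma derive_mulr (a b : V -> R) x v : derivable a x v -> derivable b x v ->
  'D_v (fun y => a y * b y) x = a x * 'D_v b x + b x * 'D_v a x.
Proof. by move=> ha hb; exact: (deriveM ha hb). Qed.

(** A coinduction principle: any class of differentiable functions stable under directional
    derivatives consists of smooth functions. Smoothness is then proved by exhibiting a stable
    class, never by computing iterated derivatives. *)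
Lemma csmooth_ind (P : (V -> R[i]) -> Prop) :
  (forall f, P f -> forall x, cdifferentiable f x) ->
  (forall f v, P f -> P (cderive v f)) -> forall f, P f -> csmooth f.
Proof.
move=> Pd PD f Pf vs x; apply: Pd.
by elim: vs => //= v vs ih; exact: PD.
Qed.

Lemma csmooth_diff f x : csmooth f -> cdifferentiable f x.
Proof. by move=> /(_ [::] x). Qed.

Lemma csmooth_derive f v : csmooth f -> csmooth (cderive v f).
Proof.
by move=> sf vs x; have := sf (rcons vs v) x; rewrite /cderives foldr_rcons.
Qed.

Lemma cdifferentiable_cst (c : R[i]) x : cdifferentiable (fun=> c) x.
Proof. by split; exact: differentiable_cst. Qed.

Lemma cdifferentiableD f g x : cdifferentiable f x -> cdifferentiable g x ->
  cdifferentiable (fun x => f x + g x) x.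
Proof.
move=> [f1 f2] [g1 g2]; split.
  by under eq_fun do rewrite ReD; exact: differentiableD.
by under eq_fun do rewrite ImD; exact: differentiableD.
Qed.

Lemma cdifferentiableM f g x : cdifferentiable f x -> cdifferentiable g x ->
  cdifferentiable (fun x => f x * g x) x.
Proof.
move=> [f1 f2] [g1 g2]; split.
  under eq_fun do rewrite ReM.
  by apply: differentiableB; exact: differentiableM.
under eq_fun do rewrite ImM.
by apply: differentiableD; exact: differentiableM.
Qed.

Lemma cderiveD f g v x : cdifferentiable f x -> cdifferentiable g x ->
  cderive v (fun x => f x + g x) x = cderive v f x + cderive v g x.
Proof.
move=> [/(@diff_derivable _ _ _ _ _ v) f1 /(@diff_derivable _ _ _ _ _ v) f2].
move=> [/(@diff_derivable _ _ _ _ _ v) g1 /(@diff_derivable _ _ _ _ _ v) g2].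
apply: eqc; rewrite ?ReD ?ImD /=.
  transitivity ('D_v ((fun y => Re (f y)) + (fun y => Re (g y))) x); last exact: deriveD.
  by congr ('D_v _ x); apply/funext => y; rewrite ReD.
transitivity ('D_v ((fun y => Im (f y)) + (fun y => Im (g y))) x); last exact: deriveD.
by congr ('D_v _ x); apply/funext => y; rewrite ImD.
Qed.

Lemma cderiveM f g v x : cdifferentiable f x -> cdifferentiable g x ->
  cderive v (fun x => f x * g x) x = cderive v f x * g x + f x * cderive v g x.
Proof.
move=> [/(@diff_derivable _ _ _ _ _ v) f1 /(@diff_derivable _ _ _ _ _ v) f2].
move=> [/(@diff_derivable _ _ _ _ _ v) g1 /(@diff_derivable _ _ _ _ _ v) g2].
apply: eqc; rewrite /cderive.
  transitivity ('D_v ((fun y => Re (f y) * Re (g y)) - (fun y => Im (f y) * Im (g y))) x).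
    by congr ('D_v _ x); apply/funext => y; rewrite ReM.
  rewrite (deriveB (derivable_mulr f1 g1) (derivable_mulr f2 g2)).
  by rewrite (derive_mulr f1 g1) (derive_mulr f2 g2) !(ReD, ReM) /=; ring.
transitivity ('D_v ((fun y => Re (f y) * Im (g y)) + (fun y => Im (f y) * Re (g y))) x).
  by congr ('D_v _ x); apply/funext => y; rewrite ImM.
rewrite (deriveD (derivable_mulr f1 g2) (derivable_mulr f2 g1)).
by rewrite (derive_mulr f1 g2) (derive_mulr f2 g1) !(ImD, ImM) /=; ring.
Qed.

Lemma cderive_cst (c : R[i]) v x : cderive v (fun=> c) x = 0.
Proof. by rewrite /cderive !derive_cst. Qed.

(** Products alone do not form a class stable under differentiation, since the Leibniz rule yields
    sums of products; this closure is the stable class to which [csmooth_ind] applies. *)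
Inductive calg : (V -> R[i]) -> Prop :=
| calg_base f : csmooth f -> calg f
| calg_add f g : calg f -> calg g -> calg (fun x => f x + g x)
| calg_mul f g : calg f -> calg g -> calg (fun x => f x * g x).

Lemma calg_diff f : calg f -> forall x, cdifferentiable f x.
Proof.
elim=> [g sg x|g h _ dg _ dh x|g h _ dg _ dh x].
- exact: csmooth_diff.
- exact: cdifferentiableD.
- exact: cdifferentiableM.
Qed.

Lemma calg_derive f v : calg f -> calg (cderive v f).
Proof.
elim=> [g sg|g h ag dg ah dh|g h ag dg ah dh].
- by apply: calg_base; exact: csmooth_derive.
- rewrite (_ : cderive v _ = fun x => cderive v g x + cderive v h x).
    exact: calg_add.
  by apply/funext => x; rewrite cderiveD//; exact: calg_diff.
- rewrite (_ : cderive v _ = fun x => cderive v g x * h x + g x * cderive v h x).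
    by apply: calg_add; exact: calg_mul.
  by apply/funext => x; rewrite cderiveM//; exact: calg_diff.
Qed.

Lemma calg_smooth f : calg f -> csmooth f.
Proof. by apply: csmooth_ind; [exact: calg_diff|move=> ? ?; exact: calg_derive]. Qed.

Lemma csmoothD f g : csmooth f -> csmooth g -> csmooth (fun x => f x + g x).
Proof. by move=> sf sg; apply/calg_smooth/calg_add; exact: calg_base. Qed.

Lemma csmoothM f g : csmooth f -> csmooth g -> csmooth (fun x => f x * g x).
Proof. by move=> sf sg; apply/calg_smooth/calg_mul; exact: calg_base. Qed.

Lemma csmooth_cst (c : R[i]) : csmooth (fun _ : V => c).
Proof.
apply: (@csmooth_ind (fun f => exists c, f = fun=> c)) => [f [a ->] x|f v [a ->]|].
- exact: cdifferentiable_cst.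
- by exists 0; apply/funext => x; rewrite cderive_cst.
- by exists c.
Qed.

Lemma csmooth_sum I (r : seq I) (F : I -> V -> R[i]) :
  (forall i, csmooth (F i)) -> csmooth (fun x => \sum_(i <- r) F i x).
Proof.
move=> sF; elim: r => [|i r ih].
  by under [X in csmooth X]eq_fun do rewrite big_nil; exact: csmooth_cst.
by under [X in csmooth X]eq_fun do rewrite big_cons; exact: csmoothD.
Qed.

Lemma cderive_sum I (r : seq I) (F : I -> V -> R[i]) v x :
  (forall i, csmooth (F i)) ->
  cderive v (fun x => \sum_(i <- r) F i x) x = \sum_(i <- r) cderive v (F i) x.
Proof.
move=> sF; elim: r => [|i r ih].
  rewrite big_nil (_ : (fun _ => _) = fun=> 0) ?cderive_cst//.
  by apply/funext => y; rewrite big_nil.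
rewrite big_cons -ih -cderiveD; [|exact: csmooth_diff|].
  by congr (cderive v _ x); apply/funext => y; rewrite big_cons.
by apply: csmooth_diff; exact: csmooth_sum.
Qed.

Lemma cderive_scale (c : R) f v x : cdifferentiable f x ->
  cderive (c *: v) f x = c%:C * cderive v f x.
Proof.
move=> [d1 d2].
have hD (h : V -> R) : differentiable h x -> 'D_(c *: v) h x = c * 'D_v h x.
  by move=> dh; rewrite !deriveE// linearZ.
by apply: eqc; rewrite ?ReM ?ImM /= hD// mul0r ?subr0 ?addr0.
Qed.

Lemma cderiveJ f v x : cdifferentiable f x ->
  cderive v (fun x => cj (f x)) x = cj (cderive v f x).
Proof.
move=> [_ f2]; apply: eqc => //=; rewrite -deriveN; last exact: diff_derivable.
by [].
Qed.

Lemma csmoothJ f : csmooth f -> csmooth (fun x => cj (f x)).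
Proof.
move=> sf.
apply: (@csmooth_ind (fun h => exists g, csmooth g /\ h = fun x => cj (g x))).
- move=> _ [g [sg ->]] x; have [g1 g2] := csmooth_diff x sg; split => //.
  exact: differentiableN.
- move=> _ v [g [sg ->]]; exists (cderive v g); split; first exact: csmooth_derive.
  by apply/funext => x; rewrite cderiveJ//; exact: csmooth_diff.
- by exists f.
Qed.

Lemma csmooth_continuousRe f : csmooth f -> continuous (fun x => Re (f x)).
Proof. by move=> sf x; apply: differentiable_continuous; have [] := csmooth_diff x sf. Qed.

Lemma csmooth_continuousIm f : csmooth f -> continuous (fun x => Im (f x)).
Proof. by move=> sf x; apply: differentiable_continuous; have [] := csmooth_diff x sf. Qed.

End csmooth_theory.

(** * Affine changes of variables and complex exponentials *)

Section affine.
Variables (R : realType) (d : nat).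
Local Notation Rd := 'rV[R]_d.
Local Notation pt := (Rd * R)%type.
Implicit Types (f g : pt -> R[i]) (v x : pt).

(** One family for all substitutions of the proof: normal dilations and shifts, restriction to a
    slice ([b = 0]), and restriction to a normal line ([a = 0]). [lin] is its linear part, acting on
    directions of differentiation. *)
Definition aff (a : R) (p : Rd) (b q : R) (x : pt) : pt :=
  (a *: x.1 + p, b * x.2 + q).

Definition lin (a b : R) (x : pt) : pt := (a *: x.1, b * x.2).

Lemma differentiable_fst x : differentiable (fst : pt -> Rd) x.
Proof. by apply: linear_differentiable => y; exact: cvg_fst. Qed.

Lemma differentiable_snd x : differentiable (snd : pt -> R) x.
Proof. by apply: linear_differentiable => y; exact: cvg_snd. Qed.

Lemma differentiable_aff a p b q x : differentiable (aff a p b q) x.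
Proof.
apply: differentiable_pair.
  apply: differentiableD => //; apply: differentiableZ; exact: differentiable_fst.
apply: differentiableD => //; apply: differentiableM => //; exact: differentiable_snd.
Qed.

Lemma derive_aff (h : pt -> R) a p b q v x :
  'D_v (h \o aff a p b q) x = 'D_(lin a b v) h (aff a p b q x).
Proof.
rewrite /derive (_ : (fun t => _) = (fun t => t^-1 *:
  ((h \o shift (aff a p b q x)) (t *: lin a b v) - h (aff a p b q x))))//.
apply/funext => t /=; congr (t^-1 *: (h _ - _)).
apply: injective_projections => /=.
  by rewrite scalerDr !scalerA (mulrC a) addrA.
by rewrite mulrDr addrA; congr (_ + _ + _); rewrite /GRing.scale /= mulrCA.
Qed.

Lemma cderive_aff f a p b q v :
  cderive v (f \o aff a p b q) = cderive (lin a b v) f \o aff a p b q.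
Proof.
apply/funext => x; apply: eqc => /=.
  by rewrite -derive_aff.
by rewrite -derive_aff.
Qed.

Lemma csmooth_aff f a p b q : csmooth f -> csmooth (f \o aff a p b q).
Proof.
move=> sf.
apply: (@csmooth_ind _ _ (fun h => exists g, csmooth g /\ h = g \o aff a p b q)).
- move=> _ [g [sg ->]] x; have [g1 g2] := csmooth_diff (aff a p b q x) sg.
  split.
    exact: (differentiable_comp (differentiable_aff a p b q x) g1).
  exact: (differentiable_comp (differentiable_aff a p b q x) g2).
- move=> _ v [g [sg ->]]; exists (cderive (lin a b v) g).
  by split; [exact: csmooth_derive|exact: cderive_aff].
- by exists f.
Qed.

(** The exponential [e^{z t}] of a real variable. *)
Definition cexp (z : R[i]) (t : R) : R[i] :=
  (expR (Re z * t) * cos (Im z * t)) +i* (expR (Re z * t) * sin (Im z * t)).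

Lemma is_derive_cexpRe z (t : R) : is_derive t 1 (fun t => Re (cexp z t)) (Re (z * cexp z t)).
Proof.
rewrite /cexp ReM /=.
apply: is_derive_eq; rewrite /GRing.scale /=; ring.
Qed.

Lemma is_derive_cexpIm z (t : R) : is_derive t 1 (fun t => Im (cexp z t)) (Im (z * cexp z t)).
Proof.
rewrite /cexp ImM /=.
apply: is_derive_eq; rewrite /GRing.scale /=; ring.
Qed.

Lemma derive_snd (h : R -> R) v x : differentiable h x.2 ->
  differentiable (h \o snd) x /\ 'D_v (h \o snd) x = v.2 * 'D_1 h x.2.
Proof.
move=> dh; have ds := differentiable_snd x; split; first exact: differentiable_comp.
rewrite deriveE; last exact: differentiable_comp.
rewrite diff_comp//= (_ : 'd snd x v = v.2); last first.
  by rewrite (@diff_lin _ _ _ snd)// => y; exact: cvg_snd.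
rewrite -[X in 'd h _ X]mulr1 -[v.2 * 1]/(v.2 *: 1) linearZ /= -deriveE//.
Qed.

Lemma cexp_snd z v x : cdifferentiable (fun x : pt => cexp z x.2) x /\
  cderive v (fun x : pt => cexp z x.2) x = (v.2)%:C * z * cexp z x.2.
Proof.
have hr := is_derive_cexpRe z x.2; have hi := is_derive_cexpIm z x.2.
have dr : differentiable (fun t => Re (cexp z t)) x.2.
  by apply/derivable1_diffP; exact: ex_derive.
have di : differentiable (fun t => Im (cexp z t)) x.2.
  by apply/derivable1_diffP; exact: ex_derive.
have [d1 e1] := derive_snd v dr; have [d2 e2] := derive_snd v di.
split; first by split.
rewrite -mulrA; apply: eqc.
  by transitivity (v.2 * Re (z * cexp z x.2)); [rewrite -(@derive_val _ _ _ _ _ _ _ hr)|rewrite [RHS]ReM /=; ring].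
by transitivity (v.2 * Im (z * cexp z x.2)); [rewrite -(@derive_val _ _ _ _ _ _ _ hi)|rewrite [RHS]ImM /=; ring].
Qed.

Lemma csmooth_cexp z : csmooth (fun x : pt => cexp z x.2).
Proof.
apply: (@csmooth_ind _ _ (fun h => exists c : R[i], h = fun x => c * cexp z x.2)).
- move=> _ [c ->] x.
  exact: (cdifferentiableM (cdifferentiable_cst c x) (cexp_snd z 0 x).1).
- move=> _ v [c ->]; exists (c * ((v.2)%:C * z)); apply/funext => x.
  have [d1 e1] := cexp_snd z v x.
  rewrite (cderiveM _ (cdifferentiable_cst c x) d1).
  by rewrite cderive_cst mul0r add0r e1 !mulrA.
- by exists 1; apply/funext => x; rewrite mul1r.
Qed.

End affine.

(** * Test functions up to the boundary *)

Section ctest.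
Variables (R : realType) (d : nat).
Local Notation Rd := 'rV[R]_d.
Local Notation pt := (Rd * R)%type.
Local Notation mu := (lebesgue_rV d \x lebesgue_measure)%E.
Local Notation sigma := (lebesgue_rV d).
Local Notation Omega := (@half_space R d).
Implicit Types (f g : pt -> R[i]) (v x : pt) (M B : R).

Definition supp_in M f := forall x, ~ ptbox M x -> f x = 0.

(** Compact support is encoded by a centred box, so that supports of sums, dilations and shifts are
    obtained by changing one radius. The box may meet the boundary and the lower half-space. *)
Definition ctest f := csmooth f /\ exists M, supp_in M f.

Lemma ptboxP M x : ptbox M x <-> (forall i, `|x.1 ord0 i| <= M) /\ `|x.2| <= M.
Proof. by rewrite /ptbox /setX /= in_itv /= -ler_norml. Qed.

Lemma ptbox_le M M' : M <= M' -> ptbox M `<=` (ptbox M' : set pt).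
Proof.
move=> MM' x /ptboxP[h1 h2]; apply/ptboxP; split; last exact: le_trans MM'.
by move=> i; exact: le_trans (h1 i) MM'.
Qed.

Lemma supp_in_le M M' f : M <= M' -> supp_in M f -> supp_in M' f.
Proof. by move=> MM' s x nx; apply: s => h; apply: nx; exact: ptbox_le h. Qed.

Lemma compact_ptbox M : compact (ptbox M : set pt).
Proof.
apply: compact_setX; last exact: segment_compact.
rewrite (_ : rVbox M = [set v : Rd | forall i, `[- M, M]%classic (v ord0 i)]); last first.
  by apply/seteqP; split => x h i; have := h i; rewrite /= in_itv /= -ler_norml.
exact: (@rV_compact R d (fun=> `[- M, M]%classic) (fun=> @segment_compact R _ _)).
Qed.

Lemma compact_ptboxP (K : set pt) : compact K -> exists M, K `<=` ptbox M.
Proof.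
move=> /compact_bounded[M [Mr KM]]; exists (M + 1) => x Kx.
have xM : `|x| < M + 1.
  rewrite (@le_lt_trans _ _ (M + 2^-1))//; last first.
    by rewrite ltrD2l invf_lt1// ltr1n.
  have MM : M < M + 2^-1 by rewrite ltrDl invr_gt0.
  exact: (KM (M + 2^-1) MM x Kx).
have : ball (0 : pt) (M + 1) x by rewrite -ball_normE /ball_ /= sub0r normrN.
case=> -[/= _ h1] h2; apply/ptboxP; split => [i|].
  by have := h1 ord0 i; rewrite mxE -ball_normE /ball_ /= sub0r normrN => /ltW.
by move: h2; rewrite -ball_normE /ball_ /= sub0r normrN => /ltW.
Qed.

Lemma ctest_test_function f : ctest f -> test_function setT f.
Proof.
move=> [sf [M fM]]; split=> //; exists (ptbox M); split=> //.
exact: compact_ptbox.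
Qed.

Lemma test_function_ctest U f : test_function U f -> ctest f.
Proof.
move=> [sf [K [cK _ fK]]]; split=> //; have [M KM] := compact_ptboxP cK.
by exists M => x nx; apply: fK => /KM.
Qed.

Lemma ctest_bound f : ctest f -> exists2 B, 0 <= B & forall x, nsq (f x) <= B.
Proof.
move=> [sf [M fM]].
have [[x0 x0M]|no] := pselect (exists x, ptbox M x); last first.
  exists 0 => // x; rewrite fM ?nsq0// => h; apply: no; by exists x.
have c : {within ptbox M, continuous (fun x => nsq (f x))}.
  apply: continuous_subspaceT => x.
  apply: cvgD; apply: cvgM; solve [exact: csmooth_continuousRe|exact: csmooth_continuousIm].
have A0 : (ptbox M : set pt) !=set0 by exists x0.
have [c0 c0A h] := compact_EVT_max A0 (@compact_ptbox M) c.
exists (nsq (f c0)); first exact: nsq_ge0.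
move=> x; have [xM|xM] := pselect (ptbox M x); first by apply: h; rewrite inE.
by rewrite fM// nsq0 nsq_ge0.
Qed.

Lemma ctest_cmeasurable f : ctest f -> cmeasurable setT f.
Proof.
move=> [sf _]; apply: ccontinuous_measurable_pt.
  exact: csmooth_continuousRe.
exact: csmooth_continuousIm.
Qed.

Lemma ctest_bounded_box f : ctest f -> bounded_box f.
Proof.
move=> tf; split; first exact: ctest_cmeasurable.
have [B _ fB] := ctest_bound tf; have [M fM] := tf.2.
by exists M, B => x; split; [exact: fB|exact: fM].
Qed.

Lemma ctest_sqint D f : measurable D -> ctest f -> sqint mu D f.
Proof. by move=> mD tf; apply: bounded_box_sqint => //; exact: ctest_bounded_box. Qed.

Lemma supp_in_derive M f v : supp_in M f -> supp_in M (cderive v f).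
Proof.
move=> fM x nx.
have n : \near x, f x = 0.
  have /compact_closed : compact (ptbox M : set pt) by exact: compact_ptbox.
  move=> /(_ (@norm_hausdorff _ _)) /closed_openC oC.
  have : nbhs x (~` ptbox M) by move: oC; rewrite openE; exact.
  by apply: filterS => y; exact: fM.
rewrite /cderive.
rewrite (@near_eq_derive _ _ _ _ (cst 0)); last first.
  by apply: filterS n => y /= ->.
rewrite (@near_eq_derive _ _ _ (fun y => Im (f y)) (cst 0)); last first.
  by apply: filterS n => y /= ->.
by rewrite !derive_cst.
Qed.

Lemma ctest_derive f v : ctest f -> ctest (cderive v f).
Proof.
move=> [sf [M fM]]; split; first exact: csmooth_derive.
by exists M; exact: supp_in_derive.
Qed.

Lemma ctestM f g : csmooth f -> ctest g -> ctest (fun x => f x * g x).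
Proof.
move=> sf [sg [M gM]]; split; first exact: csmoothM.
by exists M => x /gM ->; rewrite mulr0.
Qed.

Lemma ctestZ c f : ctest f -> ctest (fun x => c * f x).
Proof. by apply: ctestM; exact: csmooth_cst. Qed.

Lemma ctestJ f : ctest f -> ctest (fun x => cj (f x)).
Proof.
move=> [sf [M fM]]; split; first exact: csmoothJ.
by exists M => x /fM ->; exact: (cj_real 0).
Qed.

Lemma ctestD f g : ctest f -> ctest g -> ctest (fun x => f x + g x).
Proof.
move=> [sf [M fM]] [sg [M' gM]]; split; first exact: csmoothD.
exists (Num.max M M') => x nx; rewrite fM ?gM ?addr0//.
- by move=> h; apply: nx; apply: ptbox_le h; rewrite le_max lexx orbT.
- by move=> h; apply: nx; apply: ptbox_le h; rewrite le_max lexx.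
Qed.

Lemma ctest0 : ctest (fun=> 0).
Proof. by split; [exact: csmooth_cst|exists 0]. Qed.

Lemma ctest_sum I (r : seq I) (F : I -> pt -> R[i]) :
  (forall i, ctest (F i)) -> ctest (fun x => \sum_(i <- r) F i x).
Proof.
move=> tF; elim: r => [|i r ih].
  by under [X in ctest X]eq_fun do rewrite big_nil; exact: ctest0.
by under [X in ctest X]eq_fun do rewrite big_cons; exact: ctestD.
Qed.

Lemma ctest_slice_sqint f t : ctest f -> sqint sigma setT (fun y => f (y, t)).
Proof.
move=> tf; have [B _ fB] := ctest_bound tf; have [M fM] := tf.2.
apply: bounded_box_rV_sqint; split; last first.
  exists M, B => y; split; first exact: fB.
  by move=> ny; apply: fM => -[].
have [m1 m2] := ctest_cmeasurable tf.
have mp : measurable_fun setT (fun y : Rd => (y, t) : pt).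
  by apply: measurable_fun_pair => //; exact: measurable_cst.
by split; [exact: (measurableT_comp m1 mp)|exact: (measurableT_comp m2 mp)].
Qed.

Lemma ctest_scale f c : 0 < c -> ctest f -> ctest (f \o aff 1 0 c 0).
Proof.
move=> c0 [sf [M fM]]; split; first exact: csmooth_aff.
exists (Num.max M (M / c)) => x nx /=; apply: fM => -[h1]; rewrite /= in_itv /=.
rewrite -ler_norml addr0 normrM (gtr0_norm c0) => h2; apply: nx; apply/ptboxP; split.
  move=> i; rewrite le_max; have := h1 i; rewrite /= scale1r addr0 => -> //.
by rewrite le_max ler_pdivlMr// mulrC h2 orbT.
Qed.

(** A slice extended constantly in the normal variable is smooth but not compactly supported; the
    factor [g] supplies the missing localization in that variable. *)
Lemma ctest_slice_mul f t g M : ctest f -> csmooth g ->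
  (forall x, M < `|x.2| -> g x = 0) ->
  ctest (fun x => g x * f (x.1, t)).
Proof.
move=> [sf [M' fM]] sg gM; split.
  apply: csmoothM => //.
  rewrite (_ : (fun _ => _) = f \o aff 1 0 0 t); first exact: csmooth_aff.
  by apply/funext => x; rewrite /= /aff scale1r addr0 mul0r add0r.
exists (Num.max M M') => x nx.
have [|h] := ltP M `|x.2|; first by move=> /gM ->; rewrite mul0r.
rewrite (fM (x.1, t)) ?mulr0// => -[/= h1 h2]; apply: nx; apply/ptboxP; split.
  by move=> i; rewrite le_max (h1 i) orbT.
by rewrite le_max h.
Qed.

Lemma test_function_Omega f : test_function Omega f -> forall x, x.2 <= 0 -> f x = 0.
Proof.
move=> [_ [K [_ KO fK]]] x x0; apply: fK => /KO; rewrite /half_space /=.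
by rewrite ltNge x0.
Qed.

End ctest.

(** * The divergence theorem *)

Section ftc_line.
Variable R : realType.
Local Notation leb := (@lebesgue_measure R).
Implicit Types (h : R -> R) (M : R).

Lemma ftc_itv h (a b : R) : a < b -> (forall t, derivable h t 1) ->
  continuous (fun t => 'D_1 h t) ->
  (\int[leb]_(t in `[a, b]) ('D_1 h t)%:E = (h b - h a)%:E)%E.
Proof.
move=> ab dh ch.
have ct t : {for t, continuous h}.
  by apply: differentiable_continuous; apply/derivable1_diffP; exact: dh.
rewrite (@continuous_FTC2 R (fun t => 'D_1 h t) h a b)//.
- by apply: continuous_subspaceT.
- split; first by move=> t _; exact: dh.
    by apply: cvg_at_right_filter; exact: ct.
  by apply: cvg_at_left_filter; exact: ct.
- by move=> t _; rewrite derive1E.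
Qed.

Lemma derive_supp h M t : (forall t, M < `|t| -> h t = 0) -> M < `|t| -> 'D_1 h t = 0.
Proof.
move=> hM Mt; rewrite (@near_eq_derive _ _ _ _ (cst 0)) ?derive_cst//.
have : \near t, M < `|t|.
  have /(_ t) : continuous (fun x : R => `|x|) by exact: norm_continuous.
  by move/cvgr_gt; apply.
by apply: filterS => s; exact: hM.
Qed.

Lemma integral_supp (g : R -> R) M : (forall t, M < `|t| -> g t = 0) ->
  (\int[leb]_t (g t)%:E = \int[leb]_(t in `[(- M)%R, M]) (g t)%:E)%E.
Proof.
move=> gM; rewrite [RHS]integral_mkcond; apply: eq_integral => t _.
rewrite patchE; case: ifPn => // /negP ni; rewrite gM//.
by rewrite ltNge; apply/negP => tM; apply: ni; rewrite inE /= in_itv /= -ler_norml.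
Qed.

Lemma ftc_line h M : (forall t, derivable h t 1) ->
  continuous (fun t => 'D_1 h t) -> (forall t, M < `|t| -> h t = 0) ->
  (\int[leb]_t ('D_1 h t)%:E = 0)%E.
Proof.
(* [M] may be negative; [N] is positive and strictly beyond [M], so that the interval is
   nondegenerate and [h] vanishes at both ends. *)
move=> dh ch hM; pose N := `|M| + 1.
have MN : M < N by rewrite /N ltr_pwDr// ler_norm.
have N0 : 0 < N by rewrite /N ltr_pwDr.
have hN t : N <= `|t| -> h t = 0 by move=> Nt; apply: hM; exact: lt_le_trans Nt.
rewrite (@integral_supp _ N); last first.
  by move=> t Nt; apply: (derive_supp hM); exact: lt_trans Nt.
rewrite ftc_itv//; last by rewrite gtrN.
by rewrite !hN ?subrr// ?normrN ger0_norm// ltW.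
Qed.

Lemma integral_supp_half (g : R -> R) M : (forall t, M < `|t| -> g t = 0) ->
  (\int[leb]_(t in `]0%R, +oo[) (g t)%:E = \int[leb]_(t in `]0%R, M]) (g t)%:E)%E.
Proof.
move=> gM; rewrite integral_mkcond [RHS]integral_mkcond; apply: eq_integral => t _.
rewrite !patchE !mem_setE !in_itv /= andbT.
case: ifPn => //= t0; case: leP => // Mt; rewrite gM//.
by rewrite gtr0_norm.
Qed.

Lemma ftc_half h M : (forall t, derivable h t 1) ->
  continuous (fun t => 'D_1 h t) -> (forall t, M < `|t| -> h t = 0) ->
  (\int[leb]_(t in `]0%R, +oo[) ('D_1 h t)%:E = (- h 0)%:E)%E.
Proof.
move=> dh ch hM; pose N := `|M| + 1.
have MN : M < N by rewrite /N ltr_pwDr// ler_norm.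
have N0 : 0 < N by rewrite /N ltr_pwDr.
rewrite (@integral_supp_half _ N); last first.
  by move=> t Nt; apply: (derive_supp hM); exact: lt_trans Nt.
have mh : measurable_fun setT (fun t => 'D_1 h t) by exact: continuous_measurable_fun.
rewrite -[LHS]/(\int[leb]_(t in `]0%R, N]) ((fun t => 'D_1 h t) t)%:E)%E.
rewrite integral_itv_obnd_cbnd; last by apply/measurable_EFinP; exact: measurable_funS mh.
rewrite ftc_itv// hM ?sub0r//.
by rewrite gtr0_norm.
Qed.

End ftc_line.

(** Along a line the difference quotients of [G \o A] and of [G] are the same functions of the
    increment, so derivability and the derivative are transferred together, without a chain rule. *)
Lemma derive_comp_line (R : realType) (U V : normedModType R) (G : V -> R)
    (A : U -> V) (v : U) (w : V) x :
  (forall s, A (s *: v + x) = s *: w + A x) ->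
  'D_v (G \o A) x = 'D_w G (A x) /\ (derivable G (A x) w -> derivable (G \o A) x v).
Proof.
move=> Ax; have E : (fun t => t^-1 *: (((G \o A) \o shift x) (t *: v) - (G \o A) x)) =
   (fun t => t^-1 *: ((G \o shift (A x)) (t *: w) - G (A x))).
  by apply/funext => t /=; rewrite Ax.
by split; rewrite /derive /derivable E.
Qed.

Section divergence_rV.
Variable R : realType.
Local Notation leb := (@lebesgue_measure R).

(** Regularity is asked only in the direction [v]: this form passes directly to slices in the
    induction on the dimension. *)
Definition C1dir d (v : 'rV[R]_d) (G : 'rV[R]_d -> R) :=
  [/\ forall x, derivable G x v, continuous (fun x => 'D_v G x) &
      exists M, forall x, ~ rVbox M x -> G x = 0].

Lemma compact_rVbox d (M : R) : compact (@rVbox R d M).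
Proof.
rewrite (_ : rVbox M = [set v : 'rV[R]_d | forall i, `[- M, M]%classic (v ord0 i)]); last first.
  by apply/seteqP; split => x h i; have := h i; rewrite /= in_itv /= -ler_norml.
exact: (@rV_compact R d (fun=> `[- M, M]%classic) (fun=> @segment_compact R _ _)).
Qed.

Lemma derive_supp_rV d (v : 'rV[R]_d) (G : 'rV[R]_d -> R) (M : R) :
  (forall x, ~ rVbox M x -> G x = 0) -> forall x, ~ rVbox M x -> 'D_v G x = 0.
Proof.
move=> GM x nx; rewrite (@near_eq_derive _ _ _ _ (cst 0)) ?derive_cst//.
have /compact_closed : compact (@rVbox R d M) by exact: compact_rVbox.
move=> /(_ (@norm_hausdorff _ _)) /closed_openC oC.
have : nbhs x (~` rVbox M) by move: oC; rewrite openE; exact.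
by apply: filterS => y; exact: GM.
Qed.

Lemma integrable_cts_rV d (g : 'rV[R]_d -> R) M : continuous g ->
  (forall x, ~ rVbox M x -> g x = 0) -> (lebesgue_rV d).-integrable setT (EFin \o g).
Proof.
move=> cg gM.
have cn : continuous (fun x : 'rV[R]_d => `|g x|).
  by move=> x; apply: (@continuous_comp _ _ _ g (fun y : R => `|y|)); [exact: cg|exact: norm_continuous].
have [B gB] : exists B, forall x, `|g x| <= B.
  have [[x0 x0M]|no] := pselect (exists x, @rVbox R d M x); last first.
    by exists 0 => x; rewrite gM ?normr0// => h; apply: no; exists x.
  have A0 : @rVbox R d M !=set0 by exists x0.
  have c : {within rVbox M, continuous (fun x => `|g x|)}.
    apply: continuous_subspaceT; exact: cn.
  have [c0 _ h] := compact_EVT_max A0 (@compact_rVbox d M) c.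
  exists `|g c0| => x; have [xM|xM] := pselect (rVbox M x); first by apply: h; rewrite inE.
  by rewrite gM// normr0.
have mg := continuous_measurable_rV cg.
have -> : EFin \o g = (EFin \o g) \_ (rVbox M).
  by apply/funext => x; rewrite patchE; case: ifPn => //; rewrite notin_setE /= => /gM ->.
apply/(integrable_mkcond _ (measurable_rVbox _)).
apply: measurable_bounded_integrable.
- exact: measurable_rVbox.
- exact: rVbox_lty.
- exact: measurable_funS mg.
- exists B; split=> [|M' BM' x _ /=]; first exact: num_real.
  exact: le_trans (ltW BM').
Qed.

Lemma rV_consE d (t : R) (y : 'rV[R]_d) (s : R) :
  rV_cons (s *: 1 + t, y) = s *: delta_mx ord0 ord0 + rV_cons (t, y).
Proof.
apply/rowP => i; rewrite !mxE /= /GRing.scale /= mulr1.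
case: (unliftP ord0 i) => [j ->|->].
  by rewrite /= mulr0 add0r.
by rewrite /= mulr1.
Qed.

Lemma rV_consE_lift d (j : 'I_d) (t : R) (y : 'rV[R]_d) (s : R) :
  rV_cons (t, s *: delta_mx ord0 j + y) =
  s *: delta_mx ord0 (lift ord0 j) + rV_cons (t, y).
Proof.
apply/rowP => i; rewrite !mxE /=.
case: (unliftP ord0 i) => [k ->|->]; last by rewrite /= mulr0 add0r.
by rewrite /= !mxE /= (inj_eq lift_inj).
Qed.

Lemma rV_cons_continuous d : continuous (@rV_cons R d).
Proof.
move=> -[t y]; apply/cvg_ballP => e e0.
exists (ball t e, ball y e) => /=; first by split; exact: nbhsx_ballx.
move=> -[t' y'] /= [h1 h2]; split=> // i j.
rewrite !mxE; case: unliftP => [k _|_] //=.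
by case: h2 => _; exact.
Qed.

Lemma rVbox_cons d M (t : R) (y : 'rV[R]_d) :
  rVbox M (rV_cons (t, y)) <-> `|t| <= M /\ rVbox M y.
Proof.
split=> [h|[h1 h2] i].
  split; first by have := h ord0; rewrite mxE unlift_none.
  by move=> i; have := h (lift ord0 i); rewrite mxE liftK.
by rewrite mxE; case: unliftP => [j _|_] //=.
Qed.

(** Induction on [d] follows the recursive definition of [lebesgue_rV], a pushforward of a product.
    The derivative in the first coordinate is integrated first and vanishes by [ftc_line]; for any
    other coordinate the first variable is frozen and the induction hypothesis applies to the
    slice. *)
Lemma divergence_rV d (j : 'I_d) (G : 'rV[R]_d -> R) : C1dir (delta_mx ord0 j) G ->
  (\int[lebesgue_rV d]_x ('D_(delta_mx ord0 j) G x)%:E = 0)%E.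
Proof.
elim: d j G => [[]//|d ih] j G [dG cG [M GM]].
pose G' := fun x => 'D_(delta_mx ord0 j) G x.
have G'M x : ~ rVbox M x -> G' x = 0 by exact: derive_supp_rV.
have iG : (lebesgue_rV d.+1).-integrable setT (EFin \o G').
  exact: integrable_cts_rV G'M.
have mG := continuous_measurable_rV cG.
have mc := @measurable_rV_cons R d.
have cc1 (y : 'rV[R]_d) : continuous (fun t : R => rV_cons (t, y)).
  move=> t; apply: (@continuous_comp _ _ _ (fun t : R => (t, y)) (@rV_cons R d)).
    by apply: differentiable_continuous; apply: differentiable_pair.
  exact: rV_cons_continuous.
have cc2 (t : R) : continuous (fun y : 'rV[R]_d => rV_cons (t, y)).
  move=> y; apply: (@continuous_comp _ _ _ (fun y => (t, y)) (@rV_cons R d)).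
    by apply: differentiable_continuous; apply: differentiable_pair.
  exact: rV_cons_continuous.
have ig : (lebesgue_measure \x lebesgue_rV d)%E.-integrable setT
    (fun p => (G' (@rV_cons R d p))%:E).
  apply/integrableP; split.
    by apply/measurable_EFinP; exact: measurableT_comp.
  move/integrableP : iG => [mG']; rewrite ge0_integral_pushforward//.
  exact: (@measurableT_comp _ _ _ _ _ _ abse _ (EFin \o G')).
transitivity (\int[lebesgue_measure \x lebesgue_rV d]_p (G' (@rV_cons R d p))%:E)%E.
  by rewrite integral_pushforward//; exact/measurable_EFinP.
case: (unliftP ord0 j) => [k jk|j0].
  rewrite -integral12_prod_meas1//; apply: integral0_eq => t _.
  rewrite /fubini_F; transitivity (\int[lebesgue_rV d]_y
      ('D_(delta_mx ord0 k) (G \o (fun y => rV_cons (t, y))) y)%:E)%E.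
    apply: eq_integral => y _; congr EFin; rewrite /G' jk; apply/esym.
    by have [] := @derive_comp_line R _ _ G (fun y => rV_cons (t, y)) (delta_mx ord0 k) _ y (rV_consE_lift k t y).
  have dc y := @derive_comp_line R _ _ G (fun y => rV_cons (t, y)) (delta_mx ord0 k) _ y (rV_consE_lift k t y).
  apply: ih; split.
  - by move=> y; apply: (dc y).2; rewrite -jk.
  - rewrite (_ : (fun _ => _) = G' \o (fun y => rV_cons (t, y))); last first.
      by apply/funext => y; rewrite (dc y).1 /G' jk.
    by move=> y; apply: continuous_comp; [exact: cc2|exact: cG].
  - exists M => y ny; apply: GM => /rVbox_cons[_]; exact: ny.
rewrite -integral21_prod_meas1//; apply: integral0_eq => y _.
rewrite /fubini_G; have dc t := @derive_comp_line R _ _ G (fun t : R => rV_cons (t, y)) 1 _ t (rV_consE t y).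
transitivity (\int[lebesgue_measure]_t
    ('D_1 (G \o (fun t => rV_cons (t, y))) t)%:E)%E.
  by apply: eq_integral => t _; congr EFin; rewrite /G' j0 (dc t).1.
apply: (@ftc_line _ _ M).
- by move=> t; apply: (dc t).2; rewrite -j0.
- rewrite (_ : (fun _ => _) = G' \o (fun t => rV_cons (t, y))); last first.
    by apply/funext => t; rewrite (dc t).1 /G' j0.
  by move=> t; apply: continuous_comp; [exact: cc1|exact: cG].
- by move=> t Mt; apply: GM => /rVbox_cons[]; rewrite leNgt Mt.
Qed.

End divergence_rV.

Section half_space_integrals.
Variables (R : realType) (d : nat).
Local Notation Rd := 'rV[R]_d.
Local Notation pt := (Rd * R)%type.
Local Notation leb := (@lebesgue_measure R).
Local Notation mu := (lebesgue_rV d \x lebesgue_measure)%E.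
Local Notation sigma := (lebesgue_rV d).
Local Notation Omega := (@half_space R d).
Local Notation E := (`]0%R, +oo[%classic : set R).
Implicit Types (f g : pt -> R[i]) (v x : pt) (G : pt -> R).

Lemma patch_half G (y : Rd) (t : R) :
  ((fun x => (G x)%:E) \_ Omega) (y, t) = ((fun t => (G (y, t))%:E) \_ E) t.
Proof.
rewrite !patchE; congr (if _ then _ else _).
by apply/idP/idP; rewrite !inE /half_space /= in_itv /= andbT.
Qed.

Lemma fubini_half12 G : mu.-integrable Omega (fun x => (G x)%:E) ->
  (\int[mu]_(x in Omega) (G x)%:E =
   \int[sigma]_y \int[leb]_(t in E) (G (y, t))%:E)%E.
Proof.
move=> iG; rewrite integral_mkcond -integral12_prod_meas1; last first.
  by apply: (proj1 (integrable_mkcond _ _)) iG; exact: (@measurable_half_space R d).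
apply: eq_integral => y _; rewrite /fubini_F [RHS]integral_mkcond.
by apply: eq_integral => t _; rewrite patch_half.
Qed.

Lemma fubini_half21 G : mu.-integrable Omega (fun x => (G x)%:E) ->
  (\int[mu]_(x in Omega) (G x)%:E =
   \int[leb]_(t in E) \int[sigma]_y (G (y, t))%:E)%E.
Proof.
move=> iG; rewrite integral_mkcond -integral21_prod_meas1; last first.
  by apply: (proj1 (integrable_mkcond _ _)) iG; exact: (@measurable_half_space R d).
rewrite [RHS]integral_mkcond; apply: eq_integral => t _.
rewrite /fubini_G patchE; case: ifPn => tE.
  by apply: eq_integral => y _; rewrite patch_half patchE tE.
by apply: integral0_eq => y _; rewrite patch_half patchE (negbTE tE).
Qed.

Lemma ctest_cintegrable D f : measurable D -> ctest f -> cintegrable mu D f.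
Proof.
move=> mD tf; have [B B0 fB] := ctest_bound tf; have [M fM] := tf.2.
have [m1 m2] := ctest_cmeasurable tf.
have K (h : pt -> R) : measurable_fun setT h ->
    (forall x, `|h x| <= normc (f x)) -> mu.-integrable D (fun x => (h x)%:E).
  move=> mh hf; apply: (@integrableS _ _ _ _ setT) => //.
  have -> : (fun x => (h x)%:E) = (EFin \o h) \_ (ptbox M).
    apply/funext => x; rewrite patchE; case: ifPn => //; rewrite notin_setE /= => /fM fx.
    congr EFin; apply/eqP; rewrite -normr_le0 (le_trans (hf x))//.
    by rewrite fx normc_nsq nsq0 sqrtr0.
  apply: (proj1 (integrable_mkcond _ _)); first exact: measurable_ptbox.
  apply: measurable_bounded_integrable.
  - exact: measurable_ptbox.
  - exact: ptbox_lty.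
  - exact: measurable_funS mh.
  - exists (Num.sqrt B); split=> [|M' BM' x _ /=]; first exact: num_real.
    rewrite (le_trans _ (ltW BM'))// (le_trans (hf x))// normc_nsq.
    exact: ler_wsqrtr.
split; apply: K => // x; [exact: normr_Re_le|exact: normr_Im_le].
Qed.

Lemma slice_divergence_re f (j : 'I_d) t : ctest f ->
  (\int[sigma]_y (Re (cderive (basis_vector R (lift ord_max j)) f (y, t)))%:E = 0)%E.
Proof.
move=> tf; have tdf := ctest_derive (basis_vector R (lift ord_max j)) tf.
have [sf [M fM]] := tf.
have dr x w : derivable (fun x => Re (f x)) x w.
  by apply: diff_derivable; have [] := csmooth_diff x sf.
have cD : continuous (fun x => 'D_(basis_vector R (lift ord_max j)) (fun x => Re (f x)) x).
  exact: (csmooth_continuousRe tdf.1).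
move: cD; rewrite /cderive /basis_vector liftK /= => cD.
have lineA (y : Rd) (s : R) : (s *: delta_mx ord0 j + y, t) = s *: ((delta_mx ord0 j, 0) : pt) + (y, t).
  by apply: injective_projections => //=; rewrite scaler0 add0r.
have dc y := @derive_comp_line R _ _ (fun x => Re (f x)) (fun y : Rd => (y, t) : pt) (delta_mx ord0 j) _ y (lineA y).
transitivity (\int[sigma]_y ('D_(delta_mx ord0 j) (fun y => Re (f (y, t))) y)%:E)%E.
  by apply: eq_integral => y _; congr EFin; rewrite -(dc y).1.
apply: divergence_rV; split.
- by move=> y; apply: (dc y).2; exact: dr.
- rewrite (_ : (fun _ => _) = (fun x => 'D_(delta_mx ord0 j, 0) (fun x => Re (f x)) x) \o (fun y => (y, t))); last first.
    by apply/funext => y; rewrite -[RHS](dc y).1.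
  move=> y; apply: continuous_comp; last exact: cD.
  by apply: differentiable_continuous; apply: differentiable_pair.
- by exists M => y ny; rewrite fM// => -[].
Qed.

Lemma divergence_half_re f (i : 'I_d.+1) : ctest f -> (forall y, f (y, 0) = 0) ->
  (\int[mu]_(x in Omega) (Re (cderive (basis_vector R i) f x))%:E = 0)%E.
Proof.
move=> tf f0.
have tdf := ctest_derive (basis_vector R i) tf.
have iD := (ctest_cintegrable (@measurable_half_space R d) tdf).1.
have [sf [M fM]] := tf.
have dr x w : derivable (fun x => Re (f x)) x w.
  by apply: diff_derivable; have [] := csmooth_diff x sf.
have cD : continuous (fun x => 'D_(basis_vector R i) (fun x => Re (f x)) x).
  exact: (csmooth_continuousRe tdf.1).
move: iD cD; rewrite /cderive /basis_vector; case: (unliftP ord_max i) => [j _|_] /= iD cD.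
- rewrite fubini_half21//; apply: integral0_eq => t _.
  by have := slice_divergence_re j t tf; rewrite /cderive /basis_vector liftK.
- rewrite fubini_half12//; apply: integral0_eq => y _.
  have lineA (t : R) (s : R) : (y, s *: 1 + t) = s *: ((0, 1) : pt) + (y, t).
    by apply: injective_projections => //=; rewrite scaler0 add0r.
  have dc t := @derive_comp_line R _ _ (fun x => Re (f x)) (fun t : R => (y, t) : pt) 1 _ t (lineA t).
  transitivity (\int[leb]_(t in E) ('D_1 (fun t => Re (f (y, t))) t)%:E)%E.
    by apply: eq_integral => t _; congr EFin; rewrite -(dc t).1.
  rewrite (@ftc_half _ _ M).
  + by rewrite f0 /= oppr0.
  + by move=> t; apply: (dc t).2; exact: dr.
  + rewrite (_ : (fun _ => _) = (fun x => 'D_(0, 1) (fun x => Re (f x)) x) \o (fun t => (y, t))); last first.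
      by apply/funext => t; rewrite -[RHS](dc t).1.
    move=> t; apply: continuous_comp; last exact: cD.
    by apply: differentiable_continuous; apply: differentiable_pair.
  + by move=> t Mt; rewrite fM// => /ptboxP[_]; rewrite leNgt Mt.
Qed.

Lemma divergence_half f (i : 'I_d.+1) : ctest f -> (forall y, f (y, 0) = 0) ->
  cintegral mu Omega (cderive (basis_vector R i) f) = 0.
Proof.
move=> tf f0; set v := basis_vector R i.
have re0 g : ctest g -> (forall y, g (y, 0) = 0) ->
    \int[mu]_(x in Omega) Re (cderive v g x) = 0.
  by move=> tg g0; rewrite /Rintegral (divergence_half_re i tg g0).
(* The imaginary part of [f] is the real part of [- 'i * f], so the real statement covers both. *)
have ti : ctest (fun x => - 'i * f x) by exact: ctestZ.
apply: eqc; first exact: re0.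
have z y : - 'i * f (y, 0) = 0 by rewrite f0 mulr0.
rewrite -[RHS](re0 _ ti z); apply: eq_Rintegral => x _.
have dc : cdifferentiable (fun=> - 'i : R[i]) x by exact: cdifferentiable_cst.
rewrite (cderiveM _ dc (csmooth_diff x tf.1)) cderive_cst mul0r add0r.
by rewrite ReM /= oppr0 mul0r sub0r mulN1r opprK.
Qed.

(** The divergence theorem for [f * cj g], which inherits the zero boundary values of [f]. *)
Lemma ip_byparts f g (i : 'I_d.+1) : ctest f -> ctest g -> (forall y, f (y, 0) = 0) ->
  ip mu Omega (cderive (basis_vector R i) f) g = - ip mu Omega f (cderive (basis_vector R i) g).
Proof.
move=> tf tg f0; set e := basis_vector R i.
have mO := @measurable_half_space R d.
have tfg : ctest (fun x => f x * cj (g x)).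
  by apply: ctestM; [exact: tf.1|exact: ctestJ].
have dfg x : cderive e (fun x => f x * cj (g x)) x =
    cderive e f x * cj (g x) + f x * cj (cderive e g x).
  rewrite cderiveM ?cderiveJ//; apply: csmooth_diff; [exact: tg.1|exact: tf.1|].
  by apply: csmoothJ; exact: tg.1.
apply/eqP; rewrite -addr_eq0 /ip -cintegralD//.
- rewrite -(@divergence_half _ i tfg); last by move=> y; rewrite f0 mul0r.
  by apply/eqP; apply: eq_cintegral => x _; rewrite dfg.
- by apply: sqint_ip => //; apply: ctest_sqint => //; exact: ctest_derive.
- by apply: sqint_ip => //; apply: ctest_sqint => //; exact: ctest_derive.
Qed.

End half_space_integrals.

(** * Products of a tangential and a normal factor *)

Section tensor.
Variables (R : realType) (d : nat).
Local Notation Rd := 'rV[R]_d.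
Local Notation pt := (Rd * R)%type.
Local Notation leb := (@lebesgue_measure R).
Local Notation mu := (lebesgue_rV d \x lebesgue_measure)%E.
Local Notation sigma := (lebesgue_rV d).
Local Notation Omega := (@half_space R d).
Local Notation E := (`]0%R, +oo[%classic : set R).

Lemma tensor_integrable (a : Rd -> R) (b : R -> R) :
  sigma.-integrable setT (fun y => (a y)%:E) ->
  leb.-integrable E (fun t => (b t)%:E) ->
  mu.-integrable Omega (fun x => (a x.1 * b x.2)%:E).
Proof.
move=> ia ib.
(* Extending [b] by zero turns the half-space into the full product, where Tonelli's theorem
   applies. *)
have ibE : leb.-integrable setT (fun t => ((b \_ E) t)%:E).
  have : leb.-integrable setT ((fun t => (b t)%:E) \_ E).
    by apply: (proj1 (integrable_mkcond _ _)) ib; exact: measurable_itv.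
  by apply: eq_integrable => // t _; rewrite !patchE; case: ifP.
have ma : measurable_fun setT a by move/integrableP : ia => [/measurable_EFinP].
have mb : measurable_fun setT (b \_ E) by move/integrableP : ibE => [/measurable_EFinP].
have mab : measurable_fun setT (fun x : pt => (a x.1 * (b \_ E) x.2)%:E).
  apply/measurable_EFinP; apply: measurable_funM.
    exact: (measurableT_comp ma measurable_fst).
  exact: (measurableT_comp mb measurable_snd).
have iab : mu.-integrable setT (fun x => (a x.1 * (b \_ E) x.2)%:E).
  apply: (proj2 (integrable12ltyP _ _ _)); first exact: mab.
  rewrite [X in (X < _)%E](_ : _ = \int[sigma]_y (`|(a y)%:E| * \int[leb]_t `|((b \_ E) t)%:E|)%E)%E.
    rewrite ge0_integralZr//.
    - rewrite lte_mul_pinfty//; last by move/integrableP : ibE => [].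
        exact: integral_ge0.
      rewrite ge0_fin_numE; last exact: integral_ge0.
      by move/integrableP : ia => [].
    - apply: (@measurableT_comp _ _ _ _ _ _ abse _ (EFin \o a)) => //.
      exact/measurable_EFinP.
    - exact: integral_ge0.
  apply: eq_integral => y _; rewrite -ge0_integralZl//.
    by apply: eq_integral => t _; rewrite EFinM abseM.
  apply: (@measurableT_comp _ _ _ _ _ _ abse _ (EFin \o (b \_ E))) => //.
  exact/measurable_EFinP.
have mO := @measurable_half_space R d.
have iO : mu.-integrable Omega (fun x => (a x.1 * (b \_ E) x.2)%:E).
  by apply: integrableS iab.
move: iO; apply: eq_integrable => // x; rewrite inE /half_space /= => x0.
by rewrite patchE ifT// inE /= in_itv /= x0.
Qed.

Lemma tensor_integral (a : Rd -> R) (b : R -> R) :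
  sigma.-integrable setT (fun y => (a y)%:E) ->
  leb.-integrable E (fun t => (b t)%:E) ->
  \int[mu]_(x in Omega) (a x.1 * b x.2) =
  (\int[sigma]_y a y) * (\int[leb]_(t in E) b t).
Proof.
move=> ia ib; have mE : (R.-ocitv.-measurable).-sigma.-measurable E by exact: measurable_itv.
rewrite /Rintegral fubini_half12; last exact: tensor_integrable.
transitivity (fine (\int[sigma]_y ((a y)%:E * (\int[leb]_(t in E) b t)%:E)%E)%E).
  congr fine; apply: eq_integral => y _ /=.
  rewrite -[RHS]EFinM -(RintegralZl _ mE ib) /Rintegral fineK//.
  apply: (integrable_fin_num mE).
  exact: (integrableZl mE (a y) ib).
rewrite integralZr// fineM//.
exact: integrable_fin_num.
Qed.

Lemma tensor_cintegrable (f : Rd -> R[i]) (g : R -> R[i]) :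
  cintegrable sigma setT f -> cintegrable leb E g ->
  cintegrable mu Omega (fun x => f x.1 * g x.2) /\
  cintegral mu Omega (fun x => f x.1 * g x.2) =
  cintegral sigma setT f * cintegral leb E g.
Proof.
move=> [f1 f2] [g1 g2].
have mO := @measurable_half_space R d.
have rr := tensor_integrable f1 g1; have ri := tensor_integrable f1 g2.
have ir := tensor_integrable f2 g1; have ii := tensor_integrable f2 g2.
split.
  split.
    by under eq_fun do rewrite ReM EFinB; exact: integrableB.
  by under eq_fun do rewrite ImM EFinD; exact: integrableD.
apply: eqc; rewrite ?(ReM, ImM) /=.
  rewrite -!tensor_integral// -RintegralB//.
  by apply: eq_Rintegral => x _; rewrite ReM.
rewrite -!tensor_integral// -RintegralD//.
by apply: eq_Rintegral => x _; rewrite ImM.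
Qed.

Lemma tensor_sqint (f : Rd -> R[i]) (g : R -> R[i]) :
  sqint sigma setT f -> sqint leb E g -> sqint mu Omega (fun x => f x.1 * g x.2).
Proof.
move=> [[mf1 mf2] If] [[mg1 mg2] Ig]; split; last first.
  by under eq_fun do rewrite nsqM; exact: (tensor_integrable (a := fun y => nsq (f y)) (b := fun t => nsq (g t)) If Ig).
have cf : forall h : Rd -> R, measurable_fun setT h -> measurable_fun Omega (fun x : pt => h x.1).
  move=> h mh; apply: (measurable_funS measurableT) => //.
  exact: (measurableT_comp mh measurable_fst).
have cg : forall h : R -> R, measurable_fun E h -> measurable_fun Omega (fun x : pt => h x.2).
  move=> h mh; have mE : (R.-ocitv.-measurable).-sigma.-measurable E by exact: measurable_itv.
  have mhE : measurable_fun setT (h \_ E).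
    by apply/(measurable_restrict h mE measurableT); rewrite setTI.
  apply: (@eq_measurable_fun _ _ _ _ _ (fun x : pt => (h \_ E) x.2)).
    move=> x; rewrite inE /half_space /= => x0.
    by rewrite patchE ifT// inE /= in_itv /= x0.
  apply: (measurable_funS measurableT) => //.
  exact: (measurableT_comp mhE measurable_snd).
apply: cmeasurableM.
  by split; [exact: (cf (fun y => Re (f y)))|exact: (cf (fun y => Im (f y)))].
by split; [exact: (cg (fun y => Re (g y)))|exact: (cg (fun y => Im (g y)))].
Qed.

Lemma tensor_ip (f f' : Rd -> R[i]) (g g' : R -> R[i]) :
  sqint sigma setT f -> sqint leb E g -> sqint sigma setT f' -> sqint leb E g' ->
  ip mu Omega (fun x => f x.1 * g x.2) (fun x => f' x.1 * g' x.2) =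
  ip sigma setT f f' * ip leb E g g'.
Proof.
move=> sf sg sf' sg'; have mE : (R.-ocitv.-measurable).-sigma.-measurable E by exact: measurable_itv.
rewrite /ip -(tensor_cintegrable (sqint_ip measurableT sf sf') (sqint_ip mE sg sg')).2.
by apply: eq_cintegral => x _; rewrite conjM; ring.
Qed.

End tensor.

(** * Dilations in the normal variable *)

Section scaling.
Variables (R : realType) (d : nat).
Local Notation Rd := 'rV[R]_d.
Local Notation pt := (Rd * R)%type.
Local Notation leb := (@lebesgue_measure R).
Local Notation mu := (lebesgue_rV d \x lebesgue_measure)%E.
Local Notation sigma := (lebesgue_rV d).
Local Notation Omega := (@half_space R d).
Local Notation E := (`]0%R, +oo[%classic : set R).
Implicit Types (f g : pt -> R[i]) (c : R).

(** Bounded support reduces the half-line to [[0, N]], which multiplication by [c] pulls back to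
    [[0, N / c]]. *)
Lemma scale_line (h : R -> R) M c : 0 < c -> continuous h ->
  (forall t, M < `|t| -> h t = 0) ->
  (\int[leb]_(t in E) (h t)%:E = \int[leb]_(t in E) (c * h (c * t))%:E)%E.
Proof.
move=> c0 ch hM; pose N := `|M| + 1.
have MN : M < N by rewrite /N ltr_pwDr// ler_norm.
have N0 : 0 < N by rewrite /N ltr_pwDr.
have cc : continuous (fun t => c * h (c * t)).
  move=> t; apply: cvgM; first exact: cvg_cst.
  apply: (@continuous_comp _ _ _ (fun t => c * t) h); last exact: ch.
  exact: mulrl_continuous.
rewrite (@integral_supp_half _ h N); last first.
  by move=> t Nt; apply: hM; exact: lt_trans Nt.
rewrite (@integral_supp_half _ (fun t => c * h (c * t)) (N / c)); last first.
  move=> t Nt; rewrite hM ?mulr0//; rewrite normrM gtr0_norm//.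
  by rewrite (lt_trans MN)// mulrC -ltr_pdivrMr.
have obnd (g : R -> R) (b : R) : continuous g ->
    (\int[leb]_(t in `]0%R, b]) (g t)%:E = \int[leb]_(t in `[0%R, b]) (g t)%:E)%E.
  move=> cg; rewrite integral_itv_obnd_cbnd//; apply/measurable_EFinP.
  by apply: (measurable_funS measurableT) => //; exact: continuous_measurable_fun.
rewrite !obnd//.
have Nc : 0 < N / c by rewrite divr_gt0.
have dF (t : R) : is_derive t 1 (fun t : R => c * t) c.
  by apply: is_derive_eq; rewrite /GRing.scale /= mulr1.
have F' : derive1 (fun t : R => c * t) = cst c.
  by apply/funext => t; rewrite derive1E; have [] := dF t.
have := @integration_by_substitution_increasing R (fun t => c * t) h 0 (N / c) (ltW Nc).
rewrite mulr0 mulrCA divff ?gt_eqF// mulr1 => ->.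
- by apply: eq_integral => t _; rewrite F' /= mulrC.
- by move=> x y _ _ xy; rewrite ltr_pM2l.
- by rewrite F' => t _; exact: cvg_cst.
- by rewrite F'; exact: is_cvg_cst.
- by rewrite F'; exact: is_cvg_cst.
- split.
  + by move=> t _; have [] := dF t.
  + by apply: cvg_at_right_filter; exact: mulrl_continuous.
  + by apply: cvg_at_left_filter; exact: mulrl_continuous.
- by apply: continuous_subspaceT.
Qed.

Definition sc c (x : pt) : pt := (x.1, c * x.2).

Lemma sc_aff c : sc c = aff 1 0 c 0.
Proof. by apply/funext => x; rewrite /sc /aff scale1r !addr0. Qed.

Lemma ctest_sc f c : 0 < c -> ctest f -> ctest (f \o sc c).
Proof. by rewrite sc_aff; exact: ctest_scale. Qed.

Lemma cderive_sc_tan f c (j : 'I_d) :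
  cderive (basis_vector R (lift ord_max j)) (f \o sc c) =
  cderive (basis_vector R (lift ord_max j)) f \o sc c.
Proof.
rewrite sc_aff cderive_aff /basis_vector liftK /lin /=.
by rewrite scale1r mulr0.
Qed.

Lemma cderive_sc_nor f c x : ctest f ->
  cderive (basis_vector R ord_max) (f \o sc c) x =
  c%:C * cderive (basis_vector R ord_max) f (sc c x).
Proof.
move=> [sf _]; rewrite sc_aff cderive_aff /basis_vector unlift_none /lin /=.
have df := csmooth_diff (aff 1 0 c 0 x) sf.
have -> : (1 *: 0, c * 1) = c *: ((0, 1) : pt).
  by apply: injective_projections => /=; rewrite ?scaler0// mulr1.
exact: (cderive_scale c _ df).
Qed.

Lemma scale_half f c : 0 < c -> ctest f ->
  cintegral mu Omega f = c%:C * cintegral mu Omega (f \o sc c).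
Proof.
move=> c0 tf; have tfc := ctest_sc c0 tf.
have mO := @measurable_half_space R d.
have [i1 i2] := ctest_cintegrable mO tf; have [j1 j2] := ctest_cintegrable mO tfc.
have [sf [M fM]] := tf.
have key (G : pt -> R) : continuous G -> (forall x, ~ ptbox M x -> G x = 0) ->
    mu.-integrable Omega (fun x => (G x)%:E) ->
    mu.-integrable Omega (fun x => (G (sc c x))%:E) ->
    \int[mu]_(x in Omega) G x = c * \int[mu]_(x in Omega) G (sc c x).
  move=> cG GM iG iGc; rewrite -RintegralZl// /Rintegral fubini_half12//.
  rewrite (@fubini_half12 _ _ (fun x => c * G (sc c x))); last first.
    by under eq_fun do rewrite EFinM; exact: integrableZl.
  congr fine; apply: eq_integral => y _.
  apply: (@scale_line _ M c) => //.
    move=> t; apply: continuous_comp; last exact: cG.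
    by apply: differentiable_continuous; apply: differentiable_pair.
  by move=> t Mt; apply: GM => /ptboxP[_]; rewrite leNgt Mt.
apply: eqc; rewrite ?(ReM, ImM) /= mul0r ?subr0 ?addr0.
  by apply: key => //; [exact: csmooth_continuousRe|move=> x /fM ->].
by apply: key => //; [exact: csmooth_continuousIm|move=> x /fM ->].
Qed.

Lemma n2_sc f c : 0 < c -> ctest f -> n2 mu Omega f = c * n2 mu Omega (f \o sc c).
Proof.
move=> c0 tf; have tff : ctest (fun x => f x * cj (f x)).
  by apply: ctestM; [exact: tf.1|exact: ctestJ].
have := scale_half c0 tff.
rewrite -[LHS]/(ip mu Omega f f) -[X in _ = _ * X]/(ip mu Omega (f \o sc c) (f \o sc c)).
by rewrite !ip_n2 -rmorphM => /complexI.
Qed.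

(** The substitution by [c t] moves the inverse dilation off [g] and onto [f]; the factor [c] is its
    Jacobian and the conjugation restores the order of the arguments. This relates the two test
    functions of the real case. *)
Lemma ip_sc f g c : 0 < c -> ctest f -> ctest g ->
  ip mu Omega f (g \o sc c^-1) = c%:C * cj (ip mu Omega g (f \o sc c)).
Proof.
move=> c0 tf tg; have ci : 0 < c^-1 by rewrite invr_gt0.
have mO := @measurable_half_space R d.
rewrite -ipC//; [|exact: ctest_sqint..|by apply: ctest_sqint => //; exact: ctest_sc].
have tff : ctest (fun x => f x * cj (g (sc c^-1 x))).
  by apply: ctestM; [exact: tf.1|apply: ctestJ; exact: (ctest_sc ci tg)].
rewrite /ip (scale_half c0 tff); congr (_ * _); apply: eq_cintegral => x _ /=.
by rewrite /sc /= mulrA mulVf ?gt_eqF// mul1r -surjective_pairing.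
Qed.

End scaling.

(** * The eigenvalue equation on test functions *)

Lemma cvg0_sum (R : realType) I (r : seq I) (F : I -> nat -> R) :
  (forall i, F i k @[k --> \oo] --> (0 : R)) ->
  \sum_(i <- r) F i k @[k --> \oo] --> (0 : R).
Proof.
move=> F0; elim: r => [|i r ih].
  rewrite (_ : (fun k => _) = cst 0); first exact: cvg_cst.
  by apply/funext => k; rewrite big_nil.
rewrite (_ : (fun k => _) = (fun k => F i k + \sum_(i <- r) F i k)); last first.
  by apply/funext => k; rewrite big_cons.
have := cvgD (F0 i) ih; rewrite addr0; exact.
Qed.

Lemma le_add3 (R : realDomainType) (a b c : R) :
  0 <= a -> 0 <= b -> 0 <= c -> b <= a + b + c /\ c <= a + b + c.
Proof. by move=> *; split; lra. Qed.

Section weak_form.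
Variables (R : realType) (d : nat).
Local Notation Rd := 'rV[R]_d.
Local Notation pt := (Rd * R)%type.
Local Notation mu := (lebesgue_rV d \x lebesgue_measure)%E.
Local Notation sigma := (lebesgue_rV d).
Local Notation Omega := (@half_space R d).
Implicit Types (p q phi : pt -> R[i]).

Definition pd (i : 'I_d.+1) : (pt -> R[i]) -> pt -> R[i] := cderive (basis_vector R i).

Definition bd q : Rd -> R[i] := fun y => q (y, 0).

Definition dform p q : R[i] := \sum_(i < d.+1) ip mu Omega (pd i p) (pd i q).

Definition H1sq q : R := \sum_(i < d.+1) n2 mu Omega (pd i q) + n2 mu Omega q.

Definition bform (alpha : Rd -> R[i]) p q : R[i] :=
  ip sigma setT (fun y => alpha y * bd p y) (bd q).

(** The squared distance from [phi] to the eigenfunction, in H^1 and in L^2 of the boundary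
    together. The trace has its own term because it is given as a separate limit. *)
Definition defect (u : pt -> R[i]) (Du : 'I_d.+1 -> pt -> R[i]) (tu : Rd -> R[i]) phi : R :=
  \sum_(i < d.+1) n2 mu Omega (fun x => pd i phi x - Du i x) +
  n2 mu Omega (fun x => phi x - u x) +
  n2 sigma setT (fun y => bd phi y - tu y).

Let mO : measurable Omega := @measurable_half_space R d.

Lemma ctest_in_H1 q : ctest q -> in_H1 q (fun i => pd i q).
Proof.
move=> tq; split.
  by apply: sqint_in_Lp; [exact: mO|exact: ctest_sqint].
move=> i; split.
  by apply: sqint_in_Lp; [exact: mO|apply: ctest_sqint => //; exact: ctest_derive].
move=> phi tphi; have cphi := test_function_ctest tphi.
have tJ := ctestJ tq.
have phi0 (y : Rd) : phi (y, 0) = 0.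
  exact: (test_function_Omega tphi (x := (y, 0)) (lexx 0)).
(* Here [phi] is the factor vanishing on the boundary; conjugating [q] beforehand turns the
   sesquilinear pairing into the bilinear one of [weak_derivative]. *)
have := ip_byparts i cphi tJ phi0.
rewrite /ip => h.
transitivity (cintegral mu Omega (fun x => cderive (basis_vector R i) phi x * cj (cj (q x)))).
  by apply: eq_cintegral => x _; rewrite conjK mulrC.
rewrite h; congr (- _); apply: eq_cintegral => x _.
by rewrite cderiveJ ?conjK 1?mulrC//; apply: csmooth_diff; exact: tq.1.
Qed.

Lemma ctest_is_trace q : ctest q -> is_trace q (fun i => pd i q) (bd q).
Proof.
move=> tq; split.
  by apply: sqint_in_Lp => //; exact: ctest_slice_sqint.
have z dd (T : measurableType dd) (m : {measure set T -> \bar R}) (D : set T) (f : T -> R[i]) :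
    measurable D -> cLnorm m D 2%:E (fun x => f x - f x) = 0.
  move=> mD; rewrite (_ : (fun _ => _) = fun=> 0 : R[i]); last first.
    by apply/funext => x; rewrite subrr.
  rewrite cLnorm2_n2//; last exact: sqint0.
  by rewrite /n2 /Rintegral; under eq_integral do rewrite nsq0; rewrite integral0 sqrtr0.
exists (fun=> q); split.
- by move=> k; exact: ctest_test_function.
- by rewrite z//; exact: cvg_cst.
- by move=> i; rewrite z//; exact: cvg_cst.
- by rewrite z//; exact: cvg_cst.
Qed.

Lemma normc_le_sqrt (z : R[i]) (a b : R) : 0 <= a -> nsq z <= a * b ->
  normc z <= Num.sqrt a * Num.sqrt b.
Proof. by move=> a0 zab; rewrite normc_nsq -sqrtrM// ler_wsqrtr. Qed.

Lemma n2_le_H1sq i q : n2 mu Omega (pd i q) <= H1sq q.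
Proof.
rewrite /H1sq (bigD1 i)//= -addrA lerDl addr_ge0 ?n2_ge0//.
by apply: sumr_ge0 => j _; exact: n2_ge0.
Qed.

Lemma n2_le_H1sq0 q : n2 mu Omega q <= H1sq q.
Proof. by rewrite /H1sq lerDr; apply: sumr_ge0 => j _; exact: n2_ge0. Qed.

Lemma H1sq_ge0 q : 0 <= H1sq q.
Proof. exact: le_trans (n2_ge0 _ _ _) (n2_le_H1sq0 q). Qed.

Lemma normc_sum I (r : seq I) (F : I -> R[i]) :
  normc (\sum_(i <- r) F i) <= \sum_(i <- r) normc (F i).
Proof.
elim: r => [|i r ih]; first by rewrite !big_nil ComplexField.Normc.normc0.
rewrite !big_cons (le_trans (le_normcD _ _))// lerD2l//.
Qed.

Variables (alpha : Rd -> R[i]) (lambda : R[i]) (u : pt -> R[i]).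
Hypothesis alpha_oo : in_Lp sigma setT +oo%E alpha.
Hypothesis Hu : robin_laplacian alpha u (fun x => lambda * u x).
Hypothesis u_L2 : sqint mu Omega u.

(* The eigenvalue equation with [u] replaced by test functions: the error is controlled
   by their distance to [u] in H^1 and in trace. *)
Lemma robin_approx : exists Du tu,
  [/\ forall i, sqint mu Omega (Du i), sqint sigma setT tu,
      forall e, 0 < e -> exists phi, ctest phi /\ defect u Du tu phi <= e &
      exists2 C, 0 <= C & forall phi q, ctest phi -> ctest q ->
        normc (dform phi q - lambda * ip mu Omega phi q + bform alpha phi q) <=
        C * Num.sqrt (defect u Du tu phi) *
        Num.sqrt (H1sq q + n2 sigma setT (bd q))].
Proof.
have [_ [Du [tu [[_ hDu] [Ltu [phi [tphi c1 c2 c3]]] eqn]]]] := Hu.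
have sDu i : sqint mu Omega (Du i) by apply: in_Lp_sqint => //; exact: (hDu i).1.
have stu : sqint sigma setT tu by exact: in_Lp_sqint.
have sbd q : ctest q -> sqint sigma setT (bd q) by move=> tq; exact: ctest_slice_sqint.
have sq q : ctest q -> sqint mu Omega q by move=> tq; exact: ctest_sqint.
have spd i q : ctest q -> sqint mu Omega (pd i q).
  by move=> tq; apply: sq; exact: ctest_derive.
exists Du, tu; split=> //.
  move=> e e0.
  have tp k : ctest (phi k) by exact: test_function_ctest (tphi k).
  have d1 : n2 mu Omega (fun x => phi k x - u x) @[k --> \oo] --> (0 : R).
    by apply: cLnorm2_cvg0 => // k; apply: sqintB => //; exact: sq.
  have d2 i : n2 mu Omega (fun x => pd i (phi k) x - Du i x) @[k --> \oo] --> (0 : R).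
    by apply: cLnorm2_cvg0; [exact: mO|move=> k; apply: sqintB => //; exact: spd|exact: c2].
  have d3 : n2 sigma setT (fun y => bd (phi k) y - tu y) @[k --> \oo] --> (0 : R).
    by apply: cLnorm2_cvg0 => // k; apply: sqintB => //; exact: sbd.
  have dd : defect u Du tu (phi k) @[k --> \oo] --> (0 : R).
    have s1 := cvg0_sum (index_enum 'I_d.+1) d2.
    have := cvgD (cvgD s1 d1) d3; rewrite !addr0; exact.
  move/cvgrPdist_lt : dd => /(_ e e0)[k _ /(_ k (leqnn k))].
  rewrite sub0r normrN => h; exists (phi k); split => //.
  by rewrite ltW// (le_lt_trans (ler_norm _)).
have [ma [Ca [Ca0 aC]]] := in_Lpoo_bound alpha_oo.
have sal f : sqint sigma setT f -> sqint sigma setT (fun y => alpha y * f y).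
  by move=> sf; exact: (sqint_ae_bound _ Ca0 ma aC sf).1.
(* One Cauchy-Schwarz estimate for each of the [d.+1] derivatives, one for the mass term and one for
   the boundary term. *)
exists ((d.+1)%:R + normc lambda + Num.sqrt Ca).
  by rewrite !addr_ge0// ?normc_ge0 ?sqrtr_ge0.
move=> p q tp tq; set S := defect _ _ _ _; set Q := H1sq q + _.
have p1 : 0 <= \sum_(i < d.+1) n2 mu Omega (fun x => pd i p x - Du i x).
  by apply: sumr_ge0 => i _; exact: n2_ge0.
have p2 : 0 <= n2 mu Omega (fun x => p x - u x) by exact: n2_ge0.
have p3 : 0 <= n2 sigma setT (fun y => bd p y - tu y) by exact: n2_ge0.
have h1 i : n2 mu Omega (fun x => pd i p x - Du i x) <= S.
  rewrite /S /defect (bigD1 i)//= -!addrA lerDl !addr_ge0//.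
  by apply: sumr_ge0 => j _; exact: n2_ge0.
have h2 : n2 mu Omega (fun x => p x - u x) <= S by exact: (le_add3 p1 p2 p3).1.
have h3 : n2 sigma setT (fun y => bd p y - tu y) <= S by exact: (le_add3 p1 p2 p3).2.
have S0 : 0 <= S by exact: le_trans h2.
have q0 : 0 <= n2 sigma setT (bd q) by exact: n2_ge0.
have Q1 i : n2 mu Omega (pd i q) <= Q by rewrite (le_trans (n2_le_H1sq i q))// lerDl.
have Q2 : n2 mu Omega q <= Q by rewrite (le_trans (n2_le_H1sq0 q))// lerDl.
have Q3 : n2 sigma setT (bd q) <= Q by rewrite lerDr H1sq_ge0.
have := eqn q _ _ (ctest_in_H1 tq) (ctest_is_trace tq).
move=> E.
have conjE : (Num.conj : R[i] -> R[i]) = @cj R by apply/funext; case.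
move: E; rewrite /robin_form conjE => E.
have {}E : \sum_(i < d.+1) ip mu Omega (Du i) (pd i q) +
    ip sigma setT (fun y => alpha y * tu y) (bd q) = lambda * ip mu Omega u q.
  by rewrite -ipZl//; exact: sq.
(* Subtracting the exact equation [E] for the eigenfunction tested with [q] replaces [p] by its
   difference from the eigenfunction in every term. *)
have -> : dform p q - lambda * ip mu Omega p q + bform alpha p q =
   \sum_(i < d.+1) ip mu Omega (fun x => pd i p x - Du i x) (pd i q)
   - lambda * ip mu Omega (fun x => p x - u x) q
   + ip sigma setT (fun y => alpha y * (bd p y - tu y)) (bd q).
  have -> : ip sigma setT (fun y => alpha y * (bd p y - tu y)) (bd q) =
     bform alpha p q - ip sigma setT (fun y => alpha y * tu y) (bd q).
    rewrite -ipBl//; [|exact: sal (sbd _ tp)|exact: sal|exact: sbd].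
    by apply: eq_ip => // y _; rewrite mulrBr.
  rewrite ipBl//; [|exact: sq..].
  have -> : \sum_(i < d.+1) ip mu Omega (fun x => pd i p x - Du i x) (pd i q) =
     dform p q - \sum_(i < d.+1) ip mu Omega (Du i) (pd i q).
    rewrite /dform -sumrB; apply: eq_bigr => i _.
    by rewrite ipBl//; exact: spd.
  by rewrite mulrBr -E; ring.
have t1 : normc (\sum_(i < d.+1) ip mu Omega (fun x => pd i p x - Du i x) (pd i q))
    <= (d.+1)%:R * (Num.sqrt S * Num.sqrt Q).
  rewrite (le_trans (normc_sum _ _))//.
  apply: (@le_trans _ _ (\sum_(i < d.+1) (Num.sqrt S * Num.sqrt Q))).
    apply: ler_sum => i _; apply: normc_le_sqrt => //.
    apply: (le_trans (CauchySchwarz _ _ _)) => //.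
    - by apply: sqintB => //; exact: spd.
    - exact: spd.
    - by apply: ler_pM => //; exact: n2_ge0.
  by rewrite sumr_const card_ord mulr_natl.
have t2 : normc (lambda * ip mu Omega (fun x => p x - u x) q)
    <= normc lambda * (Num.sqrt S * Num.sqrt Q).
  rewrite ComplexField.Normc.normcM ler_wpM2l ?normc_ge0//.
  apply: normc_le_sqrt => //; apply: (le_trans (CauchySchwarz _ _ _)) => //.
  - by apply: sqintB => //; exact: sq.
  - exact: sq.
  - by apply: ler_pM => //; exact: n2_ge0.
have t3 : normc (ip sigma setT (fun y => alpha y * (bd p y - tu y)) (bd q))
    <= Num.sqrt Ca * (Num.sqrt S * Num.sqrt Q).
  rewrite mulrA -sqrtrM//; apply: normc_le_sqrt; first exact: mulr_ge0.
  have sb : sqint sigma setT (fun y => bd p y - tu y).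
    by apply: sqintB => //; exact: sbd.
  apply: (le_trans (CauchySchwarz _ _ _)) => //; [exact: sal|exact: sbd|].
  apply: ler_pM => //; [exact: n2_ge0|].
  rewrite (le_trans (sqint_ae_bound _ Ca0 ma aC sb).2)//.
  exact: ler_wpM2l.
rewrite -mulrA 2!mulrDl.
rewrite (le_trans (le_normcD _ _))// lerD//.
rewrite (le_trans (le_normcD _ _))// lerD//.
by rewrite normcN.
Qed.

End weak_form.

(** * Sup norm and Lipschitz bounds *)

Section sup_bounds.
Variables (R : realType) (d : nat).
Local Notation Rd := 'rV[R]_d.
Local Notation pt := (Rd * R)%type.
Local Notation mu := (lebesgue_rV d \x lebesgue_measure)%E.
Local Notation Omega := (@half_space R d).
Implicit Types (f g : pt -> R[i]).

Let mO : measurable Omega := @measurable_half_space R d.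

Lemma n2_sup f M B : 0 <= B -> sqint mu Omega f ->
  (forall x, Omega x -> nsq (f x) <= B) -> (forall x, Omega x -> ~ ptbox M x -> f x = 0) ->
  n2 mu Omega f <= B * fine (mu (ptbox M : set pt)).
Proof.
move=> B0 sf fB fM.
have mM := @measurable_ptbox R d M.
have i1 : mu.-integrable Omega (fun x => (B * \1_(ptbox M) x)%:E).
  apply: (@integrableS _ _ _ _ setT) => //.
  under eq_fun do rewrite EFinM.
  apply: integrableZl => //.
  apply/integrableP; split; first by apply/measurable_EFinP; exact: measurable_indic.
  under eq_integral do rewrite gee0_abs ?lee_fin//.
  by rewrite integral_indic ?setIT//; exact: ptbox_lty.
apply: (@le_trans _ _ (\int[mu]_(x in Omega) (B * \1_(ptbox M) x))).
  apply: le_Rintegral => //; first exact: sf.2.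
  move=> x Ox; rewrite indicE; case: (boolP (x \in ptbox M)) => [_|].
    by rewrite mulr1; exact: fB.
  by rewrite notin_setE => /(fM _ Ox) ->; rewrite nsq0 mulr0.
have i2 : mu.-integrable Omega (EFin \o (\1_(ptbox M) : pt -> R)).
  apply: (@integrableS _ _ _ _ setT) => //.
  apply/integrableP; split; first by apply/measurable_EFinP; exact: measurable_indic.
  under eq_integral do rewrite gee0_abs ?lee_fin//.
  by rewrite integral_indic ?setIT//; exact: ptbox_lty.
rewrite RintegralZl// ler_wpM2l// /Rintegral integral_indic// fine_le//.
- rewrite ge0_fin_numE ?measure_ge0//; apply: le_lt_trans (@ptbox_lty R d M).
  by apply: le_measure; rewrite ?inE//; exact: measurableI.
- by rewrite ge0_fin_numE ?measure_ge0//; exact: ptbox_lty.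
- by apply: le_measure; rewrite ?inE//; exact: measurableI.
Qed.

Lemma lipschitz_line (h : R -> R) L : (forall t, derivable h t 1) ->
  (forall t, `|'D_1 h t| <= L) -> forall s t, `|h s - h t| <= L * `|s - t|.
Proof.
move=> dh hL.
have key s t : t < s -> `|h s - h t| <= L * `|s - t|.
  move=> st; have [x _|x|c _ ->] := @MVT R h (fun t => 'D_1 h t) t s st.
  - by apply/derivableP; exact: dh.
  - apply: continuous_subspaceT => y.
    by apply: differentiable_continuous; apply/derivable1_diffP.
  - by rewrite normrM ler_wpM2r.
move=> a b; have [ab|ba|->] := ltgtP a b; last by rewrite !subrr normr0 mulr0.
  by rewrite distrC (distrC a); exact: key.
exact: key.
Qed.

(** The mean value theorem is applied to the real and imaginary parts separately, each contributing
    one bound [B] on the squared normal derivative. The constant is uniform in the tangential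
    variable. *)
Lemma ctest_lipschitz f : ctest f -> exists2 L, 0 <= L &
  forall (y : Rd) s t, nsq (f (y, s) - f (y, t)) <= L * (s - t) ^+ 2.
Proof.
move=> tf; have [B B0 fB] := ctest_bound (ctest_derive (basis_vector R ord_max) tf).
exists (2 * B); first by rewrite mulr_ge0.
move=> y s t; have [sf _] := tf.
have lineA (r : R) (h : R) : (y, h *: 1 + r) = h *: ((0, 1) : pt) + (y, r).
  by apply: injective_projections => //=; rewrite scaler0 add0r.
have bd (h : pt -> R) : (forall x w, derivable h x w) ->
    (forall x, ('D_(basis_vector R ord_max) h x) ^+ 2 <= B) ->
    (h (y, s) - h (y, t)) ^+ 2 <= B * (s - t) ^+ 2.
  move=> dh hB.
  have dc t := @derive_comp_line R _ _ h (fun t : R => (y, t) : pt) 1 _ t (lineA t).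
  have := @lipschitz_line (h \o (fun t => (y, t))) (Num.sqrt B) _ _ s t.
  move=> /(_ (fun t => (dc t).2 (dh _ _))) W.
  have {}W : `|h (y, s) - h (y, t)| <= Num.sqrt B * `|s - t|.
    apply: W => t'; rewrite (dc t').1 -sqrtr_sqr ler_wsqrtr//.
    by have := hB (y, t'); rewrite /basis_vector unlift_none.
  rewrite -real_normK ?num_real// -[leRHS](_ : (Num.sqrt B * `|s - t|) ^+ 2 = _).
    by rewrite lerXn2r// nnegrE mulr_ge0// sqrtr_ge0.
  by rewrite exprMn sqr_sqrtr// real_normK ?num_real.
have b1 := bd (fun x => Re (f x)) _ _.
have b2 := bd (fun x => Im (f x)) _ _.
rewrite /nsq !(ReD, ImD, ReN, ImN).
rewrite (_ : 2 * B * (s - t) ^+ 2 = B * (s - t) ^+ 2 + B * (s - t) ^+ 2); last by ring.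
apply: lerD; [apply: b1|apply: b2].
- by move=> x w; apply: diff_derivable; have [] := csmooth_diff x sf.
- by move=> x; rewrite (le_trans _ (fB x))// /nsq /= lerDl sqr_ge0.
- by move=> x w; apply: diff_derivable; have [] := csmooth_diff x sf.
- by move=> x; rewrite (le_trans _ (fB x))// /nsq /= lerDr sqr_ge0.
Qed.

End sup_bounds.

(** * Real spectral parameter *)

(* [c * T], [X] and [B] are the normal, tangential minus mass, and boundary parts of the
   form at [phi] and [phi (y, c t)]; by scaling, those at [phi] and [phi (y, t / c)] are
   [cj T], [c * cj X] and [B]. *)
Lemma real_case_algebra (R : realType) (c : R) (T X B r1 r2 : R[i]) (m : R) :
  1 < c <= 2 -> 0 <= Re B ->
  r1 = c%:C * T + X + B -> r2 = cj T + c%:C * cj X + B ->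
  normc r1 <= m -> normc r2 <= m -> (c ^+ 2 - 1) * Re T <= 3 * m.
Proof.
move=> /andP[c1 c2] B0 e1 e2 n1 n2.
have h1 : Re r1 <= m by rewrite (le_trans _ n1)// (le_trans (ler_norm _))// normr_Re_le.
have h2 : - Re r2 <= m.
  by rewrite (le_trans _ n2)// (le_trans _ (normr_Re_le _))// -normrN ler_norm.
(* In the real part of [c * r1 - r2] the two occurrences of [X] cancel, since [c * X] and [c * cj X]
   have the same real part. The bound [c <= 2] then gives the factor 3. *)
have -> : (c ^+ 2 - 1) * Re T = c * Re r1 - Re r2 - (c - 1) * Re B.
  by rewrite e1 e2 !(ReD, ReM, ReJ) /=; ring.
have p1 : c * Re r1 <= c * m by rewrite ler_wpM2l//; lra.
have m0 : 0 <= m by exact: le_trans (normc_ge0 _) n1.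
have p2 : c * m <= 2 * m by rewrite ler_wpM2r.
have p3 : 0 <= (c - 1) * Re B by rewrite mulr_ge0// subr_ge0 ltW.
by lra.
Qed.

Lemma energy_arith (R : realType) (s1 s2 s3 t1 t2 t3 u1 u2 u3 : R) :
  t1 <= 2 * s1 + 2 * u1 -> t2 <= 2 * s2 + 2 * u2 -> t3 <= 2 * s3 + 2 * u3 ->
  s1 + s2 + s3 <= 1 -> t1 + t2 + t3 <= 2 + 2 * (u1 + u2 + u3).
Proof. by lra. Qed.

Lemma sqrtr_le (R : realType) (x y : R) : 0 <= y -> x <= y ^+ 2 -> Num.sqrt x <= y.
Proof. by move=> y0 h; rewrite -[leRHS]ger0_norm// -sqrtr_sqr ler_wsqrtr. Qed.

Lemma le28 (R : realType) (a x y z : R) :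
  x <= 4 * a -> y <= a -> z <= 4 * a -> 2 * x + 2 * (2 * y + 2 * z) <= 28 * a.
Proof. by lra. Qed.

Section cases.
Variables (R : realType) (d : nat).
Local Notation Rd := 'rV[R]_d.
Local Notation pt := (Rd * R)%type.
Local Notation mu := (lebesgue_rV d \x lebesgue_measure)%E.
Local Notation sigma := (lebesgue_rV d).
Local Notation Omega := (@half_space R d).
Implicit Types p q phi : pt -> R[i].

Let mO : @measurable _ (Rd * g_sigma_algebraType (R.-ocitv.-measurable))%type Omega := @measurable_half_space R d.

Variables (alpha : Rd -> R[i]) (lambda : R[i]) (u : pt -> R[i]).
Variables (Du : 'I_d.+1 -> pt -> R[i]) (tu : Rd -> R[i]) (C : R).
Hypothesis su : sqint mu Omega u.
Hypothesis sDu : forall i, sqint mu Omega (Du i).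
Hypothesis stu : sqint sigma setT tu.
Hypothesis approx : forall e, 0 < e -> exists phi, ctest phi /\ defect u Du tu phi <= e.
Hypothesis C0 : 0 <= C.
Hypothesis weak : forall p q, ctest p -> ctest q ->
  normc (dform p q - lambda * ip mu Omega p q + bform alpha p q) <=
  C * Num.sqrt (defect u Du tu p) * Num.sqrt (H1sq q + n2 sigma setT (bd q)).
Hypothesis Bpos : forall p, ctest p -> 0 <= Re (bform alpha p p).

Let energy q := H1sq q + n2 sigma setT (bd q).

Lemma dform_split p q : dform p q =
  ip mu Omega (pd ord_max p) (pd ord_max q) +
  \sum_(j < d) ip mu Omega (pd (lift ord_max j) p) (pd (lift ord_max j) q).
Proof. exact: (@bigD1_ord _ _ _ d.+1 ord_max xpredT (fun i => ip mu Omega (pd i p) (pd i q))). Qed.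

(** Bounds the energy of every [phi] of defect at most 1, so that the estimates are uniform along
    the approximation. The factors 2 come from [n2_sub_le]. *)
Let K : R := 2 + 2 * (\sum_(i < d.+1) n2 mu Omega (Du i) + n2 mu Omega u + n2 sigma setT tu).

Lemma n2_sub_le dd (T : measurableType dd) (m : {measure set T -> \bar R}) (D : set T)
    (f g : T -> R[i]) : measurable D -> sqint m D f -> sqint m D g ->
  n2 m D f <= 2 * n2 m D (fun x => f x - g x) + 2 * n2 m D g.
Proof.
move=> mD sf sg; rewrite (le_trans _ (n2D_le mD (sqintB mD sf sg) sg))//.
by rewrite le_eqVlt; apply/orP; left; apply/eqP/eq_n2 => x _; rewrite subrK.
Qed.

Lemma energy_bound phi : ctest phi -> defect u Du tu phi <= 1 -> energy phi <= K.
Proof.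
move=> tp; rewrite /defect /energy /H1sq /K => S1.
have sp : sqint mu Omega phi by exact: ctest_sqint.
have sb : sqint sigma setT (bd phi) by exact: ctest_slice_sqint.
have b1 := n2_sub_le mO sp su; have b2 := n2_sub_le measurableT sb stu.
have b3 : \sum_(i < d.+1) n2 mu Omega (pd i phi) <=
   2 * (\sum_(i < d.+1) n2 mu Omega (fun x => pd i phi x - Du i x)) +
   2 * \sum_(i < d.+1) n2 mu Omega (Du i).
  rewrite !mulr_sumr -big_split /=; apply: ler_sum => i _.
  by apply: n2_sub_le => //; apply: ctest_sqint => //; exact: ctest_derive.
exact: energy_arith b3 b1 b2 S1.
Qed.

(** Dilation multiplies the squared norms of the function and of its tangential derivatives by
    [c^-1], that of the normal derivative by [c], and fixes the trace; all these factors are at most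
    2 on this range of [c]. *)
Lemma energy_sc c phi : 2^-1 <= c <= 2 -> ctest phi -> energy (phi \o sc c) <= 2 * energy phi.
Proof.
move=> /andP[c1 c2] tp.
have c0 : 0 < c by rewrite (lt_le_trans _ c1)// invr_gt0.
have tc := ctest_sc c0 tp.
have ci : c^-1 <= 2 by rewrite -[leRHS]invrK lef_pV2// posrE ?invr_gt0.
have base q : ctest q -> n2 mu Omega (q \o sc c) = c^-1 * n2 mu Omega q.
  by move=> tq; rewrite (n2_sc c0 tq) mulrA mulVf ?gt_eqF// mul1r.
have le2 q : ctest q -> n2 mu Omega (q \o sc c) <= 2 * n2 mu Omega q.
  by move=> tq; rewrite base// ler_wpM2r// n2_ge0.
rewrite /energy /H1sq 2!mulrDr; apply: lerD; [apply: lerD|].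
- rewrite mulr_sumr; apply: ler_sum => i _.
  case: (unliftP ord_max i) => [j ->|->].
    by rewrite /pd cderive_sc_tan; apply: le2; exact: ctest_derive.
  have -> : n2 mu Omega (pd ord_max (phi \o sc c)) =
      n2 mu Omega (fun x => c%:C * (pd ord_max phi \o sc c) x).
    by apply: eq_n2 => x _; rewrite /pd cderive_sc_nor.
  have tn := ctest_derive (basis_vector R ord_max) tp.
  rewrite (n2Z mO); last by apply: ctest_sqint => //; exact: ctest_sc.
  rewrite base// nsq_real mulrA expr2 -mulrA mulrA.
  rewrite ler_wpM2r ?n2_ge0//; by rewrite -mulrA divff ?gt_eqF// mulr1.
- exact: (le2 _ tp).
- have -> : bd (phi \o sc c) = bd phi by apply/funext => y; rewrite /bd /sc /= mulr0.
  by rewrite ler_peMl ?n2_ge0// ler1n.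
Qed.

Hypothesis lam_real : Im lambda = 0.

Lemma dilation c phi : 1 < c <= 2 -> ctest phi ->
  (c ^+ 2 - 1) * Re (ip mu Omega (pd ord_max phi) (pd ord_max phi \o sc c)) <=
  3 * (C * Num.sqrt (defect u Du tu phi) * Num.sqrt (2 * energy phi)).
Proof.
move=> c12 tp; have /andP[c1 c2] := c12.
have c0 : 0 < c by exact: lt_trans c1.
have ci0 : 0 < c^-1 by rewrite invr_gt0.
have sq q : ctest q -> sqint mu Omega q by move=> tq; exact: ctest_sqint.
have tpd i : ctest (pd i phi) by exact: ctest_derive.
have spd i : sqint mu Omega (pd i phi) by exact: sq.
have half_le1 : 2^-1 <= 1 :> R by rewrite invf_le1// ler1n.
pose T := ip mu Omega (pd ord_max phi) (pd ord_max phi \o sc c).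
pose Z := \sum_(j < d) ip mu Omega (pd (lift ord_max j) phi) (pd (lift ord_max j) phi \o sc c).
pose X := Z - lambda * ip mu Omega phi (phi \o sc c).
pose B := bform alpha phi phi.
have form b : 0 < b -> dform phi (phi \o sc b) =
    b%:C * ip mu Omega (pd ord_max phi) (pd ord_max phi \o sc b) +
    \sum_(j < d) ip mu Omega (pd (lift ord_max j) phi) (pd (lift ord_max j) phi \o sc b).
  move=> b0; rewrite dform_split; apply: f_equal2.
    rewrite -(cj_real b) -(ipZr mO _ (sq _ (ctest_sc b0 (tpd ord_max))) (spd ord_max)).
    by apply: eq_ip => // x _; rewrite /pd cderive_sc_nor.
  by apply: eq_bigr => j _; rewrite /pd cderive_sc_tan.
have bb b : bform alpha phi (phi \o sc b) = B.
  by apply: eq_ip => // y _; rewrite /bd /sc /= mulr0.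
(* Realness of [lambda] makes the mass term conjugate in the same way as the tangential terms, so
   that both can be put into [X]. *)
have lamJ : cj lambda = lambda by apply: eqc => //=; rewrite lam_real oppr0.
apply: (@real_case_algebra _ c T X B _ _ _ c12 (Bpos tp) erefl erefl).
- rewrite (_ : _ + _ + _ = dform phi (phi \o sc c) -
    lambda * ip mu Omega phi (phi \o sc c) + bform alpha phi (phi \o sc c)); last first.
    by rewrite form// bb /X /Z /T; ring.
  rewrite (le_trans (weak tp (ctest_sc c0 tp)))//.
  rewrite ler_wpM2l ?mulr_ge0 ?sqrtr_ge0// ler_wsqrtr//.
  by apply: energy_sc => //; rewrite c2 andbT (le_trans half_le1 (ltW c1)).
- rewrite (_ : _ + _ + _ = dform phi (phi \o sc c^-1) -
    lambda * ip mu Omega phi (phi \o sc c^-1) + bform alpha phi (phi \o sc c^-1)); last first.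
    (* Each pairing dilated by [c^-1] is [c] times the conjugate of the one dilated by [c]. In the
       normal term this [c] cancels the [c^-1] produced by differentiation; in the other terms it
       remains. *)
    rewrite (form _ ci0) bb (ip_sc c0 (tpd ord_max) (tpd ord_max)) (ip_sc c0 tp tp).
    rewrite mulrA -rmorphM mulVf ?gt_eqF// mul1r -/T.
    under eq_bigr => j _ do rewrite (ip_sc c0 (tpd (lift ord_max j)) (tpd (lift ord_max j))).
    rewrite /X /Z -mulr_sumr -conj_sum conjD conjN conjM lamJ; ring.
  rewrite (le_trans (weak tp (ctest_sc ci0 tp)))//.
  rewrite ler_wpM2l ?mulr_ge0 ?sqrtr_ge0// ler_wsqrtr//.
  apply: energy_sc => //; rewrite lef_pV2 ?posrE//= c2 /=.
  by rewrite (@le_trans _ _ 1) ?ler1n// invf_le1// ltW.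
Qed.

Lemma Re_ip_le (f g : pt -> R[i]) : sqint mu Omega f -> sqint mu Omega g ->
  `|Re (ip mu Omega f g)| <= Num.sqrt (n2 mu Omega f) * Num.sqrt (n2 mu Omega g).
Proof.
move=> sf sg; rewrite (le_trans (normr_Re_le _))//.
by apply: normc_le_sqrt; [exact: n2_ge0|exact: CauchySchwarz].
Qed.

Lemma dilation_continuity f e : ctest f -> 0 < e ->
  exists c, 1 < c <= 2 /\ n2 mu Omega (fun x => f x - (f \o sc c) x) <= e.
Proof.
move=> tf e0; have [L L0 fL] := ctest_lipschitz tf; have [sf [M fM]] := tf.
(* With [c = 1 + h], the Lipschitz bound on a support of height [|M|] gives a squared norm of at
   most [V * h ^+ 2]; the [+ 1] below guards against [V = 0]. *)
pose V := L * `|M| ^+ 2 * fine (mu (ptbox `|M| : set pt)).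
have V0 : 0 <= V by rewrite /V !mulr_ge0// fine_ge0// measure_ge0.
pose h := Num.min 1 (Num.sqrt (e / (V + 1))).
have eV : 0 < e / (V + 1) by rewrite divr_gt0// ltr_pwDr.
have h0 : 0 < h by rewrite lt_min ltr01 sqrtr_gt0 eV.
have h1 : h <= 1 by rewrite ge_min lexx.
have hh : h ^+ 2 <= e / (V + 1).
  rewrite -[leRHS]sqr_sqrtr; last exact: ltW.
  by rewrite lerXn2r ?nnegrE ?sqrtr_ge0 ?(ltW h0)// /h ge_min lexx orbT.
exists (1 + h); split; first by rewrite ltrDl h0 /= -[leRHS]/(1 + 1) lerD2l.
have c0 : 0 < 1 + h by rewrite addr_gt0.
have td : ctest (fun x => f x - (f \o sc (1 + h)) x).
  have := ctestD tf (ctestZ (-1) (ctest_sc c0 tf)).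
  rewrite (_ : (fun x => _ + _) = (fun x => f x - (f \o sc (1 + h)) x))//.
  by apply/funext => x; rewrite mulN1r.
have LM0 : 0 <= L * `|M| ^+ 2 * h ^+ 2.
  exact: (mulr_ge0 (mulr_ge0 L0 (sqr_ge0 _)) (sqr_ge0 _)).
apply: (@le_trans _ _ ((L * `|M| ^+ 2 * h ^+ 2) * fine (mu (ptbox `|M| : set pt)))).
  have zero x : Omega x -> ~ ptbox `|M| x -> f x - (f \o sc (1 + h)) x = 0.
    rewrite /half_space /= => x0 nx.
    have fM' := supp_in_le (ler_norm M) fM.
    rewrite fM'// fM' ?subrr// => /ptboxP[/= h2 h3]; apply: nx; apply/ptboxP; split => //.
    rewrite (le_trans _ h3)// normrM (gtr0_norm c0) ler_peMl// lerDl ltW//.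
  apply: n2_sup => //; first exact: ctest_sqint.
  move=> x Ox; have [xM|nx] := pselect (ptbox `|M| x); last first.
    by rewrite zero// nsq0 LM0.
  case: x xM Ox => y t /ptboxP[/= _ tM] _; rewrite /sc /=.
  rewrite (le_trans (fL _ _ _))// -mulrA ler_wpM2l//.
  rewrite (_ : t - (1 + h) * t = - (h * t)); last by ring.
  rewrite sqrrN exprMn mulrC ler_wpM2r ?sqr_ge0//.
  by rewrite -(real_normK (num_real t)) lerXn2r// nnegrE.
have VV : V / (V + 1) <= 1 by rewrite ler_pdivrMr ?ltr_pwDr// mul1r lerDl.
rewrite mulrAC -/V (le_trans (ler_wpM2l V0 hh))// mulrCA.
by rewrite ler_piMr// ltW.
Qed.

Lemma defect_pd i phi : n2 mu Omega (fun x => pd i phi x - Du i x) <= defect u Du tu phi.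
Proof.
rewrite /defect (bigD1 i)//= -!addrA lerDl !addr_ge0 ?n2_ge0//.
by apply: sumr_ge0 => j _; exact: n2_ge0.
Qed.

Lemma defect_u phi : n2 mu Omega (fun x => phi x - u x) <= defect u Du tu phi.
Proof.
rewrite /defect addrAC lerDr addr_ge0 ?n2_ge0//.
by apply: sumr_ge0 => j _; exact: n2_ge0.
Qed.

Lemma K_gt0 : 0 < K.
Proof.
rewrite /K ltr_pwDl// mulr_ge0// !addr_ge0 ?n2_ge0//.
by apply: sumr_ge0 => j _; exact: n2_ge0.
Qed.

Lemma energy_pd i phi : n2 mu Omega (pd i phi) <= energy phi.
Proof. by rewrite (le_trans (n2_le_H1sq i phi))// lerDl n2_ge0. Qed.

(** The dilation [c] is chosen for [chi], before [phi] is known. The smallness of the dilation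
    difference passes from [chi] to [phi] because both normal derivatives are close to [Du ord_max]:
    their squared distance is at most [4 * a], and dilation by [c > 1] only decreases it. The
    constant is 28 = 2 * 4 + 2 * (2 * 1 + 2 * 4). *)
Lemma sc_difference phi chi c a : 1 < c -> ctest phi -> ctest chi ->
  defect u Du tu phi <= a -> defect u Du tu chi <= a ->
  n2 mu Omega (fun x => pd ord_max chi x - (pd ord_max chi \o sc c) x) <= a ->
  n2 mu Omega (fun x => pd ord_max phi x - (pd ord_max phi \o sc c) x) <= 28 * a.
Proof.
move=> c1 tp tx dp dx hx.
have c0 : 0 < c by exact: lt_trans c1.
set P := pd ord_max phi; set X := pd ord_max chi.
have tP : ctest P by exact: ctest_derive.
have tX : ctest X by exact: ctest_derive.
have sq q : ctest q -> sqint mu Omega q by move=> tq; exact: ctest_sqint.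
have sPc : sqint mu Omega (P \o sc c) by apply: sq; exact: ctest_sc.
have sXc : sqint mu Omega (X \o sc c) by apply: sq; exact: ctest_sc.
have sPX : sqint mu Omega (fun x => P x - X x) := sqintB mO (sq _ tP) (sq _ tX).
have PX : n2 mu Omega (fun x => P x - X x) <= 4 * a.
  rewrite (@le_trans _ _ (2 * n2 mu Omega (fun x => P x - Du ord_max x) +
     2 * n2 mu Omega (fun x => X x - Du ord_max x)))//.
    rewrite (le_trans _ (n2B_le mO (sqintB mO (sq _ tP) (sDu ord_max)) (sqintB mO (sq _ tX) (sDu ord_max))))//.
    by rewrite le_eqVlt; apply/orP; left; apply/eqP/eq_n2 => x _; ring.
  rewrite (_ : 4 * a = 2 * a + 2 * a); last by ring.
  by apply: lerD; rewrite ler_wpM2l//; apply: le_trans (defect_pd _ _) _.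
have tXP : ctest (fun x => P x - X x).
  have := ctestD tP (ctestZ (-1) tX).
  rewrite (_ : (fun x => _ + _) = (fun x => P x - X x))//.
  by apply/funext => x; rewrite mulN1r.
have XPc : n2 mu Omega (fun x => (P \o sc c) x - (X \o sc c) x) <= 4 * a.
  apply: (le_trans _ PX).
  have -> : n2 mu Omega (fun x => P x - X x) =
      c * n2 mu Omega (fun x => (P \o sc c) x - (X \o sc c) x) := n2_sc c0 tXP.
  rewrite ler_peMl ?n2_ge0//; exact: ltW.
rewrite (@le_trans _ _ (2 * n2 mu Omega (fun x => P x - X x) +
   2 * (2 * n2 mu Omega (fun x => X x - (X \o sc c) x) +
        2 * n2 mu Omega (fun x => (P \o sc c) x - (X \o sc c) x))))//.
  have s1 : sqint mu Omega (fun x => X x - (X \o sc c) x).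
    by apply: sqintB => //; exact: sq.
  have s2 : sqint mu Omega (fun x => (P \o sc c) x - (X \o sc c) x) by exact: sqintB.
  have L1 := n2D_le mO sPX (sqintB mO s1 s2).
  have L2 := n2B_le mO s1 s2.
  rewrite (le_trans _ (le_trans L1 _))//; last by rewrite lerD2l ler_wpM2l.
  by rewrite le_eqVlt; apply/orP; left; apply/eqP/eq_n2 => x _; ring.
exact: le28 PX hx XPc.
Qed.

Lemma normal_small e : 0 < e -> exists phi,
  [/\ ctest phi, defect u Du tu phi <= e & n2 mu Omega (pd ord_max phi) <= e].
Proof.
move=> e0; have K0 := K_gt0.
have [a [a0 a1 ae ak]] : exists a, [/\ 0 < a, a <= 1, a <= e / 2 &
    Num.sqrt K * Num.sqrt (28 * a) <= e / 2].
  exists (Num.min 1 (Num.min (e / 2) ((e / 2) ^+ 2 / (28 * K)))); split.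
  - by rewrite !lt_min ltr01 !divr_gt0// ?exprn_gt0 ?mulr_gt0// divr_gt0.
  - by rewrite ge_min lexx.
  - by rewrite !ge_min lexx !orbT.
  - rewrite -sqrtrM; last exact: ltW.
    apply: sqrtr_le; first by rewrite divr_ge0// ltW.
    set m := Num.min _ _; have : m <= (e / 2) ^+ 2 / (28 * K) by rewrite /m !ge_min lexx !orbT.
    by rewrite ler_pdivlMr ?mulr_gt0// => h; rewrite (le_trans _ h)// mulrCA mulrA mulrC.
(* The order of choices matters: [dilation] is divided by [c ^+ 2 - 1], so [c] has to be fixed
   through an auxiliary [chi] before the final [phi] is chosen with a defect small relative to
   [c]. *)
have [chi [tx dx]] := approx a0.
have [c [c12 hx]] := dilation_continuity (ctest_derive (basis_vector R ord_max) tx) a0.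
have /andP[c1 c2] := c12.
have cc : 0 < c ^+ 2 - 1 by rewrite subr_gt0 expr_gt1// ltW// (lt_trans ltr01).
pose Q := 3 * C * Num.sqrt (2 * K) + 1.
have Q0 : 0 < Q by rewrite /Q ltr_pwDr// !mulr_ge0// sqrtr_ge0.
(* The second entry makes the right-hand side of [dilation] at most [(c ^+ 2 - 1) * a]. *)
pose b := Num.min a (((c ^+ 2 - 1) * a / Q) ^+ 2).
have b0 : 0 < b by rewrite lt_min a0 exprn_gt0// divr_gt0// mulr_gt0.
have [phi [tp dp]] := approx b0; exists phi.
have dpa : defect u Du tu phi <= a by rewrite (le_trans dp)// /b ge_min lexx.
have a_e : a <= e by rewrite (le_trans ae)// ler_pdivrMr// ler_peMr ?ler1n ?ltW.
split => //; first exact: le_trans a_e.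
have EK : energy phi <= K by apply: energy_bound => //; exact: le_trans a1.
have sq q : ctest q -> sqint mu Omega q by move=> tq; exact: ctest_sqint.
have tP : ctest (pd ord_max phi) by exact: ctest_derive.
have c0 : 0 < c by exact: lt_trans c1.
have T1 : Re (ip mu Omega (pd ord_max phi) (pd ord_max phi \o sc c)) <= a.
  rewrite -(ler_pM2l cc) (le_trans (dilation c12 tp))//.
  have sb : Num.sqrt (defect u Du tu phi) <= (c ^+ 2 - 1) * a / Q.
    apply: sqrtr_le; first by rewrite divr_ge0// ?mulr_ge0//; exact: ltW.
    by rewrite (le_trans dp)// /b ge_min lexx orbT.
  rewrite (@le_trans _ _ (3 * (C * ((c ^+ 2 - 1) * a / Q) * Num.sqrt (2 * K))))//.
    rewrite ler_wpM2l// ler_pM ?mulr_ge0 ?sqrtr_ge0//; first by rewrite ler_wpM2l.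
    by rewrite ler_wsqrtr// ler_wpM2l.
  rewrite (_ : 3 * _ = (c ^+ 2 - 1) * a * ((3 * C * Num.sqrt (2 * K)) / Q)); last by ring.
  rewrite ler_piMr//; first by rewrite mulr_ge0//; exact: ltW.
  by rewrite ler_pdivrMr// mul1r /Q lerDl.
have T2 := sc_difference c1 tp tx dpa dx hx.
have sPc : sqint mu Omega (pd ord_max phi \o sc c) by apply: sq; exact: ctest_sc.
(* With [P] the normal derivative and [P_c] its dilation, [<P, P> = <P, P - P_c> + <P, P_c>]: the
   first term is small by continuity of dilations, the second by [dilation]. *)
have : (n2 mu Omega (pd ord_max phi))%:C = ip mu Omega (pd ord_max phi)
    (fun x => pd ord_max phi x - (pd ord_max phi \o sc c) x) +
    ip mu Omega (pd ord_max phi) (pd ord_max phi \o sc c).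
  by rewrite (ipBr mO (sq _ tP) sPc (sq _ tP)) ip_n2 subrK.
move=> /(congr1 (@complex.Re R)); rewrite ReD [Re (n2 _ _ _)%:C]/= => ->.
rewrite [leRHS]splitr lerD//; last exact: le_trans ae.
apply: (le_trans (ler_norm _)); apply: (le_trans (Re_ip_le _ _)).
- exact: sq.
- exact: (sqintB mO (sq _ tP) sPc).
apply: le_trans ak; apply: ler_pM; rewrite ?sqrtr_ge0// ler_wsqrtr//.
exact: le_trans (energy_pd _ _) EK.
Qed.

End cases.

Section cexp_theory.
Variable R : realType.
Implicit Types (z w : R[i]) (t : R).

Lemma nsq_cexp z t : nsq (cexp z t) = expR (2 * (Re z * t)).
Proof.
rewrite /nsq /cexp /= !exprMn -mulrDr cos2Dsin2 mulr1 -expRM_natl.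
by congr expR; rewrite mulr_natl.
Qed.

Lemma cexp0 z : cexp z 0 = 1.
Proof. by apply: eqc; rewrite /cexp /= !mulr0 ?expR0 ?cos0 ?sin0 ?mulr0 ?mulr1. Qed.

Lemma cexpJ z t : cj (cexp z t) = cexp (cj z) t.
Proof. by rewrite /cj /cexp /= mulNr cosN sinN mulrN. Qed.

Lemma cexpD z w t : cexp (z + w) t = cexp z t * cexp w t.
Proof.
rewrite /cexp ReD ImD !mulrDl expRD cosD sinD; apply: eqc; rewrite ?ReM ?ImM /=; ring.
Qed.

Lemma cexp_half t : cexp (- 1) t = (nsq (cexp (- 2^-1)%:C t))%:C.
Proof.
have e : - 1 = (- 2^-1)%:C + (- 2^-1)%:C :> R[i].
  by apply: eqc; rewrite ?ReD ?ImD ?ReN ?ImN /=; lra.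
by rewrite {1}e cexpD -mulcJ_nsq cexpJ cj_real.
Qed.

End cexp_theory.

Lemma real_eqRe (R : realType) (a : R) (x y : R[i]) :
  a%:C + x = - y -> a = - Re y - Re x.
Proof. by move/(congr1 (@complex.Re R)); rewrite ReD ReN /= => <-; rewrite addrK. Qed.

(** * A small normal derivative forces a small function *)

Section weight.
Variables (R : realType) (d : nat).
Local Notation Rd := 'rV[R]_d.
Local Notation pt := (Rd * R)%type.
Local Notation mu := (lebesgue_rV d \x lebesgue_measure)%E.
Local Notation sigma := (lebesgue_rV d).
Local Notation Omega := (@half_space R d).
Implicit Types p q phi : pt -> R[i].

Let mO : @measurable _ (Rd * g_sigma_algebraType (R.-ocitv.-measurable))%type Omega := @measurable_half_space R d.

(** The weights are [hw = e^{- t / 2}] and [m = 1 - e^{- t}]. They are linked by [d_t m = hw ^+ 2];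
    moreover [m] vanishes on the boundary and both are at most 1 in the half-space. *)
Let hw (x : pt) : R[i] := cexp (- 2^-1)%:C x.2.
Let m (x : pt) : R[i] := 1 - cexp (- 1) x.2.

Lemma nsq_hw_le x : Omega x -> nsq (hw x) <= 1.
Proof.
move=> x0; rewrite /hw nsq_cexp -expR0 ler_expR /= mulNr mulrN oppr_le0.
by rewrite !mulr_ge0// ltW.
Qed.

Lemma nsq_m_le x : Omega x -> nsq (m x) <= 1.
Proof.
move=> x0; have h1 := nsq_hw_le x0; rewrite /m cexp_half -/(hw x).
have h0 := nsq_ge0 (hw x); rewrite -[1 : R[i]]/(1%:C) -rmorphB nsq_real; nra.
Qed.

Lemma sqintM_le1 (a f : pt -> R[i]) : cmeasurable Omega a ->
  (forall x, Omega x -> nsq (a x) <= 1) -> sqint mu Omega f ->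
  sqint mu Omega (fun x => a x * f x) /\ n2 mu Omega (fun x => a x * f x) <= n2 mu Omega f.
Proof.
move=> ma a1 sf.
have le x : Omega x -> nsq (a x * f x) <= nsq (f x).
  by move=> Ox; rewrite nsqM ler_piMl ?nsq_ge0// a1.
have s : sqint mu Omega (fun x => a x * f x).
  by apply: (le_integrable_nsq mO (cmeasurableM ma sf.1) sf.2).
by split => //; exact: n2_le.
Qed.

Lemma cmeasurable_smooth (f : pt -> R[i]) : csmooth f -> cmeasurable Omega f.
Proof.
move=> sf; have [m1 m2] := ccontinuous_measurable_pt (csmooth_continuousRe sf) (csmooth_continuousIm sf).
by split; apply: (measurable_funS measurableT).
Qed.

Let mm : csmooth m.
Proof.
rewrite /m; have := csmoothD (csmooth_cst 1) (csmoothM (csmooth_cst (-1)) (@csmooth_cexp R d (-1))).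
by rewrite (_ : (fun x => _ + _) = m)//; apply/funext => x; rewrite mulN1r.
Qed.

(** Integrating [d_t m * |phi|^2] by parts leaves no boundary term since [m] vanishes at [t = 0],
    and each of the two remaining terms is a Cauchy-Schwarz product. The weight is essential: a
    slowly varying function on a half-line has small derivative and large L^2 norm. *)
Lemma weighted_bound phi : ctest phi ->
  n2 mu Omega (fun x => hw x * phi x) <=
  2 * (Num.sqrt (n2 mu Omega (pd ord_max phi)) * Num.sqrt (n2 mu Omega phi)).
Proof.
move=> tp; set P := pd ord_max phi.
have tP : ctest P by exact: ctest_derive.
have sq q : ctest q -> sqint mu Omega q by move=> tq; exact: ctest_sqint.
have cm : cmeasurable Omega m by exact: cmeasurable_smooth.
have [smp mp] := sqintM_le1 cm nsq_m_le (sq _ tp).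
have [smP mP] := sqintM_le1 cm nsq_m_le (sq _ tP).
have tf : ctest (fun x => m x * phi x) by exact: ctestM.
have se : sqint mu Omega (fun x => cexp (-1) x.2 * phi x).
  by apply: sq; apply: ctestM => //; exact: csmooth_cexp.
have f0 (y : Rd) : m (y, 0) * phi (y, 0) = 0 by rewrite /m cexp0 subrr mul0r.
have := @ip_byparts R d _ _ ord_max tf tp f0.
have -> : ip mu Omega (cderive (basis_vector R ord_max) (fun x => m x * phi x)) phi =
   ip mu Omega (fun x => cexp (-1) x.2 * phi x) phi + ip mu Omega (fun x => m x * P x) phi.
  rewrite -(ipDl mO se smP (sq _ tp)); apply: eq_ip => // x _.
  rewrite cderiveM; [|exact: csmooth_diff|by apply: csmooth_diff; exact: tp.1].
  congr (_ * _ + _); rewrite /m.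
  have [d1 e1] := @cexp_snd R d (-1) (basis_vector R ord_max) x.
  have -> : (fun x : pt => 1 - cexp (-1) x.2 : R[i]) = (fun x => 1 + (-1) * cexp (-1) x.2).
    by apply/funext => z; rewrite mulN1r.
  have dm := cdifferentiableM (cdifferentiable_cst (-1) x) d1.
  rewrite (cderiveD _ (cdifferentiable_cst 1 x) dm) cderive_cst add0r.
  rewrite (cderiveM _ (cdifferentiable_cst (-1) x) d1) cderive_cst mul0r add0r e1.
  by rewrite /basis_vector unlift_none /= mul1r mulrA mulrNN !mul1r.
have -> : ip mu Omega (fun x => cexp (-1) x.2 * phi x) phi =
    (n2 mu Omega (fun x => hw x * phi x))%:C.
  rewrite -ip_n2; apply: eq_cintegral => x _.
  by rewrite mulcJ_nsq nsqM cexp_half -mulrA mulcJ_nsq -rmorphM.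
move/real_eqRe => ->.
have b1 : - Re (ip mu Omega (fun x => m x * phi x) P) <= Num.sqrt (n2 mu Omega P) * Num.sqrt (n2 mu Omega phi).
  rewrite -ReN; apply: le_trans (ler_norm _) _; rewrite ReN normrN.
  apply: le_trans (Re_ip_le smp (sq _ tP)) _.
  by rewrite mulrC ler_wpM2l ?sqrtr_ge0// ler_wsqrtr.
have b2 : - Re (ip mu Omega (fun x => m x * P x) phi) <= Num.sqrt (n2 mu Omega P) * Num.sqrt (n2 mu Omega phi).
  rewrite -ReN; apply: le_trans (ler_norm _) _; rewrite ReN normrN.
  apply: le_trans (Re_ip_le smP (sq _ tp)) _.
  by rewrite ler_wpM2r ?sqrtr_ge0// ler_wsqrtr.
by rewrite mulr2n mulrDl !mul1r; exact: lerD.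
Qed.

Lemma normal_small_zero (u : pt -> R[i]) : sqint mu Omega u ->
  (forall e, 0 < e -> exists phi, [/\ ctest phi,
     n2 mu Omega (fun x => phi x - u x) <= e & n2 mu Omega (pd ord_max phi) <= e]) ->
  {ae mu, forall x, Omega x -> u x = 0}.
Proof.
move=> su approx.
have ch : cmeasurable Omega hw by apply: cmeasurable_smooth; exact: csmooth_cexp.
have [shu _] := sqintM_le1 ch nsq_hw_le su.
suff n0 : n2 mu Omega (fun x => hw x * u x) = 0.
  have := n2_eq0 mO shu n0; apply: filterS => x h Ox; have /eqP := h Ox.
  rewrite mulf_eq0 => /orP[|/eqP//]; rewrite -nsq_eq0 nsq_cexp.
  by rewrite gt_eqF// expR_gt0.
apply/eqP; rewrite eq_le n2_ge0 andbT; apply/ler_addgt0Pl => e e0; rewrite addr0.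
pose K := 2 + 2 * n2 mu Omega u.
have K0 : 0 < K by rewrite /K ltr_pwDl// mulr_ge0// n2_ge0.
(* The two smallness conditions split [e] evenly: [2 * (2 * (e / 8))] for the weighted norm of [phi]
   and [2 * (e / 4)] for the distance to [u]. *)
pose a := Num.min 1 (Num.min (e / 4) ((e / 8) ^+ 2 / K)).
have a0 : 0 < a by rewrite !lt_min ltr01 !divr_gt0// exprn_gt0// divr_gt0.
have a1 : a <= 1 by rewrite /a ge_min lexx.
have a2 : a <= e / 4 by rewrite /a !ge_min lexx orbT.
have a3 : a * K <= (e / 8) ^+ 2 by rewrite -ler_pdivlMr// /a !ge_min lexx !orbT.
have [phi [tp dp np]] := approx a a0.
have sp : sqint mu Omega phi by exact: ctest_sqint.
have spu : sqint mu Omega (fun x => phi x - u x) by exact: sqintB.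
have [_ h1] := sqintM_le1 ch nsq_hw_le spu.
have h2 : n2 mu Omega phi <= K.
  rewrite (le_trans (n2_sub_le mO sp su))// lerD2r.
  by rewrite -[leRHS]mulr1 ler_wpM2l// (le_trans dp).
have [shp _] := sqintM_le1 ch nsq_hw_le sp.
have h3 : n2 mu Omega (fun x => hw x * phi x) <= 2 * (e / 8).
  rewrite (le_trans (weighted_bound tp))// ler_wpM2l//.
  rewrite -sqrtrM ?n2_ge0//; apply: sqrtr_le; first by rewrite divr_ge0// ltW.
  by rewrite (le_trans _ a3)// ler_pM// ?n2_ge0.
have [shpu _] := sqintM_le1 ch nsq_hw_le spu.
rewrite (@le_trans _ _ (2 * n2 mu Omega (fun x => hw x * phi x) +
  2 * n2 mu Omega (fun x => hw x * (phi x - u x))))//.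
  rewrite (le_trans _ (n2B_le mO shp shpu))// le_eqVlt; apply/orP; left; apply/eqP.
  by apply: eq_n2 => x _; ring.
rewrite (_ : e = 2 * (2 * (e / 8)) + 2 * (e / 4)); last by field.
apply: lerD; rewrite ler_wpM2l//.
exact: le_trans (le_trans h1 dp) a2.
Qed.

End weight.

(** * Linear algebra *)

Section simultaneous_diagonalization.
Variables (R : realType) (N : nat).
Implicit Types (A B M K U V : 'M[R[i]]_N) (s : 'I_N -> R).

Definition adj m n (A : 'M[R[i]]_(m, n)) : 'M[R[i]]_(n, m) := map_mx (@cj R) A^T.

Definition diagR s : 'M[R[i]]_N := diag_mx (\row_j (s j)%:C).

Lemma cjE (z : R[i]) : cj z = z^*%R.
Proof. by case: z. Qed.

Lemma adjE m n (A : 'M[R[i]]_(m, n)) : adj A = map_mx Num.conj A^T.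
Proof. by apply/matrixP => i j; rewrite !mxE cjE. Qed.

Lemma adjK m n (A : 'M[R[i]]_(m, n)) : adj (adj A) = A.
Proof. by apply/matrixP => i j; rewrite !mxE conjK. Qed.

Lemma adjM m n p (A : 'M[R[i]]_(m, n)) (B : 'M[R[i]]_(n, p)) :
  adj (A *m B) = adj B *m adj A.
Proof. by rewrite !adjE trmx_mul map_mxM. Qed.

Lemma adj_diagR s : adj (diagR s) = diagR s.
Proof.
apply/matrixP => i j; rewrite !mxE; case: eqVneq => [->|ij].
  by rewrite mulr1n cj_real.
by rewrite mulr0n; exact: (cj_real 0).
Qed.

Lemma diagRM s t : diagR s *m diagR t = diagR (fun j => s j * t j).
Proof.
apply/matrixP => i j; rewrite mul_diag_mx !mxE rmorphM.
by case: eqP => _; rewrite ?mulr1n ?mulr0n ?mulr0.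
Qed.

Lemma diagR_form s (w : 'rV[R[i]]_N) :
  (w *m diagR s *m adj w) 0 0 = (\sum_j s j * nsq (w 0 j))%:C.
Proof.
rewrite mxE rmorph_sum /=; apply: eq_bigr => j _.
by rewrite mul_mx_diag !mxE rmorphM /= -mulcJ_nsq mulrAC mulrA (mulrC (_ * cj _)) mulrA mulrC mulrA.
Qed.

Lemma hermitian_diag A : adj A = A -> (forall v : 'rV_N, 0 <= Re ((v *m A *m adj v) 0 0)) ->
  exists U s, [/\ U *m adj U = 1%:M, adj U *m U = 1%:M, (forall j, 0 <= s j) &
    A = adj U *m diagR s *m U].
Proof.
move=> hA pA.
have Ah : A \is hermsymmx.
  by apply/is_hermitianmxP; rewrite expr0 scale1r -adjE.
have /hermitian_normalmx /orthomx_spectralP eA := Ah.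
set U := spectralmx A in eA.
have uU : U \is unitarymx by exact: spectral_unitarymx.
have UU : U *m adj U = 1%:M by rewrite adjE; apply/unitarymxP.
have UU' : adj U *m U = 1%:M by apply: mulmx1C.
have rs := hermitian_spectral_diag_real Ah.
have sE : diag_mx (spectral_diag A) = diagR (fun j => Re (spectral_diag A 0 j)).
  congr diag_mx; apply/rowP => j; rewrite mxE.
  have /mxOverP /(_ 0 j) := rs; case: (spectral_diag A 0 j) => a b; rewrite complex_real /= => /eqP ->.
  by [].
exists U, (fun j => Re (spectral_diag A 0 j)).
have eA' : A = adj U *m diagR (fun j => Re (spectral_diag A 0 j)) *m U.
  have e := invmx_unitary uU; rewrite -adjE in e.
  by rewrite -sE -e; exact: eA.
split => // j.
(* The eigenvalue [s j] is the value of the form at the [j]-th row of [U], hence nonnegative. *)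
have := pA (delta_mx 0 j *m U).
set e : 'rV[R[i]]_N := delta_mx 0 j; set S := diagR _ in eA' *.
have -> : e *m U *m A *m adj (e *m U) = e *m S *m adj e.
  rewrite eA' adjM !mulmxA -(mulmxA e U (adj U)) UU mulmx1.
  by rewrite -(mulmxA (e *m S) U (adj U)) UU mulmx1.
rewrite diagR_form /= (bigD1 j)//= big1 ?addr0; last first.
  by move=> k kj; rewrite mxE (negbTE kj) andbF nsq0 mulr0.
by rewrite mxE !eqxx -[1%:R : R[i]]/(1%:C) nsq_real expr1n mulr1.
Qed.

(** For invertible [M] one diagonalizes [M^{-1/2} K M^{-1/2}] by a unitary [V] and takes
    [Q = V M^{-1/2}]. Gram matrices may be singular, so [M^{-1/2}] is a pseudo-inverse; the kernel
    condition says that [K] lives on the range of [M], so nothing of [K] is lost. [Q]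
    orthonormalizes [M] only up to a projection, whence an inequality in the last clause. *)
Lemma simultaneous_diag M K :
  adj M = M -> (forall v : 'rV_N, 0 <= Re ((v *m M *m adj v) 0 0)) ->
  adj K = K -> (forall v : 'rV_N, 0 <= Re ((v *m K *m adj v) 0 0)) ->
  (forall v : 'rV_N, v *m M = 0 -> v *m K = 0) ->
  exists P Q D, [/\ forall j, 0 <= D j, M *m adj Q = P, K *m adj Q = P *m diagR D,
    Q *m K *m adj Q = diagR D & (1%:M - P *m Q) *m M = 0 /\
    forall v : 'rV_N, Re ((v *m (Q *m M *m adj Q) *m adj v) 0 0) <= \sum_j nsq (v 0 j)].
Proof.
move=> hM pM hK pK ker.
have [U [m [U1 U2 m0 eM]]] := hermitian_diag hM pM.
(* Since the inverse of 0 is 0, [iq] is the pseudo-inverse of the square root, and [E] below is the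
   projection onto the range of [M] in the eigenbasis. *)
pose sq j := Num.sqrt (m j); pose iq j := (sq j)^-1.
pose E := diagR (fun j => sq j * iq j).
have m_iq : diagR m *m diagR iq = diagR sq.
  rewrite diagRM; congr diagR; apply/funext => j; rewrite /iq /sq.
  have [->|n0] := eqVneq (m j) 0; first by rewrite sqrtr0 mul0r.
  by rewrite -{1}(sqr_sqrtr (m0 j)) expr2 mulfK// gt_eqF// sqrtr_gt0 lt_neqAle eq_sym n0 m0.
have Em : E *m diagR m = diagR m.
  rewrite diagRM; congr diagR; apply/funext => j; rewrite /iq /sq.
  have [->|n0] := eqVneq (m j) 0; first by rewrite mulr0.
  by rewrite divff ?mul1r// gt_eqF// sqrtr_gt0 lt_neqAle eq_sym n0 m0.
(* The rows of [E *m U - U] are annihilated by [M], hence by [K]. *)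
have EUK : E *m U *m K = U *m K.
  apply/eqP; rewrite -subr_eq0 -mulmxBl; apply/eqP/row_matrixP => i.
  rewrite row_mul row0; apply: ker; rewrite -row_mul eM.
  rewrite mulmxBl !mulmxA.
  by rewrite -(mulmxA E) U1 mulmx1 Em mul1mx subrr row0.
have KUE : K *m adj U *m E = K *m adj U.
  by apply: (can_inj (@adjK _ _)); rewrite !adjM !adjK adj_diagR hK mulmxA.
pose K' := diagR iq *m U *m K *m adj U *m diagR iq.
have hK' : adj K' = K' by rewrite /K' !adjM !adjK adj_diagR hK !mulmxA.
have pK' (v : 'rV_N) : 0 <= Re ((v *m K' *m adj v) 0 0).
  have := pK (v *m diagR iq *m U); rewrite !adjM adj_diagR /K' !mulmxA.
  exact.
have [V [D [V1 V2 D0 eK']]] := hermitian_diag hK' pK'.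
pose Q := V *m diagR iq *m U; pose P := adj U *m diagR sq *m adj V.
have aQ : adj Q = adj U *m diagR iq *m adj V by rewrite /Q !adjM adj_diagR mulmxA.
have MQ : M *m adj Q = P.
  rewrite aQ eM !mulmxA -(mulmxA _ U) U1 mulmx1 -(mulmxA _ (diagR m)) m_iq.
  by rewrite /P.
have PQ : P *m Q = adj U *m E *m U.
  rewrite /P /Q !mulmxA -(mulmxA _ (adj V)) V2 mulmx1 -(mulmxA _ (diagR sq)) diagRM.
  by [].
exists P, Q, D; split => //.
- have -> : P *m diagR D = adj U *m diagR sq *m (K' *m adj V).
    by rewrite eK' -!mulmxA V1 mulmx1 /P !mulmxA.
  rewrite /K' !mulmxA -(mulmxA _ (diagR sq)) diagRM -/E aQ !mulmxA.
  do 3!congr (_ *m _).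
  by rewrite -(mulmxA _ E) -(mulmxA _ (E *m U)) EUK mulmxA U2 mul1mx.
- rewrite aQ /Q.
  have -> : V *m diagR iq *m U *m K *m (adj U *m diagR iq *m adj V) = V *m K' *m adj V.
    by rewrite /K' !mulmxA.
  by rewrite eK' !mulmxA V1 mul1mx -mulmxA V1 mulmx1.
split.
  rewrite mulmxBl mul1mx PQ eM !mulmxA -(mulmxA _ U) U1 mulmx1 -(mulmxA _ E) Em.
  by rewrite subrr.
move=> v.
have -> : v *m (Q *m M *m adj Q) *m adj v = (v *m V) *m E *m adj (v *m V).
  rewrite -(mulmxA Q) MQ /Q /P adjM !mulmxA.
  by rewrite -(mulmxA _ U (adj U)) U1 mulmx1 -(mulmxA _ (diagR iq)) diagRM /E;
     under eq_fun do rewrite mulrC.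
have -> : \sum_j nsq (v 0 j) = Re ((v *m adj v) 0 0).
  have := diagR_form (fun=> 1) v.
  have -> : diagR (fun=> 1) = 1%:M.
    by apply/matrixP => i j; rewrite !mxE.
  by rewrite mulmx1 => ->; apply: eq_bigr => j _; rewrite mul1r.
have -> : v *m adj v = (v *m V) *m diagR (fun=> 1) *m adj (v *m V).
  have -> : diagR (fun=> 1) = 1%:M.
    by apply/matrixP => i j; rewrite !mxE.
  by rewrite mulmx1 adjM !mulmxA -(mulmxA v) V1 mulmx1.
(* The diagonal entries of [E] are 0 or 1. *)
rewrite !diagR_form /=; apply: ler_sum => j _; rewrite ler_wpM2r ?nsq_ge0// /iq.
by have [->|n0] := eqVneq (sq j) 0; rewrite ?mul0r ?divff.
Qed.

End simultaneous_diagonalization.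

(** * Piecewise linear interpolation in the normal variable *)

Section ramps.
Variable R : realType.
Local Notation leb := (@lebesgue_measure R).
Local Notation E := (`]0%R, +oo[%classic : set R).
Implicit Types (s t : R) (z k : R[i]).

Let mE : (R.-ocitv.-measurable).-sigma.-measurable E.
Proof. exact: measurable_itv. Qed.

Definition ind s t : R[i] := ((t <= s)%R%:R : R)%:C.

Definition ramp s t : R[i] := (Num.max 0 (s - t))%:C.

Lemma cmeasurable_real (D : set R) (f : R -> R) : measurable D ->
  measurable_fun setT f -> cmeasurable D (fun t => (f t)%:C).
Proof.
move=> mD mf; split; last exact: measurable_cst.
exact: measurable_funS mf.
Qed.

Lemma integrable_itv_cst s c : leb.-integrable E (EFin \o (fun t => c * \1_(`[0, s]%classic) t)).
Proof.
apply: (@integrableS _ _ _ _ setT) => //.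
rewrite /comp; under eq_fun do rewrite EFinM.
apply: integrableZl => //; apply/integrableP; split.
  by apply/measurable_EFinP; apply: measurable_indic; exact: measurable_itv.
under eq_integral do rewrite gee0_abs ?lee_fin//.
rewrite integral_indic ?setIT//=.
by rewrite lebesgue_measure_itv; case: ifP => _; rewrite /= ?ltry// -EFinD ltry.
Qed.

Lemma sqint_ind s : sqint leb E (ind s).
Proof.
apply: (le_integrable_nsq mE _ (integrable_itv_cst s 1)).
  apply: cmeasurable_real => //.
  rewrite (_ : (fun t => _) = \1_(`]-oo, s]%classic)).
    by apply: measurable_indic; exact: measurable_itv.
  by apply/funext => t; rewrite indicE mem_setE in_itv.
move=> t; rewrite /= in_itv /= andbT => t0; rewrite /ind nsq_real indicE mem_setE in_itv /= (ltW t0) /=.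
by case: (t <= s); rewrite /= ?expr1n ?expr0n /= ?mulr1 ?mulr0.
Qed.

Lemma sqint_ramp s : sqint leb E (ramp s).
Proof.
apply: (le_integrable_nsq mE _ (integrable_itv_cst s (s ^+ 2))).
  apply: cmeasurable_real => //; apply: measurable_maxr => //.
  by apply: measurable_funB => //.
move=> t; rewrite /= in_itv /= andbT => t0; rewrite /ramp nsq_real indicE mem_setE in_itv /= (ltW t0) /=.
case: (leP t s) => st; rewrite ?mulr1 ?mulr0.
  have s0 := le_trans (ltW t0) st; have st0 : 0 <= s - t by rewrite subr_ge0.
  by rewrite (max_idPr st0) lerXn2r// gerBl ltW.
have st0 : s - t <= 0 by rewrite subr_le0 ltW.
by rewrite (max_idPl st0) expr0n.
Qed.

Lemma sqint_cexp z : Re z < 0 -> sqint leb E (cexp z) /\ n2 leb E (cexp z) <= (2 * - Re z)^-1.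
Proof.
move=> z0; set r := 2 * - Re z; have r0 : 0 < r by rewrite mulr_gt0// oppr_gt0.
(* The squared modulus is [r^-1] times the density of the exponential law of rate [r]; its total
   mass 1 provides both integrability and the bound. *)
have eq t : E t -> nsq (cexp z t) = r^-1 * exponential_pdf r t.
  rewrite /= in_itv /= andbT => t0; rewrite exponential_pdfE ?ltW// mulKf ?gt_eqF//.
  by rewrite nsq_cexp /r; congr expR; ring.
have ip0 := integrable_exponential_pdf r0.
have ipE : leb.-integrable E (EFin \o (fun t => r^-1 * exponential_pdf r t)).
  apply: (@integrableS _ _ _ _ setT) => //.
  by rewrite /comp; under eq_fun do rewrite EFinM; exact: integrableZl.
have s : sqint leb E (cexp z).
  apply: (le_integrable_nsq mE _ ipE) => [|t /eq ->//].
  have c1 : continuous (fun t => Re (cexp z t)).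
    by move=> t; apply/differentiable_continuous/derivable1_diffP; have [] := is_derive_cexpRe z t.
  have c2 : continuous (fun t => Im (cexp z t)).
    by move=> t; apply/differentiable_continuous/derivable1_diffP; have [] := is_derive_cexpIm z t.
  by split; apply: measurable_funTS; exact: continuous_measurable_fun.
split=> //; rewrite -lee_fin -sqint_n2E//.
under eq_integral => t /[!inE] /eq -> do [].
under eq_integral do rewrite EFinM.
rewrite integralZl//; last exact: integrableS ip0.
rewrite -[leRHS]mule1 lee_pmul2l ?lte_fin ?invr_gt0//.
rewrite -(integral_exponential_pdf r0); apply: ge0_subset_integral => //.
- by apply/measurable_EFinP; exact: measurable_exponential_pdf.
- by move=> t _; rewrite lee_fin exponential_pdf_ge0// ltW.
Qed.

(** The free factor [A] makes a single real formula sufficient: [A = k] gives the real part of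
    [ramp_identity] and [A = - 'i * k] its imaginary part. *)
Lemma ramp_antiderivative (A k : R[i]) s t :
  is_derive t 1 (fun t => - ((s - t) * Re (A * cexp (- k) t)))
    (Re (A * cexp (- k) t + A * k * (s - t)%:C * cexp (- k) t)).
Proof.
have h1 := is_derive_cexpRe (- k) t; have h2 := is_derive_cexpIm (- k) t.
under eq_fun do rewrite ReM.
apply: is_derive_eq; rewrite /GRing.scale /= ReD !ReM !ImM /= {h1 h2}.
by case: A k => a a' [b b'] /=; ring.
Qed.

Lemma ramp_Re (A k : R[i]) s : 0 <= s ->
  \int[leb]_(t in E) Re (A * (ind s t * cexp (- k) t) + A * k * (ramp s t * cexp (- k) t)) = s * Re A.
Proof.
rewrite le_eqVlt => /orP[/eqP <-|s0].
  rewrite mul0r /Rintegral integral0_eq// => t; rewrite /= in_itv /= andbT => t0.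
  rewrite /ind /ramp leNgt t0 /= sub0r.
  have t1 : - t <= 0 by rewrite oppr_le0 ltW.
  by rewrite (max_idPl t1) !mul0r !mulr0 addr0.
pose G t := - ((s - t) * Re (A * cexp (- k) t)).
have dG t : 'D_1 G t = Re (A * cexp (- k) t + A * k * (s - t)%:C * cexp (- k) t).
  by rewrite (@derive_val _ _ _ _ _ _ _ (ramp_antiderivative A k s t)).
have cw : continuous (fun t => Re (cexp (- k) t)) /\ continuous (fun t => Im (cexp (- k) t)).
  split=> t; apply/differentiable_continuous/derivable1_diffP.
    by have [] := is_derive_cexpRe (- k) t.
  by have [] := is_derive_cexpIm (- k) t.
have cG : continuous (fun t => 'D_1 G t).
  have -> : (fun t => 'D_1 G t) = fun t =>
     (Re A * Re (cexp (- k) t) - Im A * Im (cexp (- k) t)) +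
     (s - t) * (Re (A * k) * Re (cexp (- k) t) - Im (A * k) * Im (cexp (- k) t)).
    by apply/funext => t; rewrite dG !(ReM, ReD, ImM) /=; ring.
  move=> t; have c1 := cw.1 t; have c2 := cw.2 t.
  apply: cvgD.
    by apply: cvgB; (apply: cvgM; first exact: cvg_cst).
  apply: cvgM; first by apply: cvgB; [exact: cvg_cst|exact: cvg_id].
  by apply: cvgB; (apply: cvgM; first exact: cvg_cst).
have := @ftc_itv R G 0 s s0 (fun t => @ex_derive _ _ _ _ _ _ _ (ramp_antiderivative A k s t)) cG.
rewrite -integral_itv_obnd_cbnd; last first.
  by apply/measurable_EFinP; apply: measurable_funTS; exact: continuous_measurable_fun.
move=> h; rewrite /Rintegral.
transitivity (fine (\int[leb]_(x in `]0%R, s]) ('D_1 G x)%:E)%E).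
  congr fine; rewrite integral_mkcond [RHS]integral_mkcond; apply: eq_integral => t _.
  rewrite !patchE !mem_setE !in_itv /= andbT.
  case: (ltP 0 t) => //= t0; rewrite /ind /ramp; case: (leP t s) => st /=.
    have st0 : 0 <= s - t by rewrite subr_ge0.
    rewrite (max_idPr st0) dG; congr (Re _)%:E.
    by rewrite mul1r !mulrA.
  have st0 : s - t <= 0 by rewrite subr_le0 ltW.
  by rewrite (max_idPl st0) !mul0r !mulr0 addr0.
by rewrite h /G /= subrr mul0r !oppr0 sub0r opprK addr0 cexp0 mulr1.
Qed.

Lemma ramp_identity k s : 0 <= s -> 0 < Re k ->
  k * ip leb E (ind s) (cexp (- cj k)) + k ^+ 2 * ip leb E (ramp s) (cexp (- cj k)) = k * s%:C.
Proof.
move=> s0 k0.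
have kn : Re (- cj k) < 0 by rewrite ReN /= oppr_lt0.
have [se _] := sqint_cexp kn.
have i1 := sqint_ip mE (sqint_ind s) se; have i2 := sqint_ip mE (sqint_ramp s) se.
rewrite /ip -(cintegralZ mE _ i1) -(cintegralZ mE _ i2).
rewrite -cintegralD//; [|exact: cintegrableZ..].
have cE t : cj (cexp (- cj k) t) = cexp (- k) t by rewrite cexpJ conjN conjK.
apply: eqc.
  rewrite [RHS]ReM /= mulr0 subr0 mulrC -(ramp_Re k k s0); apply: eq_Rintegral => t _.
  by rewrite cE expr2.
rewrite [RHS]ImM /= mulr0 add0r.
have -> : Im k * s = s * Re (- 'i * k) by rewrite ReM /= oppr0 mul0r sub0r mulN1r opprK mulrC.
rewrite -(ramp_Re (- 'i * k) k s0); apply: eq_Rintegral => t _.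
have imE (z : R[i]) : Im z = Re (- 'i * z) by case: z => a b; rewrite ReM /=; ring.
by rewrite imE cE; congr (Re _); ring.
Qed.

Lemma hat_arith (k X Y Z W a b c : R[i]) :
  k * X + k ^+ 2 * Z = k * b -> k * Y + k ^+ 2 * W = k * a -> c * (b - a) = 1 ->
  - k * (- c * (X - Y)) + k ^+ 2 * (c * (Z - W)) = k.
Proof.
move=> h1 h2 h3; transitivity (c * ((k * X + k ^+ 2 * Z) - (k * Y + k ^+ 2 * W))); first by ring.
by rewrite h1 h2 -mulrBr mulrCA h3 mulr1.
Qed.

Variable delta : R.
Hypothesis delta0 : 0 < delta.

(* [hatc i] decreases linearly from 1 at [i * delta] to 0 at [i.+1 * delta], and [hatd i]
   is its derivative. *)
Definition hatc (i : nat) t : R[i] :=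
  (delta^-1)%:C * (ramp (i.+1%:R * delta) t - ramp (i%:R * delta) t).

Definition hatd (i : nat) t : R[i] :=
  - (delta^-1)%:C * (ind (i.+1%:R * delta) t - ind (i%:R * delta) t).

Lemma sqint_hatc i : sqint leb E (hatc i).
Proof. by apply: sqintZ => //; apply: sqintB => //; exact: sqint_ramp. Qed.

Lemma sqint_hatd i : sqint leb E (hatd i).
Proof. by apply: sqintZ => //; apply: sqintB => //; exact: sqint_ind. Qed.

(** The weak form on the half-line of [w'' = k ^+ 2 * w] for [w = e^{- k t}], tested with [hatc i].
    This function equals 1 at [t = 0] for every [i], so the right-hand side is always [- w'(0) = k],
    the Dirichlet-to-Neumann value. The exponential in the pairing has rate [cj k] because the
    second argument is conjugated. *)
Lemma hat_identity i k : 0 < Re k ->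
  - k * ip leb E (hatd i) (cexp (- cj k)) + k ^+ 2 * ip leb E (hatc i) (cexp (- cj k)) = k.
Proof.
move=> k0.
have kn : Re (- cj k) < 0 by rewrite ReN /= oppr_lt0.
have [se _] := sqint_cexp kn.
rewrite /hatd /hatc.
rewrite (ipZl mE _ (sqintB mE (sqint_ind _) (sqint_ind _)) se).
rewrite (ipZl mE _ (sqintB mE (sqint_ramp _) (sqint_ramp _)) se).
rewrite (ipBl mE (sqint_ind _) (sqint_ind _) se).
rewrite (ipBl mE (sqint_ramp _) (sqint_ramp _) se).
have b0 : 0 <= i.+1%:R * delta by rewrite mulr_ge0// ltW.
have a0 : 0 <= i%:R * delta by rewrite mulr_ge0// ltW.
have hb := ramp_identity b0 k0; have ha := ramp_identity a0 k0.
apply: (hat_arith hb ha).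
rewrite -rmorphB -mulrBl -natrB// subSnn mul1r -rmorphM mulVf ?gt_eqF//.
Qed.

End ramps.

(** With [r] the modulus of [x +i* y], the root has [Re k ^+ 2 = (r + x) / 2]. From
    [(r + x) * (r - x) = y ^+ 2], an upper bound on [r - x] becomes a lower bound on [Re k], which
    is stable when [x] is large. *)
Lemma complex_sqrt (R : realType) (x y : R) : y != 0 -> exists k : R[i],
  [/\ 0 < Re k, k ^+ 2 = x +i* y &
      forall c, `|x| - x + `|y| <= c -> y ^+ 2 / (2 * c) <= Re k ^+ 2].
Proof.
move=> y0; pose r := Num.sqrt (x ^+ 2 + y ^+ 2).
have r0 : 0 <= r by exact: sqrtr_ge0.
have y2 : 0 < y ^+ 2 by rewrite exprn_even_gt0.
have r2 : r ^+ 2 = x ^+ 2 + y ^+ 2 by rewrite sqr_sqrtr// addr_ge0// sqr_ge0.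
have xr : `|x| < r.
  by rewrite -sqrtr_sqr ltr_sqrt ?ltrDl// ltr_wpDl// sqr_ge0.
have rp : 0 < r + x by have := ler_norm (- x); rewrite normrN => h; lra.
have rm : 0 < r - x by rewrite subr_gt0 (le_lt_trans _ xr)// ler_norm.
have ry : (r + x) * (r - x) = y ^+ 2 by rewrite mulrC -subr_sqr r2 addrAC subrr add0r.
pose a := Num.sqrt ((r + x) / 2).
have a2 : a ^+ 2 = (r + x) / 2 by rewrite sqr_sqrtr// divr_ge0// ltW.
have a0 : 0 < a by rewrite sqrtr_gt0 divr_gt0.
have an0 : a != 0 by rewrite gt_eqF.
exists (a +i* (y / (2 * a))); split => //=.
- have b2 : (y / (2 * a)) ^+ 2 = (r - x) / 2.
    rewrite exprMn exprVn exprMn a2 -ry; field.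
    by rewrite gt_eqF.
  rewrite expr2; apply: eqc; rewrite ?ReM ?ImM /=.
    by rewrite -!expr2 a2 b2; field.
  by field.
- move=> c hc; rewrite a2 -ry.
  have c0 : 0 < c by rewrite (lt_le_trans _ hc)// ltr_wpDl ?normr_gt0// subr_ge0 ler_norm.
  have rc : r - x <= c.
    rewrite (le_trans _ hc)// addrAC lerD2r.
    apply: sqrtr_le; first by rewrite addr_ge0.
    rewrite sqrrD !real_normK ?num_real// addrAC lerDl mulrn_wge0// mulr_ge0//.
  rewrite ler_pdivrMr ?mulr_gt0// (_ : _ / 2 * _ = (r + x) * c); last by field.
  by rewrite ler_wpM2l// ltW.
Qed.

(** The bound [a0] is uniform in [D]: for [D >= 0] the quantity [|D - Re lambda| - (D - Re lambda)]
    never exceeds [2 * |Re lambda|], so one constant [c] serves in [complex_sqrt] for all [D]. *)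
Lemma spectral_root (R : realType) (lambda : R[i]) : Im lambda != 0 ->
  exists2 a0, 0 < a0 & forall D, 0 <= D -> exists k : R[i],
    [/\ a0 <= Re k, k ^+ 2 = D%:C - lambda & nsq k + D = 2 * Re k ^+ 2 + Re lambda].
Proof.
case: lambda => l1 l2 /= l0.
pose c := 2 * `|l1| + `|l2|.
have c0 : 0 < c by rewrite /c ltr_wpDl ?normr_gt0// mulr_ge0.
pose a0 := Num.sqrt (l2 ^+ 2 / (2 * c)).
have a00 : 0 < a0 by rewrite sqrtr_gt0 divr_gt0 ?exprn_even_gt0// mulr_gt0.
exists a0 => // D D0.
have ln : - l2 != 0 by rewrite oppr_eq0.
have [k [k0 k2 kc]] := complex_sqrt (D - l1) ln; exists k.
have hk : `|D - l1| - (D - l1) + `|- l2| <= c.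
  rewrite normrN /c lerD2r.
  have := ler_norm l1; have := ler_norm (- l1); rewrite normrN.
  by case: (ler0P (D - l1)) => *; lra.
split.
- apply: sqrtr_le; first exact: ltW.
  by rewrite -(sqrrN l2) kc.
- by rewrite k2; apply: eqc; rewrite ?ReD ?ImD ?ReN ?ImN /= ?add0r.
- have := congr1 (@complex.Re R) k2; rewrite expr2 ReM /= -!expr2 /nsq => h.
  by rewrite !expr2 in h *; lra.
Qed.

Section scalar_interpolation.
Variables (R : realType) (delta : R).
Hypothesis delta0 : 0 < delta.
Local Notation hatc := (hatc delta).
Local Notation hatd := (hatd delta).

(** Cells are open on the left and closed on the right, matching the convention [t <= s] of [ind],
    so that the cell formulas below hold at the nodes too. *)
Lemma grid_cell (t : R) : 0 < t -> exists k : nat, k%:R * delta < t <= k.+1%:R * delta.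
Proof.
move=> t0; have ex : exists n : nat, t <= n%:R * delta.
  exists (Num.bound (t / delta)); rewrite -ler_pdivrMr// ltW//.
  by apply: archi_boundP; rewrite divr_ge0// ltW.
have := ex_minnP ex; case => -[|k] tk kmin.
  by rewrite mul0r leNgt t0 in tk.
exists k; rewrite tk andbT ltNge; apply/negP => /kmin; by rewrite ltnn.
Qed.

Lemma rampE (s t : R) : ramp s t = if t <= s then (s - t)%:C else 0.
Proof.
rewrite /ramp; case: (leP t s) => ts.
  have h : 0 <= s - t by rewrite subr_ge0.
  by rewrite (max_idPr h).
have h : s - t <= 0 by rewrite subr_le0 ltW.
by rewrite (max_idPl h).
Qed.

Lemma le_grid (k i : nat) (t : R) : k%:R * delta < t <= k.+1%:R * delta ->
  (t <= i%:R * delta) = (k < i)%N.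
Proof.
move=> /andP[kt tk]; case: (ltnP k i) => ki.
  by apply: (le_trans tk); rewrite ler_pM2r// ler_nat.
by apply/negbTE; rewrite -ltNge; apply: le_lt_trans kt; rewrite ler_pM2r// ler_nat.
Qed.

Lemma hatc_cell (k i : nat) (t : R) : k%:R * delta < t <= k.+1%:R * delta ->
  hatc i t = if (i < k)%N then 0 else if i == k then (k.+1%:R - t / delta)%:C else 1.
Proof.
move=> kt; rewrite /hatc !rampE !(le_grid _ kt) ltnS.
have dn : delta != 0 by rewrite gt_eqF.
case: (ltngtP i k) => [ik|ik|->].
- by rewrite subrr mulr0.
- rewrite -rmorphB -rmorphM -(rmorph1 (@real_complex R)); congr (_%:C).
  by rewrite -natr1; field.
- by rewrite subr0 -rmorphM; congr (_%:C); field.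
Qed.

Lemma hatd_cell (k i : nat) (t : R) : k%:R * delta < t <= k.+1%:R * delta ->
  hatd i t = if i == k then - (delta^-1)%:C else 0.
Proof.
move=> kt; rewrite /hatd /ind !(le_grid _ kt) ltnS.
case: (ltngtP i k) => [ik|ik|_].
- by rewrite subrr mulr0.
- by rewrite subrr mulr0.
- by rewrite subr0 /= mulr1.
Qed.

(** The piecewise linear interpolant of [f] after summation by parts, for [f] vanishing at the last
    node. In this form every basis function [hatc i] equals 1 at [t = 0], as [hat_identity] uses,
    and the coefficients are increments that telescope to [f 0]. *)
Definition lini (N : nat) (f : R -> R[i]) t : R[i] :=
  \sum_(i < N) hatc i t * (f (i%:R * delta) - f (i.+1%:R * delta)).

Definition dini (N : nat) (f : R -> R[i]) t : R[i] :=
  \sum_(i < N) hatd i t * (f (i%:R * delta) - f (i.+1%:R * delta)).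

Lemma lini_cell (N k : nat) f (t : R) : k%:R * delta < t <= k.+1%:R * delta -> (k < N)%N ->
  f (N%:R * delta) = 0 ->
  lini N f t = (k.+1%:R - t / delta)%:C * f (k%:R * delta) +
               (1 - (k.+1%:R - t / delta))%:C * f (k.+1%:R * delta).
Proof.
move=> kt kN fN; rewrite /lini -(big_mkord xpredT (fun i => hatc i t * (f (i%:R * delta) - f (i.+1%:R * delta)))).
rewrite (big_cat_nat (n := k))//=; last exact: ltnW.
rewrite big_nat_cond big1 ?add0r; last first.
  by move=> i /andP[/andP[_ ik] _]; rewrite (hatc_cell i kt) ik mul0r.
(* Cells before [k] contribute nothing, cell [k] contributes a fraction of its increment, and the
   later increments telescope to the value at the right node. *)
rewrite big_ltn// (hatc_cell _ kt) ltnn eqxx big_nat_cond.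
rewrite (eq_bigr (fun i => - (f (i.+1%:R * delta) - f (i%:R * delta)))); last first.
  move=> i /andP[/andP[ki _] _]; rewrite (hatc_cell _ kt) gtn_eqF// ltnNge ltnW//= mul1r opprB//.
rewrite -big_nat_cond sumrN (telescope_sumr (fun i => f (i%:R * delta)) kN) fN.
by rewrite [(1 - _)%:C]rmorphB rmorph1; ring.
Qed.

Lemma dini_cell (N k : nat) f (t : R) : k%:R * delta < t <= k.+1%:R * delta -> (k < N)%N ->
  dini N f t = (delta^-1)%:C * (f (k.+1%:R * delta) - f (k%:R * delta)).
Proof.
move=> kt kN; rewrite /dini (bigD1 (Ordinal kN))//= big1 ?addr0.
  by rewrite (hatd_cell _ kt) eqxx; ring.
move=> i ik; rewrite (hatd_cell _ kt) ifF ?mul0r//.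
by apply/negbTE; apply: contra ik => /eqP e; apply/eqP/val_inj.
Qed.

Lemma ini_out (N k : nat) f (t : R) : k%:R * delta < t <= k.+1%:R * delta -> (N <= k)%N ->
  lini N f t = 0 /\ dini N f t = 0.
Proof.
move=> kt Nk; split; apply: big1 => i _.
  by rewrite (hatc_cell _ kt) (leq_trans (ltn_ord i) Nk) mul0r.
by rewrite (hatd_cell _ kt) ltn_eqF ?mul0r// (leq_trans (ltn_ord i) Nk).
Qed.

Lemma nsq_convex (th L : R) (a b : R[i]) : 0 <= th <= 1 -> nsq a <= L -> nsq b <= L ->
  nsq (th%:C * a + (1 - th)%:C * b) <= 4 * L.
Proof.
move=> /andP[h0 h1] ha hb.
have p1 : th ^+ 2 <= 1 by rewrite expr_le1.
have p2 : (1 - th) ^+ 2 <= 1 by rewrite expr_le1 ?subr_ge0// gerBl.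
rewrite (le_trans (nsqD_le _ _))// !nsqM !nsq_real.
have q1 : th ^+ 2 * nsq a <= L by rewrite (le_trans _ ha)// ler_piMl// nsq_ge0.
have q2 : (1 - th) ^+ 2 * nsq b <= L by rewrite (le_trans _ hb)// ler_piMl// nsq_ge0.
by lra.
Qed.

Lemma sqr_le (x y : R) : 0 <= x -> x <= y -> x ^+ 2 <= y ^+ 2.
Proof. by move=> x0 xy; rewrite lerXn2r// nnegrE (le_trans x0). Qed.

Lemma lini_error (N k : nat) f L (t : R) : k%:R * delta < t <= k.+1%:R * delta -> (k < N)%N ->
  f (N%:R * delta) = 0 -> 0 <= L -> (forall s t, nsq (f s - f t) <= L * (s - t) ^+ 2) ->
  nsq (f t - lini N f t) <= 4 * (L * delta ^+ 2).
Proof.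
move=> kt kN fN L0 fL; rewrite (lini_cell kt kN fN).
have /andP[k1 k2] := kt; set th := _ - t / delta.
have k1' : k%:R < t / delta by rewrite ltr_pdivlMr.
have k2' : t / delta <= k.+1%:R by rewrite ler_pdivrMr.
have th01 : 0 <= th <= 1.
  by rewrite /th; move: k1' k2'; rewrite -natr1 => h1 h2; apply/andP; split; lra.
have -> : f t - (th%:C * f (k%:R * delta) + (1 - th)%:C * f (k.+1%:R * delta)) =
   th%:C * (f t - f (k%:R * delta)) + (1 - th)%:C * (f t - f (k.+1%:R * delta)).
  by rewrite [(1 - _)%:C]rmorphB rmorph1; ring.
apply: (nsq_convex th01); rewrite (le_trans (fL _ _))// ler_wpM2l//.
  apply: sqr_le; first by rewrite subr_ge0 ltW.
  by rewrite lerBlDr (le_trans k2)// -natr1 mulrDl mul1r addrC.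
rewrite -sqrrN opprB; apply: sqr_le; first by rewrite subr_ge0.
by rewrite lerBlDr -natr1 mulrDl mul1r addrC lerD2l ltW.
Qed.

(** The derivative of the interpolant is a difference quotient, hence a value of the derivative at a
    point of the cell. The real and imaginary parts have different mean value points, whence the
    factor 2. *)
Lemma dini_error (N k : nat) (f g : R -> R[i]) L (t : R) :
  k%:R * delta < t <= k.+1%:R * delta -> (k < N)%N -> 0 <= L ->
  (forall t : R, is_derive t (1 : R) (fun s : R => Re (f s)) (Re (g t))) ->
  (forall t : R, is_derive t (1 : R) (fun s : R => Im (f s)) (Im (g t))) ->
  (forall s t, nsq (g s - g t) <= L * (s - t) ^+ 2) ->
  nsq (g t - dini N f t) <= 2 * (L * delta ^+ 2).
Proof.
move=> kt kN L0 d1 d2 gL; rewrite (dini_cell f kt kN).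
have /andP[k1 k2] := kt; set a := k%:R * delta; set b := k.+1%:R * delta.
have ba : b - a = delta by rewrite /b /a -mulrBl -natrB// subSnn mul1r.
have ab : a < b by rewrite -subr_gt0 ba.
have key (h g' : R -> R) : (forall t : R, is_derive t (1 : R) h (g' t)) ->
    exists2 xi, (xi - t) ^+ 2 <= delta ^+ 2 & delta^-1 * (h b - h a) = g' xi.
  move=> dh.
  have [s|xi x12 e] := @MVT R h g' a b ab.
    apply: continuous_subspaceT => s'.
    by apply: differentiable_continuous; apply/derivable1_diffP; have [] := dh s'.
  have /andP[x1 x2] : a < xi < b by move: x12; rewrite in_itv.
  exists xi; last by rewrite e ba mulrCA mulVf ?mulr1// gt_eqF.
  rewrite -(real_normK (num_real _)); apply: sqr_le => //.
  by rewrite ler_norml; apply/andP; split; rewrite /a /b in x1 x2 ba k1 k2; lra.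
have [x1 hx1 e1] := key _ _ d1; have [x2 hx2 e2] := key _ _ d2.
rewrite /nsq; apply: (@le_trans _ _ (nsq (g t - g x1) + nsq (g t - g x2))).
  have -> : Re (g t - (delta^-1)%:C * (f b - f a)) = Re (g t - g x1).
    by rewrite !(ReD, ReN, ReM) /= -e1 mul0r subr0.
  have -> : Im (g t - (delta^-1)%:C * (f b - f a)) = Im (g t - g x2).
    by rewrite !(ImD, ImN, ImM) /= -e2 mul0r addr0.
  by rewrite /nsq lerD// ?lerDl ?lerDr sqr_ge0.
rewrite mulr2n mulrDl mul1r; apply: lerD.
  by rewrite (le_trans (gL _ _))// ler_wpM2l// -sqrrN opprB.
by rewrite (le_trans (gL _ _))// ler_wpM2l// -sqrrN opprB.
Qed.

End scalar_interpolation.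

Section interpolation.
Variables (R : realType) (d : nat).
Local Notation Rd := 'rV[R]_d.
Local Notation pt := (Rd * R)%type.
Local Notation mu := (lebesgue_rV d \x lebesgue_measure)%E.
Local Notation sigma := (lebesgue_rV d).
Local Notation Omega := (@half_space R d).
Local Notation leb := (@lebesgue_measure R).
Local Notation E := (`]0%R, +oo[%classic : set R).
Implicit Types (F phi : pt -> R[i]).

Let mO : @measurable _ (Rd * g_sigma_algebraType (R.-ocitv.-measurable))%type Omega := @measurable_half_space R d.

Definition step delta F (i : nat) : Rd -> R[i] :=
  fun y => F (y, i%:R * delta) - F (y, i.+1%:R * delta).

Definition lint delta N F (x : pt) : R[i] :=
  \sum_(i < N) step delta F i x.1 * hatc delta i x.2.

Definition dint delta N F (x : pt) : R[i] :=
  \sum_(i < N) step delta F i x.1 * hatd delta i x.2.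

Lemma lintE delta N F y t : lint delta N F (y, t) = lini delta N (fun s => F (y, s)) t.
Proof. by apply: eq_bigr => i _; rewrite mulrC. Qed.

Lemma dintE delta N F y t : dint delta N F (y, t) = dini delta N (fun s => F (y, s)) t.
Proof. by apply: eq_bigr => i _; rewrite mulrC. Qed.

Lemma sqint_step delta F i : ctest F -> sqint sigma setT (step delta F i).
Proof. by move=> tF; apply: sqintB => //; exact: ctest_slice_sqint. Qed.

Lemma sqint_lint delta N F : ctest F -> sqint mu Omega (lint delta N F).
Proof.
move=> tF; apply: sqint_sum => // i.
by apply: tensor_sqint; [exact: sqint_step|exact: sqint_hatc].
Qed.

Lemma sqint_dint delta N F : ctest F -> sqint mu Omega (dint delta N F).
Proof.
move=> tF; apply: sqint_sum => // i.
by apply: tensor_sqint; [exact: sqint_step|exact: sqint_hatd].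
Qed.

Variables (M delta : R) (N : nat).
Hypothesis delta0 : 0 < delta.
Hypothesis MN : M < N%:R * delta.
Hypothesis NM : N%:R * delta <= M + 2.

Lemma supp_top F y t : supp_in M F -> N%:R * delta <= t -> F (y, t) = 0.
Proof.
move=> sF h; apply: sF => /ptboxP[_ /= h2].
have : M < M by rewrite (lt_le_trans MN)// (le_trans h)// (le_trans _ h2)// ler_norm.
by rewrite ltxx.
Qed.

Lemma int_out F x : supp_in M F -> Omega x -> ~ ptbox (M + 2) x ->
  lint delta N F x = 0 /\ dint delta N F x = 0.
Proof.
case: x => y t sF t0 nx; rewrite /half_space /= in t0.
have [k kt] := grid_cell delta0 t0.
rewrite lintE dintE; have [Nk|kN] := leqP N k; first exact: (ini_out delta0 _ kt Nk).
have tN : t <= M + 2.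
  have /andP[_ h] := kt; rewrite (le_trans h)// (le_trans _ NM)//.
  by rewrite ler_pM2r// ler_nat.
have z s : F (y, s) = 0.
  apply: sF => /ptboxP[/= h1 _]; apply: nx; apply/ptboxP; split => /=.
    by move=> i; rewrite (le_trans (h1 i))// lerDl.
  by rewrite gtr0_norm.
by split; apply: big1 => i _; rewrite !z subrr mulr0.
Qed.

Lemma lint_error F L : ctest F -> supp_in M F -> 0 <= L ->
  (forall (y : Rd) s t, nsq (F (y, s) - F (y, t)) <= L * (s - t) ^+ 2) ->
  n2 mu Omega (fun x => F x - lint delta N F x) <=
    4 * (L * delta ^+ 2) * fine (mu (ptbox (M + 2) : set pt)).
Proof.
move=> tF sF L0 FL.
have B0 : 0 <= 4 * (L * delta ^+ 2) by apply: mulr_ge0 => //; exact: mulr_ge0 L0 (sqr_ge0 _).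
have out (x : pt) : Omega x -> ~ ptbox (M + 2) x -> F x - lint delta N F x = 0.
  move=> Ox nx; rewrite (int_out sF Ox nx).1 sF ?subrr// => h; apply: nx.
  by apply: ptbox_le h; rewrite lerDl.
apply: n2_sup => //; first by apply: sqintB => //; [exact: ctest_sqint|exact: sqint_lint].
case=> y t Ox; have [k kt] := grid_cell delta0 Ox.
have [Nk|kN] := leqP N k.
  rewrite lintE (ini_out delta0 _ kt Nk).1 supp_top ?subrr ?nsq0//.
  have /andP[h _] := kt; rewrite (le_trans _ (ltW h))//.
  by rewrite ler_pM2r// ler_nat.
rewrite lintE; apply: (lini_error delta0 (f := fun s => F (y, s)) kt kN) => //.
exact: supp_top.
Qed.

Lemma is_derive_slice F (y : Rd) (t : R) : csmooth F ->
  is_derive t (1 : R) (fun s : R => Re (F (y, s))) (Re (pd ord_max F (y, t))) /\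
  is_derive t (1 : R) (fun s : R => Im (F (y, s))) (Im (pd ord_max F (y, t))).
Proof.
move=> sF; have [dr di] := csmooth_diff (y, t) sF.
have lineA (r : R) (h : R) : (y, h *: 1 + r) = h *: ((0, 1) : pt) + (y, r).
  by apply: injective_projections => //=; rewrite scaler0 add0r.
have c1 := @derive_comp_line R _ _ (fun x => Re (F x)) (fun t : R => (y, t) : pt) 1 _ t (lineA t).
have c2 := @derive_comp_line R _ _ (fun x => Im (F x)) (fun t : R => (y, t) : pt) 1 _ t (lineA t).
split.
  apply: DeriveDef; first by apply: c1.2; exact: diff_derivable.
  by rewrite c1.1 /pd /cderive /= /basis_vector unlift_none.
apply: DeriveDef; first by apply: c2.2; exact: diff_derivable.
by rewrite c2.1 /pd /cderive /= /basis_vector unlift_none.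
Qed.

Lemma dint_error F L : ctest F -> supp_in M F -> 0 <= L ->
  (forall (y : Rd) s t, nsq (pd ord_max F (y, s) - pd ord_max F (y, t)) <= L * (s - t) ^+ 2) ->
  n2 mu Omega (fun x => pd ord_max F x - dint delta N F x) <=
    2 * (L * delta ^+ 2) * fine (mu (ptbox (M + 2) : set pt)).
Proof.
move=> tF sF L0 FL.
have tP : ctest (pd ord_max F) by exact: ctest_derive.
have sP : supp_in M (pd ord_max F) by exact: supp_in_derive.
have B0 : 0 <= 2 * (L * delta ^+ 2) by apply: mulr_ge0 => //; exact: mulr_ge0 L0 (sqr_ge0 _).
have out (x : pt) : Omega x -> ~ ptbox (M + 2) x -> pd ord_max F x - dint delta N F x = 0.
  move=> Ox nx; rewrite (int_out sF Ox nx).2 sP ?subrr// => h; apply: nx.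
  by apply: ptbox_le h; rewrite lerDl.
apply: n2_sup => //; first by apply: sqintB => //; [exact: ctest_sqint|exact: sqint_dint].
case=> y t Ox; have [k kt] := grid_cell delta0 Ox.
have [Nk|kN] := leqP N k.
  rewrite dintE (ini_out delta0 _ kt Nk).2 (supp_top _ sP) ?subrr ?nsq0//.
  have /andP[h _] := kt; rewrite (le_trans _ (ltW h))//.
  by rewrite ler_pM2r// ler_nat.
rewrite dintE; apply: (dini_error delta0 (f := fun s => F (y, s)) (g := fun s => pd ord_max F (y, s)) kt kN) => //.
  by move=> s; exact: (is_derive_slice y s tF.1).1.
by move=> s; exact: (is_derive_slice y s tF.1).2.
Qed.

End interpolation.

Section approximation.
Variables (R : realType) (d : nat).
Local Notation Rd := 'rV[R]_d.
Local Notation pt := (Rd * R)%type.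
Local Notation mu := (lebesgue_rV d \x lebesgue_measure)%E.
Local Notation Omega := (@half_space R d).
Implicit Types (F phi : pt -> R[i]).

(** Replaces [phi] and its derivatives by finite sums of slices times normal profiles. The normal
    derivative has two approximants: its own interpolant, and the derivative of the interpolant of
    [phi], which is the one compatible with [hat_identity]. *)
Lemma piecewise_linear phi e : ctest phi -> 0 < e -> exists delta N,
  [/\ 0 < delta, forall y t, N%:R * delta <= t -> phi (y, t) = 0,
    n2 mu Omega (fun x => phi x - lint delta N phi x) <= e,
    forall j, n2 mu Omega (fun x => pd j phi x - lint delta N (pd j phi) x) <= e &
    n2 mu Omega (fun x => pd ord_max phi x - dint delta N phi x) <= e].
Proof.
move=> tp e0; have [M' sM'] := tp.2.
pose M := `|M'|; have M0 : 0 <= M by rewrite normr_ge0.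
have sp : supp_in M phi by apply: supp_in_le sM'; exact: ler_norm.
have tP j : ctest (pd j phi) by exact: ctest_derive.
have sP j : supp_in M (pd j phi) by exact: supp_in_derive.
have [L0 L00 hL0] := ctest_lipschitz tp.
have /choice[L hL] : forall j, exists L, 0 <= L /\
    forall (y : Rd) s t, nsq (pd j phi (y, s) - pd j phi (y, t)) <= L * (s - t) ^+ 2.
  by move=> j; have [Lj ? ?] := ctest_lipschitz (tP j); exists Lj.
(* A single constant dominating all the Lipschitz constants, so that one mesh serves every
   estimate. *)
pose S := L0 + \sum_j L j.
have S0 : 0 <= \sum_j L j by apply: sumr_ge0 => j _; exact: (hL j).1.
have LS j : L j <= S.
  rewrite /S (bigD1 j)//= addrCA lerDl addr_ge0//.
  by apply: sumr_ge0 => k _; exact: (hL k).1.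
have L0S : L0 <= S by rewrite /S lerDl.
pose V := fine (mu (ptbox (M + 2) : set pt)).
have V0 : 0 <= V by rewrite fine_ge0// measure_ge0.
have SS : 0 <= S by exact: le_trans L0S.
pose Q := 4 * S * V + 1; have Q0 : 0 < Q by rewrite /Q ltr_pwDr// !mulr_ge0.
pose delta := Num.min 1 (Num.sqrt (e / Q)).
have delta0 : 0 < delta by rewrite lt_min ltr01 sqrtr_gt0 divr_gt0.
have delta1 : delta <= 1 by rewrite /delta ge_min lexx.
have d2 : delta ^+ 2 <= e / Q.
  rewrite -[leRHS]sqr_sqrtr; last by rewrite divr_ge0// ltW.
  by apply: sqr_le; [exact: ltW|rewrite /delta ge_min lexx orbT].
have M10 : 0 < M + 1 by rewrite ltr_pwDr.
(* The last node falls between [M + 1] and [M + 2] because [delta <= 1]: it lies beyond the support,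
   yet inside a box whose volume does not depend on the mesh. *)
have [k /andP[k1 k2]] := grid_cell delta0 M10.
exists delta, k.+1.
have MN : M < k.+1%:R * delta by rewrite (lt_le_trans _ k2)// ltrDl.
have NM : k.+1%:R * delta <= M + 2.
  by rewrite -natr1 mulrDl mul1r; lra.
have fin c L' : c <= 4 -> 0 <= c -> 0 <= L' -> L' <= S -> c * (L' * delta ^+ 2) * V <= e.
  move=> c4 c0 L'0 L'S.
  apply: (@le_trans _ _ (4 * S * V * delta ^+ 2)).
    rewrite (_ : c * _ * V = c * L' * V * delta ^+ 2); last by ring.
    by rewrite ler_wpM2r ?sqr_ge0// ler_wpM2r// ler_pM.
  rewrite (le_trans (ler_wpM2l _ d2)) ?mulr_ge0//.
  rewrite mulrCA ler_piMr//; first exact: ltW.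
  by rewrite ler_pdivrMr// mul1r /Q lerDl.
split => //.
- by move=> y t h; exact: (supp_top MN y sp h).
- by apply: le_trans (lint_error delta0 MN NM tp sp L00 hL0) _; apply: fin.
- move=> j; apply: le_trans (lint_error delta0 MN NM (tP j) (sP j) (hL j).1 (hL j).2) _.
  by apply: fin; rewrite ?(hL j).1// ler_nat.
- apply: le_trans (dint_error delta0 MN NM tp sp (hL ord_max).1 (hL ord_max).2) _.
  by apply: fin; rewrite ?(hL ord_max).1// ler_nat.
Qed.

End approximation.

(** * The Galerkin test function *)

Section gram.
Context dd (T : measurableType dd) (R : realType).
Variables (m : {measure set T -> \bar R}) (S : set T) (N : nat).
Hypothesis mS : measurable S.
Implicit Types (f g : 'I_N -> T -> R[i]) (v w : 'rV[R[i]]_N).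

Definition gram f g : 'M[R[i]]_N := \matrix_(a, b) ip m S (f a) (g b).

Definition lc v f (x : T) : R[i] := \sum_a v 0 a * f a x.

Lemma sqint_lc v f : (forall a, sqint m S (f a)) -> sqint m S (lc v f).
Proof. by move=> sf; apply: sqint_sum => // a; exact: sqintZ. Qed.

Lemma ip_lcl v f (g : T -> R[i]) : (forall a, sqint m S (f a)) -> sqint m S g ->
  ip m S (lc v f) g = \sum_a v 0 a * ip m S (f a) g.
Proof.
move=> sf sg; rewrite ip_suml//; last by move=> a; exact: sqintZ.
by apply: eq_bigr => a _; rewrite ipZl.
Qed.

Lemma ip_lcr v f (g : T -> R[i]) : (forall a, sqint m S (f a)) -> sqint m S g ->
  ip m S g (lc v f) = \sum_a cj (v 0 a) * ip m S g (f a).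
Proof.
move=> sf sg; rewrite ip_sumr//; last by move=> a; exact: sqintZ.
by apply: eq_bigr => a _; rewrite ipZr.
Qed.

Lemma gram_form f g v w : (forall a, sqint m S (f a)) -> (forall a, sqint m S (g a)) ->
  (v *m gram f g *m adj w) 0 0 = ip m S (lc v f) (lc w g).
Proof.
move=> sf sg; rewrite ip_lcr//; last exact: sqint_lc.
rewrite mxE; apply: eq_bigr => b _; rewrite !mxE mulrC; congr (_ * _).
by rewrite ip_lcl//; apply: eq_bigr => a _; rewrite mxE.
Qed.

Lemma adj_gram f g : (forall a, sqint m S (f a)) -> (forall a, sqint m S (g a)) ->
  adj (gram f g) = gram g f.
Proof. by move=> sf sg; apply/matrixP => a b; rewrite !mxE -ipC. Qed.

Lemma gram_psd f v : (forall a, sqint m S (f a)) ->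
  (v *m gram f f *m adj v) 0 0 = (n2 m S (lc v f))%:C.
Proof. by move=> sf; rewrite gram_form// ip_n2. Qed.

Lemma ip_n2_eq0 (f g : T -> R[i]) : sqint m S f -> sqint m S g -> n2 m S f = 0 -> ip m S f g = 0.
Proof.
move=> sf sg f0; apply/eqP; rewrite -nsq_eq0 eq_le nsq_ge0 andbT.
by rewrite (le_trans (CauchySchwarz mS sf sg))// f0 mul0r.
Qed.

End gram.

Section galerkin.
Variables (R : realType) (d N : nat).
Local Notation Rd := 'rV[R]_d.
Local Notation pt := (Rd * R)%type.
Local Notation sigma := (lebesgue_rV d).
Implicit Types (p q f g : pt -> R[i]) (j : 'I_d).

Definition tg j q : Rd -> R[i] := bd (pd (lift ord_max j) q).

Lemma sqint_bd q : ctest q -> sqint sigma setT (bd q).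
Proof. by move=> tq; exact: ctest_slice_sqint. Qed.

Lemma sqint_tg j q : ctest q -> sqint sigma setT (tg j q).
Proof. by move=> tq; apply: sqint_bd; exact: ctest_derive. Qed.

Lemma divergence_bd q j : ctest q -> cintegral sigma setT (tg j q) = 0.
Proof.
move=> tq.
have re0 g : ctest g -> \int[sigma]_y Re (tg j g y) = 0.
  by move=> tg; rewrite /Rintegral (slice_divergence_re j 0 tg).
have ti : ctest (fun x => - 'i * q x) by exact: ctestZ.
apply: eqc; first exact: re0.
rewrite -[RHS](re0 _ ti); apply: eq_Rintegral => y _.
have dc : cdifferentiable (fun=> - 'i : R[i]) (y, 0 : R) by exact: cdifferentiable_cst.
rewrite /tg /bd /pd (cderiveM _ dc (csmooth_diff (y, 0) tq.1)) cderive_cst mul0r add0r.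
by rewrite ReM /= oppr0 mul0r sub0r mulN1r opprK.
Qed.

(** Used to show that a null combination of traces has null tangential derivatives, the kernel
    condition of [simultaneous_diag]. *)
Lemma bd_byparts p q j : ctest p -> ctest q ->
  ip sigma setT (tg j p) (bd q) = - ip sigma setT (bd p) (tg j q).
Proof.
move=> tp tq; set e := basis_vector R (lift ord_max j).
have tpq : ctest (fun x => p x * cj (q x)) by apply: ctestM; [exact: tp.1|exact: ctestJ].
apply/eqP; rewrite -addr_eq0 /ip -cintegralD//; last 2 first.
- by apply: sqint_ip => //; [exact: sqint_tg|exact: sqint_bd].
- by apply: sqint_ip => //; [exact: sqint_bd|exact: sqint_tg].
rewrite -(divergence_bd j tpq); apply/eqP; apply: eq_cintegral => y _.
rewrite /tg /bd /pd cderiveM ?cderiveJ//; apply: csmooth_diff; [exact: tq.1|exact: tp.1|].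
by apply: csmoothJ; exact: tq.1.
Qed.

Lemma pd_lc i (v : 'rV[R[i]]_N) (F : 'I_N -> pt -> R[i]) : (forall a, ctest (F a)) ->
  pd i (lc v F) = lc v (fun a => pd i (F a)).
Proof.
move=> tF; apply/funext => x; rewrite /pd cderive_sum; last first.
  by move=> a; apply: csmoothM; [exact: csmooth_cst|exact: (tF a).1].
apply: eq_bigr => a _.
have dc : cdifferentiable (fun=> v 0 a : R[i]) x by exact: cdifferentiable_cst.
by rewrite (cderiveM _ dc (csmooth_diff x (tF a).1)) cderive_cst mul0r add0r.
Qed.

Lemma ctest_lc (v : 'rV[R[i]]_N) (F : 'I_N -> pt -> R[i]) : (forall a, ctest (F a)) ->
  ctest (lc v F).
Proof. by move=> tF; apply: ctest_sum => a; exact: ctestZ. Qed.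

Variable F : 'I_N -> pt -> R[i].
Hypothesis tF : forall a, ctest (F a).

Let M := gram sigma setT (fun a => bd (F a)) (fun a => bd (F a)).
Let K := \sum_(j < d) gram sigma setT (fun a => tg j (F a)) (fun a => tg j (F a)).

(* In the basis [H] both the L^2 and the tangential Dirichlet forms of the span of the
   boundary values of [F] are diagonal; [P] gives the coordinates of [F]. The last clause
   replaces [F a = \sum_b P a b * H b], since the boundary values of [F] may be dependent. *)
Lemma galerkin : exists (H : 'I_N -> pt -> R[i]) (P : 'M[R[i]]_N) (D : 'I_N -> R),
  [/\ forall b, ctest (H b) /\ 0 <= D b,
    forall a b, ip sigma setT (bd (F a)) (bd (H b)) = P a b,
    forall a b, \sum_(j < d) ip sigma setT (tg j (F a)) (tg j (H b)) = P a b * (D b)%:C,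
    forall v : 'rV[R[i]]_N,
      n2 sigma setT (lc v (fun b => bd (H b))) <= \sum_b nsq (v 0 b) /\
      \sum_(j < d) n2 sigma setT (lc v (fun b => tg j (H b))) = \sum_b D b * nsq (v 0 b) &
    n2 sigma setT (fun y => \sum_a bd (F a) y - \sum_b (\sum_a P a b) * bd (H b) y) = 0].
Proof.
have sF a : sqint sigma setT (bd (F a)) by exact: sqint_bd.
have sT j a : sqint sigma setT (tg j (F a)) by exact: sqint_tg.
have Kform (v w : 'rV[R[i]]_N) : (v *m K *m adj w) 0 0 =
    \sum_(j < d) ip sigma setT (lc v (fun a => tg j (F a))) (lc w (fun a => tg j (F a))).
  rewrite /K mulmx_sumr mulmx_suml summxE; apply: eq_bigr => j _.
  by rewrite gram_form.
have hM : adj M = M by exact: adj_gram.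
have hK : adj K = K.
  rewrite /K adjE linear_sum map_mx_sum /=; apply: eq_bigr => j _.
  by rewrite -adjE adj_gram.
have pM (v : 'rV[R[i]]_N) : 0 <= Re ((v *m M *m adj v) 0 0) by rewrite gram_psd//= n2_ge0.
have pK (v : 'rV[R[i]]_N) : 0 <= Re ((v *m K *m adj v) 0 0).
  by rewrite Kform Re_sum; apply: sumr_ge0 => j _; rewrite ip_n2 /= n2_ge0.
(* A vector killed by [M] is a combination with trace zero almost everywhere. Moving its tangential
   derivative onto [F b] by parts leaves a pairing with that null trace. *)
have ker (v : 'rV[R[i]]_N) : v *m M = 0 -> v *m K = 0.
  move=> vM.
  have n0 : n2 sigma setT (lc v (fun a => bd (F a))) = 0.
    by have := gram_psd measurableT v sF; rewrite -/M vM mul0mx mxE => /(congr1 (@complex.Re R)) /= <-.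
  apply/rowP => b; rewrite [RHS]mxE /K mulmx_sumr summxE big1// => j _.
  rewrite mxE; transitivity (ip sigma setT (lc v (fun a => tg j (F a))) (tg j (F b))).
    by rewrite ip_lcl//; apply: eq_bigr => a _; rewrite mxE.
  transitivity (- ip sigma setT (lc v (fun a => bd (F a))) (tg j (pd (lift ord_max j) (F b)))).
    have tP : ctest (pd (lift ord_max j) (F b)) by exact: ctest_derive.
    have := bd_byparts j (ctest_lc v tF) tP; rewrite /tg pd_lc//; exact.
  rewrite ip_n2_eq0 ?oppr0//; first exact: sqint_lc.
  by apply: sqint_tg; exact: ctest_derive.
have [P [Q [D [D0 MQ KQ QKQ [PQM QMQ]]]]] := simultaneous_diag hM pM hK pK ker.
pose H b := lc (row b Q) F.
have tH b : ctest (H b) by exact: ctest_lc.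
have bdH b : bd (H b) = lc (row b Q) (fun a => bd (F a)) by [].
have tgH j b : tg j (H b) = lc (row b Q) (fun a => tg j (F a)) by rewrite /tg /H pd_lc.
have lcH (f : 'I_N -> Rd -> R[i]) (v : 'rV[R[i]]_N) :
    lc v (fun b => lc (row b Q) f) = lc (v *m Q) f.
  apply/funext => y; rewrite /lc; under eq_bigr do rewrite mulr_sumr.
  rewrite exchange_big; apply: eq_bigr => a _ /=; rewrite mxE mulr_suml.
  by apply: eq_bigr => b _; rewrite mxE mulrA.
exists H, P, D; split.
- by [].
- move=> a b; rewrite bdH ip_lcr// -MQ mxE; apply: eq_bigr => c _.
  by rewrite !mxE mulrC.
- move=> a b.
  have -> : P a b * (D b)%:C = (P *m diagR D) a b by rewrite mul_mx_diag !mxE.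
  rewrite -KQ /K mulmx_suml summxE; apply: eq_bigr => j _.
  rewrite tgH ip_lcr// mxE; apply: eq_bigr => c _.
  by rewrite !mxE mulrC.
- move=> v; split.
    have := QMQ v.
    have -> : v *m (Q *m M *m adj Q) *m adj v = (v *m Q) *m M *m adj (v *m Q).
      by rewrite adjM !mulmxA.
    by rewrite gram_psd// -lcH.
  have := congr1 (fun X => Re ((v *m X *m adj v) 0 0)) QKQ.
  rewrite diagR_form /= => <-.
  have -> : v *m (Q *m K *m adj Q) *m adj v = (v *m Q) *m K *m adj (v *m Q).
    by rewrite adjM !mulmxA.
  rewrite Kform Re_sum; apply: eq_bigr => j _; rewrite ip_n2 /= -lcH.
  by apply: eq_n2 => y _; apply: eq_bigr => b _; rewrite tgH.
(* [const_mx 1] is the coordinate vector of [\sum_a F a], and [w] that of its difference from the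
   expansion in [H]. Since [w *m M = 0], the corresponding trace has norm zero. *)
- pose w : 'rV[R[i]]_N := const_mx 1 *m (1%:M - P *m Q).
  have wM : w *m M = 0 by rewrite /w -mulmxA PQM mulmx0.
  have := gram_psd measurableT w sF; rewrite -/M wM mul0mx mxE => /(congr1 (@complex.Re R)) /= n0.
  rewrite [RHS]n0; apply: eq_n2 => y _.
  have -> : lc w (fun a => bd (F a)) y = lc (const_mx 1) (fun a => bd (F a)) y -
      lc ((const_mx 1 *m P) *m Q) (fun a => bd (F a)) y.
    rewrite /lc -sumrB; apply: eq_bigr => a _.
    by rewrite /w mulmxBr mulmx1 mulmxA !mxE mulrBl.
  congr (_ - _); first by apply: eq_bigr => a _; rewrite mxE mul1r.
  rewrite -lcH; apply: eq_bigr => b _; congr (_ * _); rewrite mxE.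
  by apply: eq_bigr => a _; rewrite mxE mul1r.
Qed.

End galerkin.

Section tensor_sums.
Variables (R : realType) (d N : nat).
Local Notation Rd := 'rV[R]_d.
Local Notation pt := (Rd * R)%type.
Local Notation leb := (@lebesgue_measure R).
Local Notation mu := (lebesgue_rV d \x lebesgue_measure)%E.
Local Notation sigma := (lebesgue_rV d).
Local Notation Omega := (@half_space R d).
Local Notation E := (`]0%R, +oo[%classic : set R).
Implicit Types (f g : 'I_N -> Rd -> R[i]) (e : 'I_N -> R -> R[i]).

Let mO : @measurable _ (Rd * g_sigma_algebraType (R.-ocitv.-measurable))%type Omega := @measurable_half_space R d.

Let mE : (R.-ocitv.-measurable).-sigma.-measurable E.
Proof. exact: measurable_itv. Qed.

(* Schur product: the trace of the product of two nonnegative forms is nonnegative *)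
Lemma schur_le (G : 'M[R[i]]_N) (c : 'I_N -> R) e : adj G = G ->
  (forall b, sqint leb E (e b)) ->
  (forall v : 'rV[R[i]]_N, Re ((v *m G *m adj v) 0 0) <= \sum_b c b * nsq (v 0 b)) ->
  Re (\sum_a \sum_b G a b * ip leb E (e a) (e b)) <= \sum_b c b * n2 leb E (e b).
Proof.
move=> hG se Gc.
(* [A] is positive semidefinite; diagonalizing it turns the double sum into a nonnegative
   combination of squared norms. *)
pose A := diagR c - G.
have hA : adj A = A by rewrite adjE linearB /= map_mxB -!adjE adj_diagR hG.
have pA (v : 'rV[R[i]]_N) : 0 <= Re ((v *m A *m adj v) 0 0).
  rewrite mulmxBr mulmxBl mxE [X in Re (_ + X)]mxE ReD ReN diagR_form /= subr_ge0.
  exact: Gc.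
have [U [s [_ _ s0 eA]]] := hermitian_diag hA pA.
have AE a b : A a b = \sum_k cj (U k a) * (s k)%:C * U k b.
  rewrite {1}eA mxE; apply: eq_bigr => k _; rewrite mul_mx_diag !mxE.
  by [].
have key : Re (\sum_a \sum_b A a b * ip leb E (e a) (e b)) =
    \sum_k s k * n2 leb E (lc (\row_a cj (U k a)) e).
  transitivity (Re (\sum_k (s k)%:C * (ip leb E (lc (\row_a cj (U k a)) e) (lc (\row_a cj (U k a)) e)))).
    congr (Re _).
    under eq_bigr do under eq_bigr do rewrite AE mulr_suml.
    under eq_bigr do rewrite exchange_big /=.
    rewrite exchange_big /=; apply: eq_bigr => k _.
    rewrite ip_lcl//; last exact: sqint_lc.
    rewrite mulr_sumr; apply: eq_bigr => a _.
    rewrite ip_lcr// !mulr_sumr; apply: eq_bigr => b _.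
    by rewrite !mxE conjK; ring.
  rewrite Re_sum; apply: eq_bigr => k _.
  by rewrite ip_n2 -rmorphM.
have p0 : 0 <= Re (\sum_a \sum_b A a b * ip leb E (e a) (e b)).
  by rewrite key; apply: sumr_ge0 => k _; rewrite mulr_ge0// n2_ge0.
rewrite -subr_ge0; apply: le_trans p0 _; rewrite le_eqVlt; apply/orP; left; apply/eqP.
have -> : \sum_b c b * n2 leb E (e b) = Re (\sum_a \sum_b diagR c a b * ip leb E (e a) (e b)).
  rewrite Re_sum; apply: eq_bigr => a _.
  rewrite (bigD1 a)//= big1 ?addr0.
    by rewrite !mxE eqxx mulr1n ip_n2 -rmorphM.
  by move=> b ba; rewrite !mxE eq_sym (negbTE ba) mulr0n mul0r.
rewrite -ReN -ReD -sumrB; congr (Re _); apply: eq_bigr => a _.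
rewrite -sumrB; apply: eq_bigr => b _; rewrite -mulrBl; congr (_ * _).
by rewrite mxE [X in _ + X = _]mxE.
Qed.

Definition tsum f e (x : pt) : R[i] := \sum_b f b x.1 * e b x.2.

Lemma sqint_tsum f e : (forall b, sqint sigma setT (f b)) -> (forall b, sqint leb E (e b)) ->
  sqint mu Omega (tsum f e).
Proof. by move=> sf se; apply: sqint_sum => // b; exact: tensor_sqint. Qed.

Lemma ip_tsum f e g e' :
  (forall b, sqint sigma setT (f b)) -> (forall b, sqint leb E (e b)) ->
  (forall b, sqint sigma setT (g b)) -> (forall b, sqint leb E (e' b)) ->
  ip mu Omega (tsum f e) (tsum g e') =
  \sum_a \sum_b ip sigma setT (f a) (g b) * ip leb E (e a) (e' b).
Proof.
move=> sf se sg se'; rewrite ip_suml//; last 2 first.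
- by move=> a; exact: tensor_sqint.
- exact: sqint_tsum.
apply: eq_bigr => a _; rewrite ip_sumr//; last 2 first.
- by move=> b; exact: tensor_sqint.
- exact: tensor_sqint.
by apply: eq_bigr => b _; rewrite tensor_ip.
Qed.

(** Formally this is the hypothesis [fc] at the vector of values [e b t], integrated over [t]. The
    Schur product does the same on Gram matrices, where the profiles need not be orthogonal. *)
Lemma n2_tsum_le k (f : 'I_k -> 'I_N -> Rd -> R[i]) e (c : 'I_N -> R) :
  (forall j b, sqint sigma setT (f j b)) -> (forall b, sqint leb E (e b)) ->
  (forall v : 'rV[R[i]]_N, \sum_j n2 sigma setT (lc v (f j)) <= \sum_b c b * nsq (v 0 b)) ->
  \sum_j n2 mu Omega (tsum (f j) e) <= \sum_b c b * n2 leb E (e b).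
Proof.
move=> sf se fc; pose G := \sum_j gram sigma setT (f j) (f j).
have hG : adj G = G.
  rewrite /G adjE linear_sum map_mx_sum /=; apply: eq_bigr => j _.
  by rewrite -adjE adj_gram.
have Gc (v : 'rV[R[i]]_N) : Re ((v *m G *m adj v) 0 0) <= \sum_b c b * nsq (v 0 b).
  rewrite (le_trans _ (fc v))// /G mulmx_sumr mulmx_suml summxE Re_sum.
  by apply: ler_sum => j _; rewrite gram_psd.
apply: le_trans (schur_le hG se Gc); rewrite le_eqVlt; apply/orP; left; apply/eqP.
have -> : \sum_j n2 mu Omega (tsum (f j) e) =
    Re (\sum_j ip mu Omega (tsum (f j) e) (tsum (f j) e)).
  by rewrite Re_sum; apply: eq_bigr => j _; rewrite ip_n2.
congr (Re _); under eq_bigr do rewrite ip_tsum//.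
rewrite exchange_big /=; apply: eq_bigr => a _.
rewrite exchange_big /=; apply: eq_bigr => b _.
by rewrite /G summxE mulr_suml; apply: eq_bigr => j _; rewrite mxE.
Qed.

End tensor_sums.

Section galerkin_test.
Variables (R : realType) (d N : nat).
Local Notation Rd := 'rV[R]_d.
Local Notation pt := (Rd * R)%type.
Local Notation leb := (@lebesgue_measure R).
Local Notation mu := (lebesgue_rV d \x lebesgue_measure)%E.
Local Notation sigma := (lebesgue_rV d).
Local Notation Omega := (@half_space R d).
Local Notation E := (`]0%R, +oo[%classic : set R).
Implicit Types (H : 'I_N -> pt -> R[i]) (cc kap : 'I_N -> R[i]).

Let mO : @measurable _ (Rd * g_sigma_algebraType (R.-ocitv.-measurable))%type Omega := @measurable_half_space R d.

Let mE : (R.-ocitv.-measurable).-sigma.-measurable E.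
Proof. exact: measurable_itv. Qed.

(* [psi = e^{- kappa^* t}] applied to [\sum_b cc b * bd (H b)]; [psin] and [psit] are its
   normal and tangential derivatives. *)
Definition prof (k : R[i]) : R -> R[i] := cexp (- cj k).

Definition psi H cc kap : pt -> R[i] :=
  tsum (fun b => bd (H b)) (fun b t => cc b * prof (kap b) t).

Definition psin H cc kap : pt -> R[i] :=
  tsum (fun b => bd (H b)) (fun b t => cc b * - cj (kap b) * prof (kap b) t).

Definition psit H cc kap j : pt -> R[i] :=
  tsum (fun b => tg j (H b)) (fun b t => cc b * prof (kap b) t).

Lemma sqint_prof k : 0 < Re k -> sqint leb E (prof k) /\ n2 leb E (prof k) <= (2 * Re k)^-1.
Proof.
move=> k0; have kn : Re (- cj k) < 0 by rewrite ReN /= oppr_lt0.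
by have := sqint_cexp kn; rewrite ReN opprK.
Qed.

Definition shift_nor (f : pt -> R[i]) s : pt -> R[i] := f \o aff 1 0 1 s.

Lemma shift_norE f s y t : shift_nor f s (y, t) = f (y, t + s).
Proof. by rewrite /shift_nor /aff /= scale1r addr0 mul1r. Qed.

Lemma ctest_shift f s : ctest f -> ctest (shift_nor f s).
Proof.
move=> [sf [M fM]]; split; first exact: csmooth_aff.
exists (M + `|s|) => -[y t] nx; rewrite shift_norE; apply: fM => /ptboxP[/= h1 h2].
apply: nx; apply/ptboxP; split => /=.
  by move=> i; rewrite (le_trans (h1 i))// lerDl.
by rewrite -[t](addrK s) (le_trans (ler_normB _ _))// lerD2r.
Qed.

Lemma pd_shift i f s : pd i (shift_nor f s) = shift_nor (pd i f) s.
Proof.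
rewrite /pd /shift_nor cderive_aff.
have -> : lin 1 1 (basis_vector R i) = basis_vector R i; last by [].
by rewrite /lin scale1r mul1r; case: (basis_vector R i).
Qed.

(** A test function on the whole space whose boundary value is the increment of [f] between two
    slices. It lets [galerkin], stated for traces, act on slices at positive height. *)
Definition stepf delta (f : pt -> R[i]) (a : nat) x :=
  shift_nor f (a%:R * delta) x - shift_nor f (a.+1%:R * delta) x.

Lemma ctest_stepf delta f a : ctest f -> ctest (stepf delta f a).
Proof.
move=> tf; have := ctestD (ctest_shift (a%:R * delta) tf) (ctestZ (-1) (ctest_shift (a.+1%:R * delta) tf)).
rewrite (_ : (fun x => _ + _) = stepf delta f a)//.
by apply/funext => x; rewrite mulN1r.
Qed.

Lemma bd_stepf delta f a : bd (stepf delta f a) = step delta f a.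
Proof. by apply/funext => y; rewrite /bd /stepf !shift_norE !add0r. Qed.

Lemma pd_stepf delta i f a : ctest f -> pd i (stepf delta f a) = stepf delta (pd i f) a.
Proof.
move=> tf; apply/funext => x; rewrite /stepf -!pd_shift.
have s1 := csmooth_diff x (ctest_shift (a%:R * delta) tf).1.
have s2 := csmooth_diff x (ctest_shift (a.+1%:R * delta) tf).1.
have dc : cdifferentiable (fun=> -1 : R[i]) x by exact: cdifferentiable_cst.
rewrite /pd.
have -> : (fun x => shift_nor f (a%:R * delta) x - shift_nor f (a.+1%:R * delta) x) =
   (fun x => shift_nor f (a%:R * delta) x + -1 * shift_nor f (a.+1%:R * delta) x).
  by apply/funext => z; rewrite mulN1r.
rewrite (cderiveD _ s1 (cdifferentiableM dc s2)) (cderiveM _ dc s2) cderive_cst.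
by rewrite mul0r add0r mulN1r.
Qed.

(** The energy of one exponential mode: [n] is the squared norm of the profile, [K] the squared
    modulus of its rate, [D] its tangential eigenvalue. The factor [(1 + K + D) / (2 * a)] equals
    [a + (1 + l1) / (2 * a)], and [a >= a0] absorbs the second term into a multiple of [a]. *)
Lemma energy_le (a a0 l1 K D w n : R) : 0 < a0 -> a0 <= a -> 0 <= w -> 0 <= K -> 0 <= D ->
  K + D = 2 * a ^+ 2 + l1 -> 0 <= n -> n <= (2 * a)^-1 ->
  w * n + w * K * n + D * (w * n) <= (1 + (1 + `|l1|) / (2 * a0 ^+ 2)) * (a * w).
Proof.
move=> a00 aa w0 K0 D0 KD n0 na; have ap : 0 < a by exact: lt_le_trans aa.
have S0 : 0 <= 1 + (K + D) by rewrite !addr_ge0.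
have -> : w * n + w * K * n + D * (w * n) = w * ((1 + (K + D)) * n) by ring.
rewrite [leRHS]mulrA [leRHS]mulrC [_ * a]mulrC ler_wpM2l//.
apply: (@le_trans _ _ ((1 + (K + D)) * (2 * a)^-1)); first by rewrite ler_wpM2l.
rewrite ler_pdivrMr ?mulr_gt0// KD.
have a02 : 0 < a0 ^+ 2 by rewrite exprn_gt0.
have h1 : a0 ^+ 2 <= a ^+ 2 by rewrite sqr_le// ltW.
have -> : a * (1 + (1 + `|l1|) / (2 * a0 ^+ 2)) * (2 * a) =
   2 * a ^+ 2 + (1 + `|l1|) * (a ^+ 2 / a0 ^+ 2).
  by field; rewrite gt_eqF.
have h2 : 1 <= a ^+ 2 / a0 ^+ 2 by rewrite ler_pdivlMr// mul1r.
have h3 : 1 + `|l1| <= (1 + `|l1|) * (a ^+ 2 / a0 ^+ 2) by rewrite ler_peMr// addr_ge0.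
have h4 := ler_norm l1; lra.
Qed.

Variables (lambda : R[i]) (a0 : R).
Hypothesis a00 : 0 < a0.
Hypothesis roots : forall D, 0 <= D -> exists k : R[i],
  [/\ a0 <= Re k, k ^+ 2 = D%:C - lambda & nsq k + D = 2 * Re k ^+ 2 + Re lambda].

Let C1 := 1 + (1 + `|Re lambda|) / (2 * a0 ^+ 2).

(** In the diagonal basis the form decouples into one-dimensional problems: each pair of an
    increment [a] and a mode [b] contributes [P a b * cj (cc b)] times the left side of
    [hat_identity], because [D b - lambda] is the square of [kap b]. Its value [kap b] does not
    depend on [a], so summing over [a] gives [kap b * nsq (cc b)]. *)
Lemma galerkin_test phi delta : ctest phi -> 0 < delta ->
  (forall y t, N%:R * delta <= t -> phi (y, t) = 0) ->
  exists H cc kap, let B := \sum_b Re (kap b) * nsq (cc b) in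
  [/\ forall b, ctest (H b) /\ a0 <= Re (kap b),
   Re (ip mu Omega (dint delta N phi) (psin H cc kap) +
     \sum_(j < d) ip mu Omega (lint delta N (pd (lift ord_max j) phi)) (psit H cc kap j) -
     lambda * ip mu Omega (lint delta N phi) (psi H cc kap)) = B,
   n2 mu Omega (psi H cc kap) + n2 mu Omega (psin H cc kap) +
     \sum_(j < d) n2 mu Omega (psit H cc kap j) <= C1 * B,
   n2 sigma setT (fun y => \sum_b cc b * bd (H b) y) <= B / a0 &
   n2 sigma setT (fun y => bd phi y - \sum_b cc b * bd (H b) y) = 0].
Proof.
move=> tp delta0 top.
have tF (a : 'I_N) : ctest (stepf delta phi a) by exact: ctest_stepf.
have [H [P [D [HD HP1 HP2 Hv Hnull]]]] := galerkin tF.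
have /choice[kap hk] : forall b, exists k : R[i], [/\ a0 <= Re k, k ^+ 2 = (D b)%:C - lambda &
    nsq k + D b = 2 * Re k ^+ 2 + Re lambda].
  by move=> b; apply: roots; exact: (HD b).2.
(* The coordinates of the trace of [phi], which is the sum of all the increments. *)
pose cc b := \sum_a P a b.
have k0 b : 0 < Re (kap b) by have [h _ _] := hk b; exact: lt_le_trans h.
have sH b : sqint sigma setT (bd (H b)) by apply: sqint_bd; exact: (HD b).1.
have sT j b : sqint sigma setT (tg j (H b)) by apply: sqint_tg; exact: (HD b).1.
have se b : sqint leb E (prof (kap b)) by exact: (sqint_prof (k0 b)).1.
have sec (c : 'I_N -> R[i]) b : sqint leb E (fun t => c b * prof (kap b) t) by exact: sqintZ.
have sst (f : pt -> R[i]) (a : 'I_N) : ctest f -> sqint sigma setT (step delta f a).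
  by move=> tf; exact: sqint_step.
have shc (a : 'I_N) : sqint leb E (hatc delta a) by exact: sqint_hatc.
have shd (a : 'I_N) : sqint leb E (hatd delta a) by exact: sqint_hatd.
have tgF j (a : 'I_N) : tg j (stepf delta phi a) = step delta (pd (lift ord_max j) phi) a.
  by rewrite /tg pd_stepf// bd_stepf.
have tpd j : ctest (pd (lift ord_max j) phi) by exact: ctest_derive.
exists H, cc, kap => B; split.
- by move=> b; split; [exact: (HD b).1|have [] := hk b].
- pose X (a b : 'I_N) := ip leb E (hatc delta a) (prof (kap b)).
  pose Y (a b : 'I_N) := ip leb E (hatd delta a) (prof (kap b)).
  have e1 : ip mu Omega (dint delta N phi) (psin H cc kap) =
      \sum_(a < N) \sum_(b < N) P a b * (cj (cc b) * (- kap b * Y a b)).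
    rewrite (ip_tsum (fun a => sst phi a tp) shd sH (sec (fun b => cc b * - cj (kap b)))).
    apply: eq_bigr => a _; apply: eq_bigr => b _.
    rewrite -HP1 bd_stepf; congr (_ * _).
    by rewrite (ipZr mE _ (se b) (shd a)) conjM conjN conjK /Y; ring.
  have e2 j : ip mu Omega (lint delta N (pd (lift ord_max j) phi)) (psit H cc kap j) =
      \sum_(a < N) \sum_(b < N) ip sigma setT (tg j (stepf delta phi a)) (tg j (H b)) * (cj (cc b) * X a b).
    rewrite (ip_tsum (fun a => sst _ a (tpd j)) shc (sT j) (sec cc)).
    apply: eq_bigr => a _; apply: eq_bigr => b _.
    by rewrite tgF (ipZr mE _ (se b) (shc a)).
  have e3 : ip mu Omega (lint delta N phi) (psi H cc kap) =
      \sum_(a < N) \sum_(b < N) P a b * (cj (cc b) * X a b).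
    rewrite (ip_tsum (fun a => sst phi a tp) shc sH (sec cc)).
    apply: eq_bigr => a _; apply: eq_bigr => b _.
    by rewrite -HP1 bd_stepf (ipZr mE _ (se b) (shc a)).
  have e2' : \sum_(j < d) ip mu Omega (lint delta N (pd (lift ord_max j) phi)) (psit H cc kap j) =
      \sum_(a < N) \sum_(b < N) P a b * (D b)%:C * (cj (cc b) * X a b).
    under eq_bigr do rewrite e2.
    rewrite exchange_big /=; apply: eq_bigr => a _.
    rewrite exchange_big /=; apply: eq_bigr => b _.
    by rewrite -HP2 mulr_suml.
  rewrite e1 e2' e3 mulr_sumr -big_split -sumrB /=.
  have -> : \sum_(a < N) (\sum_b P a b * (cj (cc b) * (- kap b * Y a b)) +
       \sum_b P a b * (D b)%:C * (cj (cc b) * X a b) - lambda * \sum_b P a b * (cj (cc b) * X a b)) =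
     \sum_(a < N) \sum_b P a b * (cj (cc b) * kap b).
    apply: eq_bigr => a _; rewrite mulr_sumr -big_split -sumrB /=; apply: eq_bigr => b _.
    have [_ hk2 _] := hk b.
    rewrite -[X in _ = _ * (_ * X)](hat_identity delta0 a (k0 b)) hk2 -/(X a b) -/(Y a b).
    by ring.
  rewrite exchange_big /= Re_sum; apply: eq_bigr => b _.
  rewrite -mulr_suml -/(cc b) mulrA mulcJ_nsq ReM /= mul0r subr0 mulrC//.
- have nE b : n2 leb E (prof (kap b)) <= (2 * Re (kap b))^-1 by exact: (sqint_prof (k0 b)).2.
  have b1 (e : 'I_N -> R -> R[i]) : (forall b, sqint leb E (e b)) ->
      n2 mu Omega (tsum (fun b => bd (H b)) e) <= \sum_b n2 leb E (e b).
    move=> he.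
    have := @n2_tsum_le R d N 1 (fun _ b => bd (H b)) e (fun=> 1) (fun _ => sH) he.
    rewrite big_ord1 => h; apply: (le_trans (h _)).
      move=> v; rewrite big_ord1; apply: (le_trans (Hv v).1).
      by apply: ler_sum => b _; rewrite mul1r.
    by apply: ler_sum => b _; rewrite mul1r.
  have b2 : \sum_(j < d) n2 mu Omega (psit H cc kap j) <=
      \sum_b D b * n2 leb E (fun t => cc b * prof (kap b) t).
    apply: (@n2_tsum_le R d N d (fun j b => tg j (H b)) _ D sT (sec cc)) => v.
    by rewrite (Hv v).2.
  have b1a := b1 _ (sec cc).
  have b1b := b1 _ (sec (fun b => cc b * - cj (kap b))).
  apply: (le_trans (lerD (lerD b1a b1b) b2)).
  rewrite -!big_split /= /B mulr_sumr; apply: ler_sum => b _.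
  have [h1 _ h3] := hk b.
  rewrite !(n2Z mE _ (se b)) nsqM nsqN nsqJ.
  by apply: energy_le => //; [exact: nsq_ge0|exact: nsq_ge0|exact: (HD b).2|exact: n2_ge0].
- have := (Hv (\row_b cc b)).1.
  have -> : n2 sigma setT (lc (\row_b cc b) (fun b => bd (H b))) =
      n2 sigma setT (fun y => \sum_b cc b * bd (H b) y).
    by apply: eq_n2 => y _; apply: eq_bigr => b _; rewrite mxE.
  move=> h; apply: (le_trans h); rewrite ler_pdivlMr// mulr_suml; apply: ler_sum => b _.
  rewrite mxE mulrC ler_wpM2r ?nsq_ge0//.
  by have [] := hk b.
- rewrite -[RHS]Hnull; apply: eq_n2 => y _; congr (_ - _).
  under eq_bigr do rewrite bd_stepf /step.
  (* The increments telescope to [phi (y, 0)], since [phi] vanishes at the last node. *)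
  rewrite -(big_mkord xpredT (fun a : nat => phi (y, a%:R * delta) - phi (y, a.+1%:R * delta))).
  under eq_bigr do rewrite -opprB.
  rewrite sumrN (telescope_sumr (fun a => phi (y, a%:R * delta)) (leq0n N)).
  by rewrite (top y (N%:R * delta) (lexx _)) mul0r sub0r opprK.
Qed.

End galerkin_test.

(** * Cutoff in the normal variable *)

Section cutoff.
Variables (R : realType) (d : nat).
Local Notation Rd := 'rV[R]_d.
Local Notation pt := (Rd * R)%type.
Implicit Types (theta ch : pt -> R[i]).

(** The exponentials are not compactly supported. A cutoff at height of order [1 / s] makes them
    admissible: its derivative is of order [s], and so is its distance from 1 at bounded height,
    with [B0], [B1] and [L] independent of [s]. *)
Definition is_cutoff (B0 B1 L s : R) ch :=
  csmooth ch /\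
  [/\ exists M, forall x, M < `|x.2| -> ch x = 0,
    forall y, ch (y, 0) = 1,
    forall x, nsq (ch x) <= B0,
    forall j x, pd (lift ord_max j) ch x = 0 &
    (forall x, nsq (pd ord_max ch x) <= s ^+ 2 * B1) /\
    forall x, nsq (ch x - 1) <= L * (s ^+ 2 * x.2 ^+ 2)].

Lemma cderive0 (f : pt -> R[i]) x : cderive 0 f x = 0.
Proof.
have d0 (h : pt -> R) : 'D_(0 : pt) h x = 0.
  rewrite /derive (_ : (fun t : R => _) = cst 0); first exact: lim_cst.
  by apply/funext => t; rewrite /= scaler0 add0r subrr scaler0.
by rewrite /cderive !d0.
Qed.

Lemma cderiveZ c (f : pt -> R[i]) v x : csmooth f ->
  cderive v (fun x => c * f x) x = c * cderive v f x.
Proof.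
move=> sf; have dc : cdifferentiable (fun=> c : R[i]) x by exact: cdifferentiable_cst.
by rewrite (cderiveM _ dc (csmooth_diff x sf)) cderive_cst mul0r add0r.
Qed.

(** No bump function has to be built: any test function with a nonzero value is restricted to the
    normal line through [x0], normalized, and stretched by [1 / s]. *)
Lemma cutoff_exists theta x0 : ctest theta -> theta x0 != 0 ->
  exists B0 B1 L, [/\ 0 <= B0, 0 <= B1, 0 <= L &
    forall s, 0 < s -> exists ch, is_cutoff B0 B1 L s ch].
Proof.
case: x0 => y0 t0 tt n0; set c := (theta (y0, t0))^-1.
have [b0 b00 hb0] := ctest_bound tt.
have [b1 b10 hb1] := ctest_bound (ctest_derive (basis_vector R ord_max) tt).
have [l l0 hl] := ctest_lipschitz tt.
have [M sM] := tt.2.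
exists (nsq c * b0), (nsq c * b1), (nsq c * l); split.
- by rewrite mulr_ge0// nsq_ge0.
- by rewrite mulr_ge0// nsq_ge0.
- by rewrite mulr_ge0// nsq_ge0.
move=> s s0; pose th := theta \o aff 0 y0 s t0.
have thE y t : th (y, t) = theta (y0, s * t + t0).
  by rewrite /th /aff /= scale0r add0r.
have sth : csmooth th by apply: csmooth_aff; exact: tt.1.
exists (fun x => c * th x); split; first by apply: csmoothM => //; exact: csmooth_cst.
split.
- exists ((M + `|t0|) / s) => -[y t] /=; rewrite ltr_pdivrMr// => h.
  rewrite thE sM ?mulr0// => /ptboxP[_ /= h2].
  have h3 : `|s * t| <= `|s * t + t0| + `|t0|.
    by rewrite -[s * t](addrK t0) (le_trans (ler_normB _ _))// subrK.
  rewrite normrM (gtr0_norm s0) mulrC in h3.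
  by have := lt_le_trans h (le_trans h3 (lerD h2 (lexx `|t0|))); rewrite ltxx.
- by move=> y; rewrite thE mulr0 add0r /c mulVf.
- by move=> x; rewrite nsqM; apply: ler_wpM2l; [exact: nsq_ge0|exact: hb0].
- move=> j x; rewrite /pd cderiveZ// /th cderive_aff /=.
  have -> : lin 0 s (basis_vector R (lift ord_max j)) = 0.
    by rewrite /lin /basis_vector liftK /= scale0r mulr0.
  by rewrite cderive0 mulr0.
- split.
    move=> x; rewrite /pd cderiveZ// /th cderive_aff /=.
    have -> : lin 0 s (basis_vector R ord_max) = s *: (basis_vector R ord_max : pt).
      have -> : basis_vector R ord_max = (0, 1) :> pt by rewrite /basis_vector unlift_none.
      by rewrite /lin /= scale0r; apply: injective_projections; rewrite /= ?scaler0.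
    rewrite (cderive_scale _ _ (csmooth_diff _ tt.1)).
    rewrite !nsqM nsq_real mulrCA; apply: ler_wpM2l; first exact: sqr_ge0.
    by apply: ler_wpM2l; [exact: nsq_ge0|exact: hb1].
  case=> y t /=; rewrite thE.
  have -> : c * theta (y0, s * t + t0) - 1 = c * (theta (y0, s * t + t0) - theta (y0, t0)).
    by rewrite mulrBr /c mulVf.
  rewrite nsqM -mulrA; apply: ler_wpM2l; first exact: nsq_ge0.
  by rewrite (le_trans (hl _ _ _))// addrK exprMn.
Qed.

Variable N : nat.
Implicit Types (H : 'I_N -> pt -> R[i]) (cc kap : 'I_N -> R[i]).

(** The product of the cutoff with [psi] is a genuine test function with the same trace as [psi];
    only its normal derivative acquires an extra term. *)
Lemma test_cutoff B0 B1 L s ch H cc kap : is_cutoff B0 B1 L s ch -> (forall b, ctest (H b)) ->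
  exists q, ctest q /\
  [/\ forall x, q x = ch x * psi H cc kap x,
    forall j x, pd (lift ord_max j) q x = ch x * psit H cc kap j x,
    forall x, pd ord_max q x = pd ord_max ch x * psi H cc kap x + ch x * psin H cc kap x &
    forall y, bd q y = \sum_b cc b * bd (H b) y].
Proof.
move=> [sch [[M hM] ch1 _ cht _]] tH.
pose P b (x : pt) : R[i] := cc b * prof (kap b) x.2.
have sP b : csmooth (P b) by apply: csmoothM; [exact: csmooth_cst|exact: csmooth_cexp].
pose h b := H b \o aff 1 0 0 0.
have hE b (x : pt) : h b x = bd (H b) x.1.
  by rewrite /h /aff /bd /= scale1r addr0 mul0r addr0.
have sh b : csmooth (h b) by apply: csmooth_aff; exact: (tH b).1.
pose q (x : pt) := \sum_b (ch x * P b x) * H b (x.1, 0).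
have qE : q = fun x => \sum_b (ch x * P b x) * h b x.
  by apply/funext => x; apply: eq_bigr => b _; rewrite hE.
have sPh b : csmooth (fun x => P b x * h b x) by exact: csmoothM.
have tq : ctest q.
  apply: ctest_sum => b; apply: (@ctest_slice_mul _ _ _ _ _ M) => //; first exact: csmoothM.
  by move=> x /hM ->; rewrite mul0r.
have S : csmooth (fun x => \sum_b P b x * h b x) by exact: csmooth_sum.
have qM : q = fun x => ch x * \sum_b P b x * h b x.
  by rewrite qE; apply/funext => x; rewrite mulr_sumr; apply: eq_bigr => b _; rewrite mulrA.
have psiE x : psi H cc kap x = \sum_b P b x * h b x.
  by apply: eq_bigr => b _; rewrite hE mulrC.
have dP v b x : cderive v (P b) x = (v.2)%:C * (cc b * - cj (kap b) * prof (kap b) x.2).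
  rewrite /P cderiveZ; last exact: csmooth_cexp.
  by rewrite (cexp_snd _ v x).2 /prof; ring.
have dS v x : cderive v (fun x => \sum_b P b x * h b x) x =
    \sum_b (cderive v (P b) x * h b x + P b x * cderive v (h b) x).
  rewrite cderive_sum//; apply: eq_bigr => b _.
  by rewrite cderiveM//; exact: csmooth_diff.
have dq v x : cderive v q x = cderive v ch x * psi H cc kap x +
    ch x * \sum_b (cderive v (P b) x * h b x + P b x * cderive v (h b) x).
  by rewrite qM cderiveM ?dS ?psiE//; exact: csmooth_diff.
exists q; split => //; split.
- by move=> x; rewrite qM psiE.
- move=> j x; rewrite /pd dq; have := cht j x; rewrite /pd => ->; rewrite mul0r add0r.
  congr (_ * _); apply: eq_bigr => b _.
  rewrite dP /basis_vector liftK /= mul0r mul0r add0r mulrC; congr (_ * _).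
  rewrite /h cderive_aff /= /tg /bd /pd /basis_vector liftK /lin /aff /= scale1r mulr0.
  by rewrite scale1r addr0 mul0r addr0.
- move=> x; rewrite /pd dq; congr (_ + _ * _); apply: eq_bigr => b _.
  rewrite dP /basis_vector unlift_none /= mul1r hE /h cderive_aff /=.
  have -> : lin 1 0 (0, 1) = 0 :> pt by rewrite /lin /= scale1r mul0r.
  by rewrite cderive0 mulr0 addr0 mulrC.
- move=> y; rewrite /bd /q; apply: eq_bigr => b _.
  by rewrite ch1 mul1r /P /prof /= cexp0 mulr1.
Qed.

End cutoff.

(** * Non-real spectral parameter *)

Section dominated.
Context dd (T : measurableType dd) (R : realType).
Variables (m : {measure set T -> \bar R}) (S : set T).
Hypothesis mS : measurable S.

Lemma sqint_dom (f g : T -> R[i]) c : 0 <= c -> cmeasurable S f -> sqint m S g ->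
  (forall x, S x -> nsq (f x) <= c * nsq (g x)) -> sqint m S f /\ n2 m S f <= c * n2 m S g.
Proof.
move=> c0 mf sg fg.
have cE x : c * nsq (g x) = nsq ((Num.sqrt c)%:C * g x).
  by rewrite nsqM nsq_real sqr_sqrtr.
have sc := sqintZ mS (Num.sqrt c)%:C sg.
have sf : sqint m S f.
  by apply: (le_integrable_nsq mS mf sc.2) => x Sx; rewrite -cE fg.
split=> //; rewrite (_ : c * _ = n2 m S (fun x => (Num.sqrt c)%:C * g x)).
  by apply: n2_le => // x Sx; rewrite -cE fg.
by rewrite n2Z// nsq_real sqr_sqrtr.
Qed.

End dominated.

(** Closes the estimate by absorption: [B] on the left against [sqrt B] on the right. *)
Lemma le_of_sqrt (R : realType) (B q : R) : 0 <= B -> 0 <= q -> B <= q * Num.sqrt B -> B <= q ^+ 2.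
Proof.
move=> B0 q0; rewrite -{1 3}(sqr_sqrtr B0); set b := Num.sqrt B => h.
have b0 : 0 <= b by exact: sqrtr_ge0.
apply: sqr_le => //; move: b0; rewrite le_eqVlt => /orP[/eqP <-//|b0].
by rewrite -(ler_pM2r b0) -expr2.
Qed.

Lemma sqrt_le_mul (R : realType) (a b e w : R) : 0 <= a -> 0 <= b -> 0 <= e -> a * b <= e * w ->
  Num.sqrt a * Num.sqrt b <= Num.sqrt e * Num.sqrt w.
Proof. by move=> a0 b0 e0 h; rewrite -!sqrtrM// ler_wsqrtr. Qed.

Lemma energy_arith2 (R : realType) (B0 B1 pn sn st s2 x y z t tb W : R) :
  0 <= B0 -> 0 <= B1 -> 0 <= pn -> 0 <= sn -> 0 <= st -> s2 <= 1 ->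
  x <= 2 * (s2 * B1 * pn) + 2 * (B0 * sn) -> y <= B0 * st -> z <= B0 * pn -> t <= tb ->
  pn + sn + st <= W -> x + y + z + t <= (2 * B0 + 2 * B1) * W + tb.
Proof.
move=> b0 b1 p0 q0 r0 s1 hx hy hz ht hW.
have h1 : 0 <= (2 * B0 + 2 * B1) * (W - (pn + sn + st)).
  by rewrite mulr_ge0 ?subr_ge0// addr_ge0// mulr_ge0.
have h2 : 0 <= (1 - s2) * (B1 * pn) by rewrite mulr_ge0 ?subr_ge0// mulr_ge0.
have h3 : 0 <= B0 * pn by rewrite mulr_ge0.
have h4 : 0 <= B0 * st by rewrite mulr_ge0.
have h5 : 0 <= B1 * sn by rewrite mulr_ge0.
have h6 : 0 <= B1 * st by rewrite mulr_ge0.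
have -> : (2 * B0 + 2 * B1) * W = (2 * B0 + 2 * B1) * (W - (pn + sn + st)) +
  2 * (B0 * pn) + 2 * (B0 * sn) + 2 * (B0 * st) + 2 * (B1 * pn) + 2 * (B1 * sn) + 2 * (B1 * st).
  by ring.
have e2 : (1 - s2) * (B1 * pn) = B1 * pn - s2 * B1 * pn by ring.
by rewrite e2 in h2; lra.
Qed.

Lemma sum_arith (R : realType) (d E l a b c e ab abc abce : R) :
  a <= E -> b <= 2 * E -> c <= 2 * d * E -> e <= l * (2 * E) ->
  ab <= a + b -> abc <= ab + c -> abce <= abc + e -> abce <= (3 + 2 * d + 2 * l) * E.
Proof.
move=> h1 h2 h3 h4 h5 h6 h7.
have -> : (3 + 2 * d + 2 * l) * E = E + 2 * E + 2 * d * E + l * (2 * E) by ring.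
by lra.
Qed.

Lemma weak_arith (R : realType) (C C2 B e de En : R) : 0 <= C -> 0 <= e -> 0 <= C2 -> 0 <= B ->
  de <= e -> En <= C2 * B ->
  C * Num.sqrt de * Num.sqrt En <= C * Num.sqrt e * (Num.sqrt C2 * Num.sqrt B).
Proof.
move=> c0 e0 c20 b0 h1 h2; rewrite -sqrtrM//.
apply: ler_pM; rewrite ?mulr_ge0 ?sqrtr_ge0//.
  by rewrite ler_wpM2l// ler_wsqrtr.
by rewrite ler_wsqrtr.
Qed.

Lemma form_arith (A : comNzRingType) (r x s l p b dn sj lp : A) :
  r + x + s - l * p + b = dn + sj - l * lp + (r + (x - dn) + (s - sj) - l * (p - lp)) + b.
Proof. by ring. Qed.

Lemma normcMN (R : realType) (x y : R[i]) : normc (- (x * y)) = normc x * normc y.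
Proof. by rewrite normcN ComplexField.Normc.normcM. Qed.

Lemma main_arith (R : realType) (A X b : R[i]) (B C D e c1 c2 sB : R) :
  Re A = B -> 0 <= Re b -> normc (A + X + b) <= C * e * (c2 * sB) ->
  normc X <= D * (e * (c1 * sB)) -> B <= (C * c2 + D * c1) * e * sB.
Proof.
move=> hA hb h1 h2.
have k1 := le_trans (le_trans (ler_norm _) (normr_Re_le (A + X + b))) h1.
have k2 : - Re X <= D * (e * (c1 * sB)).
  by rewrite (le_trans _ h2)// (le_trans _ (normr_Re_le _))// -normrN ler_norm.
rewrite !ReD hA in k1.
have -> : (C * c2 + D * c1) * e * sB = C * e * (c2 * sB) + D * (e * (c1 * sB)) by ring.
by lra.
Qed.

Lemma im_arith (R : realType) (A lambda P b : R[i]) (n c h k s q : R) :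
  0 <= n -> Im A = 0 -> normc (A - lambda * P + b) <= c * h * k -> P = n%:C ->
  normc b <= s * (q * h) -> `|Im lambda| * n <= (c * k + s * q) * h.
Proof.
move=> n0 hA h1 eP h2.
have e : Im lambda * n = Im b - Im (A - lambda * P + b).
  by rewrite !ImD ImN ImM eP /= hA; ring.
have -> : `|Im lambda| * n = `|Im b - Im (A - lambda * P + b)|.
  by rewrite -e normrM (ger0_norm n0).
apply: le_trans (ler_normB _ _) _.
have k1 := le_trans (normr_Im_le _) h1; have k2 := le_trans (normr_Im_le _) h2.
by rewrite (_ : _ * h = s * (q * h) + c * h * k); [exact: lerD|ring].
Qed.

Section complex_case.
Variables (R : realType) (d : nat).
Local Notation Rd := 'rV[R]_d.
Local Notation pt := (Rd * R)%type.
Local Notation mu := (lebesgue_rV d \x lebesgue_measure)%E.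
Local Notation sigma := (lebesgue_rV d).
Local Notation Omega := (@half_space R d).
Implicit Types (p q phi f g ch : pt -> R[i]).

Let mO : @measurable _ (Rd * g_sigma_algebraType (R.-ocitv.-measurable))%type Omega := @measurable_half_space R d.

Lemma H1sq_split q : H1sq q = n2 mu Omega (pd ord_max q) +
  \sum_(j < d) n2 mu Omega (pd (lift ord_max j) q) + n2 mu Omega q.
Proof.
congr (_ + _).
exact: (@bigD1_ord _ _ _ d.+1 ord_max xpredT (fun i => n2 mu Omega (pd i q))).
Qed.

Lemma sqint_cutoff B0 B1 L s ch g : 0 <= B0 -> is_cutoff B0 B1 L s ch -> sqint mu Omega g ->
  sqint mu Omega (fun x => ch x * g x) /\ n2 mu Omega (fun x => ch x * g x) <= B0 * n2 mu Omega g.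
Proof.
move=> B00 [sch [_ _ chB _ _]] sg; apply: sqint_dom => //.
  by apply: cmeasurableM; [exact: cmeasurable_smooth|exact: sg.1].
by move=> x _; rewrite nsqM ler_wpM2r// nsq_ge0.
Qed.

Lemma sqint_dcutoff B0 B1 L s ch g : 0 <= B1 -> is_cutoff B0 B1 L s ch -> sqint mu Omega g ->
  sqint mu Omega (fun x => pd ord_max ch x * g x) /\
  n2 mu Omega (fun x => pd ord_max ch x * g x) <= s ^+ 2 * B1 * n2 mu Omega g.
Proof.
move=> B10 [sch [_ _ _ _ [chB _]]] sg; apply: sqint_dom => //.
- by apply: mulr_ge0 => //; exact: sqr_ge0.
- apply: cmeasurableM; last exact: sg.1.
  by apply: cmeasurable_smooth; exact: csmooth_derive.
by move=> x _; rewrite nsqM ler_wpM2r// nsq_ge0.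
Qed.

(** The error has two sources. Replacing [f] by [f'] is a direct estimate; the factor [ch - 1],
    which is not small on the support of [g], is moved onto [f], whose support has height at most
    [M], where it is of order [s * M]. *)
Lemma pair_error B0 B1 L s ch f f' g M e W K : 0 <= B0 -> 0 <= L -> is_cutoff B0 B1 L s ch ->
  ctest f -> supp_in M f -> sqint mu Omega f' -> sqint mu Omega g ->
  n2 mu Omega (fun x => f x - f' x) <= e -> n2 mu Omega g <= W -> n2 mu Omega f <= K ->
  L * (s ^+ 2 * M ^+ 2) * K <= e ->
  normc (ip mu Omega f (fun x => ch x * g x) - ip mu Omega f' g) <=
    2 * (Num.sqrt e * Num.sqrt W).
Proof.
move=> B00 L0 hch tf sM sf' sg he hW hK hLK.
have [sch [_ _ _ _ [_ ch1]]] := hch.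
have [scg _] := sqint_cutoff B00 hch sg.
have sf : sqint mu Omega f by exact: ctest_sqint.
have e0 : 0 <= e by exact: le_trans (n2_ge0 _ _ _) he.
have c0 : 0 <= L * (s ^+ 2 * M ^+ 2).
  by apply: mulr_ge0 => //; apply: mulr_ge0; exact: sqr_ge0.
have [sh hh] : sqint mu Omega (fun x => cj (ch x - 1) * f x) /\
    n2 mu Omega (fun x => cj (ch x - 1) * f x) <= L * (s ^+ 2 * M ^+ 2) * n2 mu Omega f.
  apply: sqint_dom => //.
    apply: cmeasurableM; last exact: sf.1.
    apply: cmeasurableJ; apply: cmeasurable_smooth.
    have := csmoothD sch (csmooth_cst (-1)); exact.
  move=> x _; rewrite nsqM nsqJ.
  have [xM|nx] := pselect (ptbox M x); last by rewrite sM// nsq0 !mulr0.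
  rewrite ler_wpM2r ?nsq_ge0// (le_trans (ch1 x))// ler_wpM2l// ler_wpM2l ?sqr_ge0//.
  have /ptboxP[_ h] := xM.
  by rewrite -(real_normK (num_real x.2)); apply: sqr_le.
have sd : sqint mu Omega (fun x => f x - f' x) by exact: sqintB.
have e1 : ip mu Omega (fun x => cj (ch x - 1) * f x) g =
    ip mu Omega f (fun x => ch x * g x) - ip mu Omega f g.
  rewrite -ipBr//; apply: eq_cintegral => x _.
  rewrite (_ : ch x * g x - g x = (ch x - 1) * g x); last by ring.
  by rewrite conjM; ring.
have -> : ip mu Omega f (fun x => ch x * g x) - ip mu Omega f' g =
    ip mu Omega (fun x => f x - f' x) g + ip mu Omega (fun x => cj (ch x - 1) * f x) g.
  by rewrite e1 ipBl//; ring.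
have W0 : 0 <= W by exact: le_trans (n2_ge0 _ _ _) hW.
rewrite mulr2n mulrDl mul1r; apply: le_trans (le_normcD _ _) _; apply: lerD.
  apply: le_trans (normc_le_sqrt (n2_ge0 _ _ _) (CauchySchwarz mO sd sg)) _.
  by apply: sqrt_le_mul => //; rewrite ?n2_ge0// ler_pM// n2_ge0.
apply: le_trans (normc_le_sqrt (n2_ge0 _ _ _) (CauchySchwarz mO sh sg)) _.
apply: sqrt_le_mul => //; rewrite ?n2_ge0// ler_pM ?n2_ge0//.
by rewrite (le_trans hh)// (le_trans _ hLK)// ler_wpM2l.
Qed.

Variables (alpha : Rd -> R[i]) (lambda : R[i]) (u : pt -> R[i]).
Variables (Du : 'I_d.+1 -> pt -> R[i]) (tu : Rd -> R[i]) (C Ca : R).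
Hypothesis su : sqint mu Omega u.
Hypothesis sDu : forall i, sqint mu Omega (Du i).
Hypothesis stu : sqint sigma setT tu.
Hypothesis approx : forall e, 0 < e -> exists phi, ctest phi /\ defect u Du tu phi <= e.
Hypothesis C0 : 0 <= C.
Hypothesis weak : forall p q, ctest p -> ctest q ->
  normc (dform p q - lambda * ip mu Omega p q + bform alpha p q) <=
  C * Num.sqrt (defect u Du tu p) * Num.sqrt (H1sq q + n2 sigma setT (bd q)).
Hypothesis Bpos : forall p, ctest p -> 0 <= Re (bform alpha p p).
Hypothesis Ca0 : 0 <= Ca.
Hypothesis alpha_bound : forall f : Rd -> R[i], sqint sigma setT f ->
  sqint sigma setT (fun y => alpha y * f y) /\
  n2 sigma setT (fun y => alpha y * f y) <= Ca * n2 sigma setT f.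
Hypothesis lam_im : Im lambda != 0.

Variables (B0 B1 L : R).
Hypothesis B00 : 0 <= B0.
Hypothesis B10 : 0 <= B1.
Hypothesis L0 : 0 <= L.
Hypothesis cutoff : forall s, 0 < s -> exists ch : pt -> R[i], is_cutoff B0 B1 L s ch.

(** Traces agreeing almost everywhere may be exchanged in the boundary form; this brings in the
    diagonal value [bform alpha phi phi], whose real part is nonnegative. *)
Lemma bform_eq p q : ctest p -> ctest q ->
  n2 sigma setT (fun y => bd p y - bd q y) = 0 -> bform alpha p q = bform alpha p p.
Proof.
move=> tp tq n0; have [sa _] := alpha_bound (sqint_bd tp).
have sp := sqint_bd tp; have sq := sqint_bd tq.
apply/eqP; rewrite eq_sym -subr_eq0 /bform -ipBr//.
rewrite ipC//; last exact: sqintB.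
by rewrite ip_n2_eq0 ?(cj_real 0)//; exact: sqintB.
Qed.

Let K : R := 2 + 2 * (\sum_(i < d.+1) n2 mu Omega (Du i) + n2 mu Omega u + n2 sigma setT tu).

(** [Q] is fixed before [e] and [phi]. The same [e] serves as the defect and as the interpolation
    error, so that all remainders are of the same order. *)
Lemma boundary_energy : exists2 Q, 0 <= Q & forall e phi, 0 < e -> ctest phi ->
  defect u Du tu phi <= e -> H1sq phi + n2 sigma setT (bd phi) <= K ->
  n2 sigma setT (bd phi) <= Q * e.
Proof.
have [a0 a00 roots] := spectral_root lam_im.
pose C1 := 1 + (1 + `|Re lambda|) / (2 * a0 ^+ 2).
have C10 : 0 <= C1.
  by rewrite /C1 addr_ge0// divr_ge0 ?addr_ge0// mulr_ge0// sqr_ge0.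
(* The energy of the cut-off test function: the product rule accounts for the first term, the trace
   bound [B / a0] for the second. *)
pose C2 := (2 * B0 + 2 * B1) * C1 + a0^-1.
have C20 : 0 <= C2.
  by rewrite /C2 addr_ge0 ?invr_ge0 ?(ltW a00)// mulr_ge0// addr_ge0// mulr_ge0.
(* It counts the errors in units of [sqrt e * sqrt W]: one for the derivative of the cutoff, two for
   the normal pairing, two for each tangential one, and two times [normc lambda] for the mass
   term. *)
pose D0 := 3 + 2 * d%:R + 2 * normc lambda.
have D00 : 0 <= D0 by rewrite /D0 !addr_ge0 ?mulr_ge0 ?normc_ge0.
pose Q := C * Num.sqrt C2 + D0 * Num.sqrt C1.
have Q0 : 0 <= Q by rewrite /Q addr_ge0// mulr_ge0// sqrtr_ge0.
exists (2 * (Q ^+ 2 / a0)); first by rewrite mulr_ge0// divr_ge0 ?sqr_ge0// ltW.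
move=> e phi e0 tp de eK.
have K0 : 0 <= K.
  by apply: le_trans eK; rewrite addr_ge0 ?n2_ge0// H1sq_ge0.
have [M0 sM0] := tp.2; pose M := `|M0|.
have sM : supp_in M phi by apply: supp_in_le sM0; exact: ler_norm.
have tP i : ctest (pd i phi) by exact: ctest_derive.
have sP i : supp_in M (pd i phi) by exact: supp_in_derive.
have nK i : n2 mu Omega (pd i phi) <= K.
  by apply: le_trans eK; rewrite (le_trans (n2_le_H1sq i phi))// lerDl n2_ge0.
have nK0 : n2 mu Omega phi <= K.
  by apply: le_trans eK; rewrite (le_trans (n2_le_H1sq0 phi))// lerDl n2_ge0.
have [delta [N [delta0 top er0 erj ern]]] := piecewise_linear tp e0.
have [H [cc [kap /=]]] := @galerkin_test R d N lambda a0 a00 roots phi delta tp delta0 top.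
set B := \sum_b (Re (kap b) * nsq (cc b)) => -[Hk main energy bdB null].
have tH b : ctest (H b) := (Hk b).1.
have k0 b : 0 < Re (kap b) by exact: lt_le_trans a00 (Hk b).2.
have Bge0 : 0 <= B.
  by apply: sumr_ge0 => b _; apply: mulr_ge0; [exact: ltW|exact: nsq_ge0].
have sse (c : 'I_N -> R[i]) b : sqint lebesgue_measure `]0%R, +oo[%classic (fun t => c b * prof (kap b) t).
  by apply: sqintZ => //; exact: (sqint_prof (k0 b)).1.
have spsi : sqint mu Omega (psi H cc kap).
  by apply: sqint_tsum => // b; exact: sqint_bd.
have spsin : sqint mu Omega (psin H cc kap).
  apply: sqint_tsum => // b; first exact: sqint_bd.
  exact: (sse (fun b => cc b * - cj (kap b))).
have spsit j : sqint mu Omega (psit H cc kap j).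
  by apply: sqint_tsum => // b; exact: sqint_tg.
pose W := C1 * B.
have W0 : 0 <= W by rewrite /W mulr_ge0.
have St0 : 0 <= \sum_(j < d) n2 mu Omega (psit H cc kap j) by apply: sumr_ge0 => j _; exact: n2_ge0.
have n1 : 0 <= n2 mu Omega (psi H cc kap) by exact: n2_ge0.
have n3 : 0 <= n2 mu Omega (psin H cc kap) by exact: n2_ge0.
have W1 : n2 mu Omega (psi H cc kap) <= W by apply: le_trans energy; rewrite -addrA lerDl addr_ge0.
have W2 : n2 mu Omega (psin H cc kap) <= W by apply: le_trans energy; rewrite addrAC lerDr addr_ge0.
have W3 j : n2 mu Omega (psit H cc kap j) <= W.
  apply: le_trans energy; rewrite (bigD1 j)//= addrCA lerDl !addr_ge0//.
  by apply: sumr_ge0 => i _; exact: n2_ge0.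
(* Both costs of the cutoff are at most [s ^+ 2 * Z]. Through [M] the scale [s] depends on [phi],
   which is harmless because the later constants use only [s ^+ 2 <= 1]. *)
pose Z := K * B1 + L * M ^+ 2 * K + 1.
have KB1 : 0 <= K * B1 by exact: mulr_ge0.
have LMK : 0 <= L * M ^+ 2 * K by apply: mulr_ge0 => //; apply: mulr_ge0 => //; exact: sqr_ge0.
have Z0 : 0 < Z by rewrite /Z ltr_pwDr// addr_ge0.
pose s := Num.min 1 (Num.sqrt (e / Z)).
have s0 : 0 < s by rewrite lt_min ltr01 sqrtr_gt0 divr_gt0.
have s1 : s ^+ 2 <= 1.
  by rewrite expr_le1// ?(ltW s0)// /s ge_min lexx.
have sZ : s ^+ 2 * Z <= e.
  rewrite -ler_pdivlMr// -[leRHS]sqr_sqrtr; last by rewrite divr_ge0// ltW.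
  by apply: sqr_le; [exact: ltW|rewrite /s ge_min lexx orbT].
have s2 : s ^+ 2 * (K * B1) <= e.
  by apply: le_trans sZ; rewrite ler_wpM2l ?sqr_ge0// /Z -addrA lerDl addr_ge0.
have s3 : L * (s ^+ 2 * M ^+ 2) * K <= e.
  apply: le_trans sZ; rewrite (_ : _ * K = s ^+ 2 * (L * M ^+ 2 * K)); last by ring.
  by rewrite ler_wpM2l ?sqr_ge0// /Z addrAC lerDr addr_ge0.
have [ch hch] := cutoff s0.
have [q [tq [q0 qt qn qb]]] := test_cutoff cc kap hch tH.
have scut g : sqint mu Omega g -> sqint mu Omega (fun x => ch x * g x) /\
    n2 mu Omega (fun x => ch x * g x) <= B0 * n2 mu Omega g by exact: sqint_cutoff hch.
have [sdp ndp] := sqint_dcutoff B10 hch spsi.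
have Eq : H1sq q + n2 sigma setT (bd q) <= C2 * B.
  have e1 : n2 mu Omega (pd ord_max q) <=
      2 * (s ^+ 2 * B1 * n2 mu Omega (psi H cc kap)) + 2 * (B0 * n2 mu Omega (psin H cc kap)).
    have [scn ncn] := scut _ spsin.
    have -> : n2 mu Omega (pd ord_max q) =
        n2 mu Omega (fun x => pd ord_max ch x * psi H cc kap x + ch x * psin H cc kap x).
      by apply: eq_n2 => x _; exact: qn.
    apply: le_trans (n2D_le mO sdp scn) _; apply: lerD; rewrite ler_wpM2l//.
  have e2 : \sum_(j < d) n2 mu Omega (pd (lift ord_max j) q) <=
      B0 * \sum_(j < d) n2 mu Omega (psit H cc kap j).
    rewrite mulr_sumr; apply: ler_sum => j _.
    have -> : n2 mu Omega (pd (lift ord_max j) q) = n2 mu Omega (fun x => ch x * psit H cc kap j x).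
      by apply: eq_n2 => x _; exact: qt.
    exact: (scut _ (spsit j)).2.
  have e3 : n2 mu Omega q <= B0 * n2 mu Omega (psi H cc kap).
    have -> : n2 mu Omega q = n2 mu Omega (fun x => ch x * psi H cc kap x).
      by apply: eq_n2 => x _; exact: q0.
    exact: (scut _ spsi).2.
  have e4 : n2 sigma setT (bd q) <= B / a0.
    by apply: le_trans bdB; rewrite le_eqVlt; apply/orP; left; apply/eqP/eq_n2 => y _; exact: qb.
  rewrite H1sq_split.
  have := energy_arith2 B00 B10 n1 n3 St0 s1 e1 e2 e3 e4 energy.
  by rewrite (_ : C2 * B = (2 * B0 + 2 * B1) * (C1 * B) + B / a0)// /C2; ring.
have bq : bform alpha phi q = bform alpha phi phi.
  apply: bform_eq => //; rewrite -[RHS]null; apply: eq_n2 => y _.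
  by rewrite qb.
pose R0 := ip mu Omega phi q - ip mu Omega (lint delta N phi) (psi H cc kap).
pose Rj (j : 'I_d) := ip mu Omega (pd (lift ord_max j) phi) (pd (lift ord_max j) q) -
   ip mu Omega (lint delta N (pd (lift ord_max j) phi)) (psit H cc kap j).
pose Rn := ip mu Omega (pd ord_max phi) (fun x => ch x * psin H cc kap x) -
   ip mu Omega (dint delta N phi) (psin H cc kap).
pose Rd := ip mu Omega (pd ord_max phi) (fun x => pd ord_max ch x * psi H cc kap x).
pose E := Num.sqrt e * Num.sqrt W.
have b0 : normc R0 <= 2 * E.
  have -> : R0 = ip mu Omega phi (fun x => ch x * psi H cc kap x) -
      ip mu Omega (lint delta N phi) (psi H cc kap).
    by rewrite /R0; congr (_ - _); apply: eq_ip => // x _; exact: q0.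
  exact: (pair_error B00 L0 hch tp sM (sqint_lint _ _ tp) spsi er0 W1 nK0 s3).
have bj j : normc (Rj j) <= 2 * E.
  have -> : Rj j = ip mu Omega (pd (lift ord_max j) phi) (fun x => ch x * psit H cc kap j x) -
      ip mu Omega (lint delta N (pd (lift ord_max j) phi)) (psit H cc kap j).
    by rewrite /Rj; congr (_ - _); apply: eq_ip => // x _; exact: qt.
  exact: (pair_error B00 L0 hch (tP _) (sP _) (sqint_lint _ _ (tP _)) (spsit j) (erj _) (W3 j) (nK _) s3).
have bn : normc Rn <= 2 * E.
  exact: (pair_error B00 L0 hch (tP _) (sP _) (sqint_dint _ _ tp) spsin ern W2 (nK _) s3).
have bd' : normc Rd <= E.
  have sPn : sqint mu Omega (pd ord_max phi) by exact: ctest_sqint.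
  apply: le_trans (normc_le_sqrt (n2_ge0 _ _ _) (CauchySchwarz mO sPn sdp)) _.
  apply: sqrt_le_mul; rewrite ?n2_ge0 ?(ltW e0)//.
  have sB0 : 0 <= s ^+ 2 * B1 by apply: mulr_ge0 => //; exact: sqr_ge0.
  apply: (@le_trans _ _ (K * (s ^+ 2 * B1 * W))).
    by rewrite ler_pM ?n2_ge0// (le_trans ndp)// ler_wpM2l.
  by rewrite (_ : K * _ = s ^+ 2 * (K * B1) * W) ?ler_wpM2r//; ring.
have tot : dform phi q - lambda * ip mu Omega phi q + bform alpha phi q =
   (ip mu Omega (dint delta N phi) (psin H cc kap) +
     \sum_(j < d) ip mu Omega (lint delta N (pd (lift ord_max j) phi)) (psit H cc kap j) -
     lambda * ip mu Omega (lint delta N phi) (psi H cc kap)) +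
   (Rd + Rn + \sum_(j < d) Rj j - lambda * R0) + bform alpha phi phi.
  have en : ip mu Omega (pd ord_max phi) (pd ord_max q) =
      Rd + ip mu Omega (pd ord_max phi) (fun x => ch x * psin H cc kap x).
    rewrite /Rd -(ipDr mO sdp (scut _ spsin).1 (ctest_sqint mO (tP ord_max))).
    by apply: eq_ip => // x _; exact: qn.
  rewrite dform_split en bq /Rj sumrB /R0 /Rn; exact: form_arith.
have main2 : B <= Q * Num.sqrt e * Num.sqrt B.
  have wk := weak tp tq.
  rewrite tot in wk.
  set X := Rd + Rn + _ - _ in wk.
  have nX : normc X <= D0 * E.
    have x1 : normc (\sum_(j < d) Rj j) <= 2 * d%:R * E.
      apply: le_trans (normc_sum _ _) _.
      apply: (@le_trans _ _ (\sum_(j < d) (2 * E))); first by apply: ler_sum => j _; exact: bj.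
      by rewrite sumr_const card_ord -[leLHS]mulr_natr mulrAC.
    have x2 : normc (- (lambda * R0)) <= normc lambda * (2 * E).
      rewrite normcMN; apply: ler_wpM2l => //; exact: normc_ge0.
    have := le_normcD (Rd + Rn + \sum_(j < d) Rj j) (- (lambda * R0)).
    have := le_normcD (Rd + Rn) (\sum_(j < d) Rj j).
    have := le_normcD Rd Rn.
    exact: sum_arith bd' bn x1 x2.
  have wk2 := le_trans wk (weak_arith C0 (ltW e0) C20 Bge0 de Eq).
  have EE : E = Num.sqrt e * (Num.sqrt C1 * Num.sqrt B) by rewrite /E /W sqrtrM.
  rewrite EE in nX.
  exact: (main_arith main (Bpos tp) wk2 nX).
have BQ : B <= (Q * Num.sqrt e) ^+ 2.
  by apply: le_of_sqrt => //; rewrite mulr_ge0// sqrtr_ge0.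
rewrite exprMn sqr_sqrtr ?(ltW e0)// in BQ.
have sb := sqint_bd tp.
have sS : sqint sigma setT (fun y => \sum_b cc b * bd (H b) y).
  by apply: (sqint_sum measurableT) => b; apply: (sqintZ measurableT); exact: sqint_bd.
apply: le_trans (n2_sub_le measurableT sb sS) _.
rewrite null mulr0 add0r -[leRHS]mulrA ler_wpM2l// (le_trans bdB)//.
by rewrite mulrAC ler_wpM2r ?invr_ge0// ltW.
Qed.

Lemma complex_zero : {ae mu, forall x, Omega x -> u x = 0}.
Proof.
have [Q Q0 hQ] := boundary_energy.
apply: n2_eq0 => //; set l := `|Im lambda|.
have l0 : 0 < l by rewrite normr_gt0.
have K0 : 0 <= K.
  rewrite /K addr_ge0// mulr_ge0// !addr_ge0 ?n2_ge0//.
  by apply: sumr_ge0 => i _; exact: n2_ge0.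
pose Y := C * Num.sqrt K + Num.sqrt Ca * Q.
have Y0 : 0 <= Y by rewrite /Y addr_ge0// mulr_ge0// sqrtr_ge0.
pose Z := 2 + 2 * (Y / l).
have Z0 : 0 < Z by rewrite /Z ltr_pwDl// mulr_ge0// divr_ge0// ltW.
(* The defect is taken to be [h ^+ 2], so the remainder in the weak equation is of order [h]; the
   boundary form, of order [h ^+ 2], is bounded by the same order. *)
have key h : 0 < h -> h <= 1 -> n2 mu Omega u <= Z * h.
  move=> h0 h1; have e0 : 0 < h ^+ 2 by rewrite exprn_gt0.
  have e1 : h ^+ 2 <= h by rewrite expr2 ler_piMr// ltW.
  have [phi [tp de]] := approx e0.
  have eK : H1sq phi + n2 sigma setT (bd phi) <= K.
    by apply: (energy_bound su sDu stu tp); rewrite (le_trans de)// (le_trans e1).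
  have nb : n2 sigma setT (bd phi) <= Q * h by rewrite (le_trans (hQ _ _ e0 tp de eK))// ler_wpM2l.
  have sb := sqint_bd tp; have [sab nab] := alpha_bound sb.
  have bb : normc (bform alpha phi phi) <= Num.sqrt Ca * (Q * h).
    apply: le_trans (normc_le_sqrt (n2_ge0 _ _ _) (CauchySchwarz measurableT sab sb)) _.
    apply: (@le_trans _ _ (Num.sqrt Ca * n2 sigma setT (bd phi))); last first.
      by rewrite ler_wpM2l// sqrtr_ge0.
    rewrite -[X in _ <= _ * X]sqr_sqrtr ?n2_ge0// expr2 mulrA ler_wpM2r ?sqrtr_ge0//.
    by rewrite -sqrtrM// ler_wsqrtr.
  have wk := weak tp tp.
  have wb : C * Num.sqrt (defect u Du tu phi) * Num.sqrt (H1sq phi + n2 sigma setT (bd phi)) <=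
      C * h * Num.sqrt K.
    apply: ler_pM; rewrite ?mulr_ge0 ?sqrtr_ge0//.
      by rewrite ler_wpM2l//; apply: sqrtr_le => //; exact: ltW.
    by rewrite ler_wsqrtr.
  have sp : sqint mu Omega phi by exact: ctest_sqint.
  (* The Dirichlet part is real, so the imaginary part of the equation at [q = phi] isolates
     [Im lambda] times the squared norm of [phi]. *)
  have im0 : Im (dform phi phi) = 0.
    by rewrite /dform Im_sum big1// => i _; rewrite ip_n2.
  have nphi : l * n2 mu Omega phi <= Y * h.
    by apply: (im_arith (n2_ge0 _ _ _) im0 (le_trans wk wb) _ bb); rewrite ip_n2.
  have up : n2 mu Omega u <= 2 * h + 2 * n2 mu Omega phi.
    rewrite (le_trans (n2_sub_le mO su sp))// lerD2r ler_wpM2l//.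
    rewrite (le_trans _ (le_trans (le_trans (defect_u u Du tu phi) de) e1))//.
    rewrite le_eqVlt; apply/orP; left; apply/eqP.
    by rewrite -n2N; apply: eq_n2 => x _; rewrite opprB.
  apply: (le_trans up); rewrite (_ : Z * h = 2 * h + 2 * (Y / l * h)); last by rewrite /Z; ring.
  by rewrite lerD2l ler_wpM2l// mulrAC ler_pdivlMr// mulrC.
apply/eqP; rewrite eq_le n2_ge0 andbT; apply/ler_addgt0Pl => e e0; rewrite addr0.
pose h := Num.min 1 (e / Z).
have h0 : 0 < h by rewrite lt_min ltr01 divr_gt0.
have h1 : h <= 1 by rewrite /h ge_min lexx.
apply: le_trans (key h h0 h1) _.
by rewrite mulrC -ler_pdivlMr// /h ge_min lexx orbT.
Qed.

End complex_case.

(** * Absence of eigenvectors *)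

Section no_eigenvalue.
Variables (R : realType) (d : nat).
Local Notation Rd := 'rV[R]_d.
Local Notation pt := (Rd * R)%type.
Local Notation mu := (lebesgue_rV d \x lebesgue_measure)%E.
Local Notation sigma := (lebesgue_rV d).
Local Notation Omega := (@half_space R d).

Let mO : @measurable _ (Rd * g_sigma_algebraType (R.-ocitv.-measurable))%type Omega := @measurable_half_space R d.

Lemma Re_ip_ge0 (alpha f : Rd -> R[i]) : cmeasurable setT alpha ->
  {ae sigma, forall x, 0 <= Re (alpha x)} -> sqint sigma setT f ->
  0 <= Re (ip sigma setT (fun y => alpha y * f y) f).
Proof.
move=> ma a0 sf; rewrite /ip /cintegral /=.
have mf := cmeasurable_nsq sf.1.
have E y : Re (alpha y * f y * cj (f y)) = Re (alpha y) * nsq (f y).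
  by rewrite -mulrA mulcJ_nsq ReM /= mulr0 subr0.
rewrite /Rintegral; apply: fine_ge0.
(* The sign of [Re alpha] is known only almost everywhere; its positive part is nonnegative
   everywhere and gives the same integral. *)
rewrite (@ae_eq_integral _ _ _ sigma setT (fun y => (Num.max 0 (Re (alpha y)) * nsq (f y))%:E))//.
- by apply: integral_ge0 => y _; rewrite lee_fin mulr_ge0 ?nsq_ge0// le_max lexx.
- apply/measurable_EFinP; under eq_fun do rewrite E.
  by apply: measurable_funM => //; exact: ma.1.
- apply/measurable_EFinP; apply: measurable_funM => //.
  by apply: measurable_maxr => //; exact: ma.1.
- apply: filterS a0 => y h _; rewrite E.
  by rewrite (max_idPr h).
Qed.

Lemma no_eigenvector (alpha : Rd -> R[i]) lambda (u : pt -> R[i]) :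
  in_Lp sigma setT +oo%E alpha -> {ae sigma, forall x, 0 <= Re (alpha x)} ->
  robin_laplacian alpha u (fun x => lambda * u x) ->
  {ae mu, forall x, Omega x -> u x = 0}.
Proof.
move=> aoo a0 Hu.
have su : sqint mu Omega u by have [_ [Du [tu [[Lu _] _ _]]]] := Hu; exact: in_Lp_sqint.
have [Du [tu [sDu stu approx [C C0 weak]]]] := robin_approx aoo Hu su.
have [ma [Ca [Ca0 aC]]] := in_Lpoo_bound aoo.
have ab (f : Rd -> R[i]) : sqint sigma setT f -> sqint sigma setT (fun y => alpha y * f y) /\
    n2 sigma setT (fun y => alpha y * f y) <= Ca * n2 sigma setT f.
  by move=> sf; exact: (sqint_ae_bound _ Ca0 ma aC sf).
have Bpos p : ctest p -> 0 <= Re (bform alpha p p).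
  by move=> tp; apply: Re_ip_ge0 => //; exact: sqint_bd.
have [l0|l0] := eqVneq (Im lambda) 0.
  apply: normal_small_zero => // e e0.
  have [phi [tp de ne]] := normal_small su sDu stu approx C0 weak Bpos l0 e0.
  by exists phi; split => //; apply: le_trans de; exact: defect_u.
(* A nonzero test function is the raw material of the cutoff. If there were none, [u] would be
   approximated by zero functions only and would vanish as well. *)
have [[theta [x0 [tt tn]]]|no] := pselect (exists (theta : pt -> R[i]) x0, ctest theta /\ theta x0 != 0).
  have [B0 [B1 [L [B00 B10 L0 cut]]]] := cutoff_exists tt tn.
  exact: (complex_zero su sDu stu approx C0 weak Bpos Ca0 ab l0 B00 B10 L0 cut).
apply: n2_eq0 => //; apply/eqP; rewrite eq_le n2_ge0 andbT; apply/ler_addgt0Pl => e e0.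
have [phi [tp de]] := approx e e0; rewrite addr0.
apply: le_trans (le_trans (defect_u u Du tu phi) de); rewrite le_eqVlt; apply/orP; left; apply/eqP.
rewrite -n2N; apply: eq_n2 => x _.
have -> : phi x = 0 by apply/eqP/negP => /negP h; apply: no; exists phi, x.
by rewrite sub0r.
Qed.

End no_eigenvalue.

Theorem theorem1p2 (R : realType) (n : nat) (alpha : 'rV[R]_(n.-1) -> R[i]) :
  (3 <= n)%N ->
  in_Lp (lebesgue_rV n.-1) setT +oo%E alpha ->
  {ae lebesgue_rV n.-1, forall x,
     `|complex.Im (alpha x)| <= complex.Re (alpha x)} ->
  (exists b1 b2 : R,
    [/\ 0 <= b1, 0 <= b2,
      (2%:E * leibniz_constant R n.-1 *
         (b1%:E + sobolev_constant R n.-1 * b2%:E) < 1%:E)%E,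
      (vLnorm +oo (xmul alpha) <= b1%:E)%E &
      exists G : 'rV[R]_(n.-1) -> 'rV[R[i]]_(n.-1),
        is_vquarter_laplacian (xmul alpha) G /\
        (vLnorm (2 * n.-1)%:R%:E G <= b2%:E)%E]) ->
  point_spectrum (robin_laplacian alpha) = set0.
Proof.
move=> _ aoo a0 _; apply/seteqP; split=> // lambda [u [Hu nz]]; apply: nz.
apply: (no_eigenvector aoo) Hu; apply: filterS a0 => x; exact: le_trans.
Qed.
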